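(* Let $\mathbb{X}$ be a uniformly convex Banach space of convexity power type $p\in[2,\infty)$. If $\Sigma\subset\mathbb{X}$ is connected and $\mathscr{H}$ is a multiresolution family for $\Sigma$ with inflation factor $A_{\mathscr{H}}>1$, then $$S_{\Sigma,p}(\mathscr{H})=\mathrm{diam}\,\Sigma+\sum_{Q\in\mathscr{H}}\beta_\Sigma(Q)^p\,\mathrm{diam}\,Q\leq C\,\mathcal{H}^1(\Sigma),$$ where $C<\infty$ depends only on $p$, the modulus of convexity $\delta_{\mathbb{X}}$, and $A_{\mathscr{H}}$.
   Context: All Banach spaces are real of dimension at least 2. The modulus of convexity of $\mathbb{X}$ is $\delta_{\mathbb{X}}(\epsilon)=\inf\{1-\tfrac12|x+y|:|x|=|y|=1,\ |x-y|\geq\epsilon\}$ for $\epsilon\in[0,2]$. $\mathbb{X}$ is uniformly convex if $\delta_{\mathbb{X}}(\epsilon)>0$ for all $\epsilon\in(0,2]$, and of convexity power type $p\in[2,\infty)$ if there is $c>0$ with $\delta_{\mathbb{X}}(\epsilon)\geq c\epsilon^p$ for all $\epsilon\in(0,2]$. For a nonempty set $E\subset\mathbb{X}$ and a set $Q\subset\mathbb{X}$ of positive diameter, the Jones beta number is $\beta_E(Q)=\inf_L\sup_{x\in E\cap Q}\mathrm{dist}(x,L)/\mathrm{diam}\,Q$ if $E\cap Q\neq\emptyset$, where $L$ ranges over all one-dimensional affine subspaces (lines) of $\mathbb{X}$, and $\beta_E(Q)=0$ if $E\cap Q=\emptyset$. For $\rho>0$, a $\rho$-net for $E$ is a set $X\subset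 E$ such that $|y-z|\geq\rho$ for all distinct $y,z\in X$ and $\mathrm{dist}(x,X)<\rho$ for all $x\in E$. A multiresolution family for $E$ with inflation factor $A>1$ is the collection of closed balls $\mathscr{G}=\{B(x,A2^{-k}):x\in X_k,\ k\in\mathbb{Z}\}$ (indexed by the pairs $(k,x)$), where $(X_k)_{k\in\mathbb{Z}}$ is a nested family ($X_k\subset X_{k+1}$) and each $X_k$ is a $2^{-k}$-net for $E$. $\mathcal{H}^1$ is one-dimensional Hausdorff measure. *)

(* Defs.v *)
From Stdlib Require Import Reals Lra List ClassicalEpsilon.
Open Scope R_scope.

Record Banach := {
  Bcar :> Type;
  Bzero : Bcar;
  Badd : Bcar -> Bcar -> Bcar;
  Bopp : Bcar -> Bcar;
  Bscal : R -> Bcar -> Bcar;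
  Bnorm : Bcar -> R;
  Badd_assoc : forall x y z, Badd x (Badd y z) = Badd (Badd x y) z;
  Badd_comm : forall x y, Badd x y = Badd y x;
  Badd_zero : forall x, Badd x Bzero = x;
  Badd_opp : forall x, Badd x (Bopp x) = Bzero;
  Bscal_addr : forall a x y, Bscal a (Badd x y) = Badd (Bscal a x) (Bscal a y);
  Bscal_addl : forall a b x, Bscal (a + b) x = Badd (Bscal a x) (Bscal b x);
  Bscal_assoc : forall a b x, Bscal a (Bscal b x) = Bscal (a * b) x;
  Bscal_one : forall x, Bscal 1 x = x;
  Bnorm_eq0 : forall x, Bnorm x = 0 -> x = Bzero;
  Bnorm_scal : forall a x, Bnorm (Bscal a x) = Rabs a * Bnorm x;
  Bnorm_triangle : forall x y, Bnorm (Badd x y) <= Bnorm x + Bnorm y;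
  Bcomplete : forall u : nat -> Bcar,
    (forall eps, eps > 0 -> exists N, forall n m, (n >= N)%nat -> (m >= N)%nat ->
        Bnorm (Badd (u n) (Bopp (u m))) < eps) ->
    exists l, forall eps, eps > 0 -> exists N, forall n, (n >= N)%nat ->
        Bnorm (Badd (u n) (Bopp l)) < eps;
  Bdim2 : exists u v : Bcar, forall a b,
    Badd (Bscal a u) (Bscal b v) = Bzero -> a = 0 /\ b = 0
}.

Arguments Bzero {_}. Arguments Badd {_}. Arguments Bopp {_}.
Arguments Bscal {_}. Arguments Bnorm {_}.

Definition Bsub {X : Banach} (x y : X) : X := Badd x (Bopp y).
Definition Bdist {X : Banach} (x y : X) : R := Bnorm (Bsub x y).

Definition is_glb (S : R -> Prop) (m : R) : Prop :=
  (forall t, S t -> m <= t) /\ (forall m', (forall t, S t -> m' <= t) -> m' <= m).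

Definition Rsup (S : R -> Prop) : R := epsilon (inhabits 0) (is_lub S).
Definition Rinf (S : R -> Prop) : R := epsilon (inhabits 0) (is_glb S).

Definition is_modulus_of_convexity (X : Banach) (delta0 : R -> R) : Prop :=
  forall eps, 0 <= eps <= 2 ->
    is_glb (fun t => exists x y : X, Bnorm x = 1 /\ Bnorm y = 1 /\
               Bdist x y >= eps /\ t = 1 - Bnorm (Badd x y) / 2) (delta0 eps).

Definition uniformly_convex_mod (delta0 : R -> R) : Prop :=
  forall eps, 0 < eps <= 2 -> delta0 eps > 0.

Definition convexity_power_type (delta0 : R -> R) (p : R) : Prop :=
  exists c, c > 0 /\ forall eps, 0 < eps <= 2 -> delta0 eps >= c * Rpower eps p.

Definition rpow (x p : R) : R := if Req_EM_T x 0 then 0 else Rpower x p.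

Definition diam {X : Banach} (Q : X -> Prop) : R :=
  Rsup (fun t => exists x y, Q x /\ Q y /\ t = Bdist x y).

Definition closed_ball {X : Banach} (c : X) (r : R) : X -> Prop :=
  fun y => Bdist y c <= r.

Definition is_open {X : Banach} (U : X -> Prop) : Prop :=
  forall x, U x -> exists r, r > 0 /\ forall y, Bdist y x < r -> U y.

Definition connected {X : Banach} (E : X -> Prop) : Prop :=
  ~ exists U V : X -> Prop, is_open U /\ is_open V /\
      (forall x, E x -> U x \/ V x) /\
      (exists x, E x /\ U x) /\ (exists x, E x /\ V x) /\
      (forall x, E x -> U x -> V x -> False).

Definition dist_line {X : Banach} (x a v : X) : R :=
  Rinf (fun t => exists s, t = Bdist x (Badd a (Bscal s v))).

Definition beta {X : Banach} (E Q : X -> Prop) : R :=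
  if excluded_middle_informative (exists x, E x /\ Q x) then
    Rinf (fun b => exists a v : X, v <> Bzero /\
            b = Rsup (fun t => exists x, E x /\ Q x /\ t = dist_line x a v) / diam Q)
  else 0.

Definition is_net {X : Banach} (E : X -> Prop) (rho : R) (N : X -> Prop) : Prop :=
  (forall y, N y -> E y) /\
  (forall y z, N y -> N z -> y <> z -> Bdist y z >= rho) /\
  (forall x, E x -> exists y, N y /\ Bdist x y < rho).

Definition multires_nets {X : Banach} (E : X -> Prop) (Xk : Z -> X -> Prop) : Prop :=
  (forall k x, Xk k x -> Xk (k + 1)%Z x) /\
  (forall k, is_net E (powerRZ 2 (- k)) (Xk k)).

Definition mr_ball {X : Banach} (A : R) (kx : Z * X) : X -> Prop :=
  closed_ball (snd kx) (A * powerRZ 2 (- fst kx)).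

Definition beta_sum {X : Banach} (E : X -> Prop) (p A : R) (F : list (Z * X)) : R :=
  fold_right (fun kx acc =>
      rpow (beta E (mr_ball A kx)) p * diam (mr_ball A kx) + acc) 0 F.

(* H^1(E) = sup_{delta>0} inf { sum_i diam U_i : E ⊂ ∪_i U_i, diam U_i <= delta } *)
Definition H1_le {X : Banach} (E : X -> Prop) (M : R) : Prop :=
  forall delta eps, delta > 0 -> eps > 0 ->
    exists (U : nat -> X -> Prop) (d : nat -> R),
      (forall x, E x -> exists i, U i x) /\
      (forall i, 0 <= d i <= delta) /\
      (forall i x y, U i x -> U i y -> Bdist x y <= d i) /\
      (forall n, sum_f_R0 d n <= M + eps).

(* Main.v *)
Require Import Defs.
From Stdlib Require Import Reals List.
From Stdlib Require Import Lra Lia Psatz Permutation ClassicalEpsilon Classical Arith ZArith.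
Open Scope R_scope.

(** The walk.  Since [Sigma] is connected, a [rho]-net of it has at most [4 M / rho] points and a walk
    with steps of size [O(rho)] visits them all in [O(M / rho)] steps; for small [rho] only the
    discrete walk matters.

    Curved arcs.  In a hierarchy of nested arcs of the walk the excesses (length of the polygon of
    children minus chord) telescope to at most the length of the walk.  Uniform convexity of power type
    [p] bounds the deviation of an arc of size [s] from its chord by a multiple of
    [s (W / s)^(1/p)], where [W] is a geometrically weighted sum of the excesses below the arc; this
    pays for every ball whose central arc is not flat.  A second hierarchy, with vertices in the
    middle of the arcs of the first, takes care of balls centred near a vertex.

    Flat arcs.  If the central arc of a ball of radius [R] is flat compared to [b = beta], then some
    other point of the walk is far from it, and covering the walk in the ball by sets smaller than
    [b R] costs [2 R + c b R].  Replacing these sets by one set of diameter about [2 R] saves [c b R],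
    so the balls of one scale are paid for by the difference of the (discretized) Hausdorff contents
    at scales [b R] and [R], and these differences telescope.  The [log (1 / b)] scales in between
    cost a factor which is harmless because [p > 1].  Net points need not have boundedly many
    neighbours in infinite dimension, but crowded groups are paid for by the same merging. *)

(** * Linear combinations, norms and real powers *)

(** The constants must not see the walk. The ball sum is a supremum over finite subfamilies, and
    such a subfamily has a smallest radius and a smallest positive beta; the mesh [rho] is chosen
    after them. Every estimate is by a multiple of the number of indices times the step size, which
    packing bounds by a multiple of [M] for all small [rho]. The root of order p dictates the shape
    of the arc hierarchy. Passing to a child arc divides the size s by 32 and may double the
    weighted excess W, so W / s grows by at most 64; since p >= 2 its root grows by at most 8, and
    the deviation inherited from the child comes with the factor 8 / 32. Without the geometric
    weights an excess would be counted again on every level above it. For a flat arc b^p R is, up to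
    a constant, at most b (b R): one factor b R is what merging saves, the other b outweighs the
    number of scales between b R and R. Arcs at the ends of the walk may be too short for both
    arguments. At each scale there are at most three kinds of them, charged min(R, l^2 / R) with l
    the length of the walk, which is geometric on both sides of l. *)

Inductive vexpr :=
| VVar (n : nat) | VZero | VAdd (a b : vexpr) | VOpp (a : vexpr) | VScal (r : R) (a : vexpr).

Fixpoint vden {X : Banach} (env : list X) (e : vexpr) : X :=
  match e with
  | VVar n => nth n env Bzero
  | VZero => Bzero
  | VAdd a b => Badd (vden env a) (vden env b)
  | VOpp a => Bopp (vden env a)
  | VScal r a => Bscal r (vden env a)
  end.

Fixpoint vcoef (n : nat) (e : vexpr) : R :=
  match e with
  | VVar m => if Nat.eqb m n then 1 else 0
  | VZero => 0
  | VAdd a b => vcoef n a + vcoef n b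
  | VOpp a => - vcoef n a
  | VScal r a => r * vcoef n a
  end.

Section VectorSpace.
Context {X : Banach}.
Implicit Types x y z : X.

Lemma Badd_cancel x y z : Badd x y = Badd x z -> y = z.
Proof.
  intros H.
  assert (E : forall t : X, Badd (Bopp x) (Badd x t) = t).
  { intros t. rewrite Badd_assoc, (Badd_comm _ (Bopp x)), Badd_opp, Badd_comm. apply Badd_zero. }
  rewrite <- (E y), <- (E z), H. reflexivity.
Qed.

Lemma Bscal_0 x : Bscal 0 x = Bzero.
Proof.
  apply (Badd_cancel (Bscal 0 x)). rewrite <- Bscal_addl, Rplus_0_l, Badd_zero. reflexivity.
Qed.

Lemma Bscal_zero (a : R) : Bscal a (Bzero : X) = Bzero.
Proof. rewrite <- (Bscal_0 Bzero), Bscal_assoc, Rmult_0_r. reflexivity. Qed.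

Lemma Bopp_scal x : Bopp x = Bscal (-1) x.
Proof.
  apply (Badd_cancel x). rewrite Badd_opp.
  transitivity (Badd (Bscal 1 x) (Bscal (-1) x)); [|rewrite Bscal_one; reflexivity].
  rewrite <- Bscal_addl. replace (1 + -1) with 0 by ring. symmetry; apply Bscal_0.
Qed.

Fixpoint vcomb (env : list X) (c : nat -> R) : X :=
  match env with
  | nil => Bzero
  | v :: env' => Badd (Bscal (c 0%nat) v) (vcomb env' (fun n => c (S n)))
  end.

Lemma Badd_swap x y z (w : X) : Badd (Badd x y) (Badd z w) = Badd (Badd x z) (Badd y w).
Proof.
  rewrite <- !Badd_assoc. f_equal. rewrite !Badd_assoc. f_equal. apply Badd_comm.
Qed.

Lemma vcomb_add env c c' :
  Badd (vcomb env c) (vcomb env c') = vcomb env (fun n => c n + c' n).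
Proof.
  revert c c'; induction env as [|v env IH]; intros c c'; simpl.
  - apply Badd_zero.
  - rewrite Badd_swap, IH, Bscal_addl. reflexivity.
Qed.

Lemma vcomb_scal env r c : Bscal r (vcomb env c) = vcomb env (fun n => r * c n).
Proof.
  revert c; induction env as [|v env IH]; intros c; simpl.
  - apply Bscal_zero.
  - rewrite Bscal_addr, IH, Bscal_assoc. reflexivity.
Qed.

Lemma vcomb_ext env c c' : (forall n, (n < length env)%nat -> c n = c' n) -> vcomb env c = vcomb env c'.
Proof.
  revert c c'; induction env as [|v env IH]; intros c c' H; simpl; [reflexivity|].
  rewrite (H 0%nat) by (simpl; lia). f_equal. apply IH. intros n Hn. apply H. simpl; lia.
Qed.

Lemma vcomb_0 env c : (forall n, c n = 0) -> vcomb env c = Bzero.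
Proof.
  revert c; induction env as [|v env IH]; intros c H; simpl; [reflexivity|].
  rewrite H, Bscal_0, IH by (intros; apply H). apply Badd_zero.
Qed.

Lemma vcomb_var env n : nth n env Bzero = vcomb env (fun m => if Nat.eqb n m then 1 else 0).
Proof.
  revert n; induction env as [|v env IH]; intros n; simpl; [destruct n; reflexivity|].
  destruct n as [|n]; simpl.
  - rewrite vcomb_0 by reflexivity. rewrite Badd_zero, Bscal_one. reflexivity.
  - rewrite Bscal_0, Badd_comm, Badd_zero. apply IH.
Qed.

Lemma vden_comb (env : list X) e : vden env e = vcomb env (fun n => vcoef n e).
Proof.
  induction e as [n| |a IHa b IHb|a IHa|r a IHa]; simpl.
  - apply vcomb_var.
  - symmetry; apply vcomb_0; reflexivity.
  - rewrite IHa, IHb. apply vcomb_add.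
  - rewrite IHa, Bopp_scal, vcomb_scal. apply vcomb_ext. intros; ring.
  - rewrite IHa. apply vcomb_scal.
Qed.

(** Recursion on [n] lets [simpl] and [repeat split] turn the comparison of coefficients into
    finitely many scalar goals. *)
Fixpoint all_below (n : nat) (P : nat -> Prop) : Prop :=
  match n with O => True | S m => P m /\ all_below m P end.

Lemma vden_eq (env : list X) e e' :
  all_below (length env) (fun n => vcoef n e = vcoef n e') -> vden env e = vden env e'.
Proof.
  intros H. rewrite !vden_comb. apply vcomb_ext. revert H.
  generalize (length env). induction n as [|m IH]; simpl; intros H k Hk; [lia|].
  destruct H as [H0 H1]. destruct (Nat.eq_dec k m) as [->|]; [exact H0|apply IH; [exact H1|lia]].
Qed.
End VectorSpace.

Ltac vmem x l := lazymatch l with nil => constr:(false) | x :: _ => constr:(true) | _ :: ?l' => vmem x l' end.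
Ltac vidx x l := lazymatch l with x :: _ => constr:(O) | _ :: ?l' => let n := vidx x l' in constr:(S n) end.
Ltac vvars e l :=
  lazymatch e with
  | Badd ?a ?b => let l1 := vvars a l in vvars b l1
  | Bsub ?a ?b => let l1 := vvars a l in vvars b l1
  | Bopp ?a => vvars a l
  | Bscal _ ?a => vvars a l
  | Bzero => l
  | _ => lazymatch vmem e l with true => l | false => constr:(e :: l) end
  end.
Ltac vreify e l :=
  lazymatch e with
  | Badd ?a ?b => let x := vreify a l in let y := vreify b l in constr:(VAdd x y)
  | Bsub ?a ?b => let x := vreify a l in let y := vreify b l in constr:(VAdd x (VOpp y))
  | Bopp ?a => let x := vreify a l in constr:(VOpp x)
  | Bscal ?r ?a => let x := vreify a l in constr:(VScal r x)
  | Bzero => constr:(VZero)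
  | _ => let n := vidx e l in constr:(VVar n)
  end.
(* Decides equality of linear combinations of vectors by comparing coefficients; the remaining
   scalar identities are left to [ring] or, when a division is involved, to the user. *)
Ltac vlin :=
  unfold Bsub;
  lazymatch goal with
  | |- @eq (Bcar ?X) ?a ?b =>
      let l0 := constr:(@nil (Bcar X)) in
      let l1 := vvars a l0 in let l := vvars b l1 in
      let x := vreify a l in let y := vreify b l in
      change (@vden X l x = @vden X l y); apply vden_eq; simpl; repeat split; try ring
  end.

Section Norm.
Context {X : Banach}.
Implicit Types x y z : X.

Lemma Bnorm_zero : Bnorm (Bzero : X) = 0.
Proof. rewrite <- (Bscal_0 Bzero), Bnorm_scal, Rabs_R0. ring. Qed.

Lemma Bnorm_opp x : Bnorm (Bopp x) = Bnorm x.
Proof. rewrite Bopp_scal, Bnorm_scal, Rabs_left by lra. ring. Qed.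

Lemma Bnorm_nonneg x : 0 <= Bnorm x.
Proof.
  pose proof (Bnorm_triangle _ x (Bopp x)) as H.
  rewrite Badd_opp, Bnorm_zero, Bnorm_opp in H. lra.
Qed.

Lemma Bdist_nonneg x y : 0 <= Bdist x y.
Proof. apply Bnorm_nonneg. Qed.

Lemma Bdist_refl x : Bdist x x = 0.
Proof. unfold Bdist, Bsub. rewrite Badd_opp. apply Bnorm_zero. Qed.

Lemma Bdist_sym x y : Bdist x y = Bdist y x.
Proof.
  unfold Bdist. rewrite <- Bnorm_opp. f_equal. vlin.
Qed.

Lemma Bdist_triangle x y z : Bdist x z <= Bdist x y + Bdist y z.
Proof.
  unfold Bdist. replace (Bsub x z) with (Badd (Bsub x y) (Bsub y z)) by vlin.
  apply Bnorm_triangle.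
Qed.

Lemma Bdist_eq0 x y : Bdist x y = 0 -> x = y.
Proof.
  intros H. apply Bnorm_eq0 in H. transitivity (Badd (Bsub x y) y); [vlin|rewrite H; vlin].
Qed.

Lemma Bdist_pos x y : x <> y -> 0 < Bdist x y.
Proof.
  intros H. destruct (Rle_lt_or_eq_dec 0 (Bdist x y) (Bdist_nonneg x y)) as [|E]; [assumption|].
  exfalso. apply H. apply Bdist_eq0. lra.
Qed.

Lemma Bnorm_scal_nonneg a x : 0 <= a -> Bnorm (Bscal a x) = a * Bnorm x.
Proof. intros H. rewrite Bnorm_scal, Rabs_pos_eq by assumption. reflexivity. Qed.
End Norm.

(** * Powers and roots of nonnegative reals *)

Section RealPower.

Lemma rpow_nonneg x p : 0 <= rpow x p.
Proof. unfold rpow. destruct (Req_EM_T x 0); [lra|]. unfold Rpower. left; apply exp_pos. Qed.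

Lemma rpow_0 p : rpow 0 p = 0.
Proof. unfold rpow. destruct (Req_EM_T 0 0); lra. Qed.

Lemma rpow_pos_eq x p : 0 < x -> rpow x p = Rpower x p.
Proof. intros H. unfold rpow. destruct (Req_EM_T x 0); [lra|reflexivity]. Qed.

Lemma rpow_pos x p : 0 < x -> 0 < rpow x p.
Proof. intros H. rewrite rpow_pos_eq by assumption. apply exp_pos. Qed.

Lemma rpow_1 p : rpow 1 p = 1.
Proof. rewrite rpow_pos_eq by lra. unfold Rpower. rewrite ln_1, Rmult_0_r. apply exp_0. Qed.

Lemma rpow_le x y p : 0 <= p -> 0 <= x <= y -> rpow x p <= rpow y p.
Proof.
  intros Hp [[Hx|<-] Hy].
  - rewrite !rpow_pos_eq by lra. apply Rle_Rpower_l; lra.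
  - rewrite rpow_0. apply rpow_nonneg.
Qed.

Lemma rpow_mult x y p : 0 <= x -> 0 <= y -> rpow (x * y) p = rpow x p * rpow y p.
Proof.
  intros [Hx|<-] [Hy|<-]; try (rewrite ?Rmult_0_l, ?Rmult_0_r, ?rpow_0; ring).
  rewrite !rpow_pos_eq by nra. symmetry. apply Rpower_mult_distr; lra.
Qed.

Lemma rpow_rpow x p q : 0 <= x -> rpow (rpow x p) q = rpow x (p * q).
Proof.
  intros [Hx|<-]; [|rewrite !rpow_0; reflexivity].
  rewrite (rpow_pos_eq x p), (rpow_pos_eq x (p*q)) by assumption.
  rewrite rpow_pos_eq by apply exp_pos. apply Rpower_mult.
Qed.

Lemma rpow_one x : 0 <= x -> rpow x 1 = x.
Proof. intros [Hx|<-]; [rewrite rpow_pos_eq by assumption; apply Rpower_1; lra|apply rpow_0]. Qed.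

Lemma rpow_exp_anti x p q : 0 <= x <= 1 -> p <= q -> rpow x q <= rpow x p.
Proof.
  intros [[Hx|<-] H1] Hpq; [|rewrite !rpow_0; lra].
  rewrite !rpow_pos_eq by assumption. unfold Rpower.
  assert (ln x <= 0) by (rewrite <- ln_1; destruct H1 as [H1| ->]; [left; apply ln_increasing; lra|lra]).
  assert (q * ln x <= p * ln x) by nra.
  destruct H0 as [H0|E]; [left; apply exp_increasing; assumption|rewrite E; lra].
Qed.

Lemma rpow_exp_le x p q : 1 <= x -> p <= q -> rpow x p <= rpow x q.
Proof. intros H1 Hpq. rewrite !rpow_pos_eq by lra. apply Rle_Rpower; assumption. Qed.

Lemma rpow_2 x : 0 <= x -> rpow x 2 = x * x.
Proof.
  intros [Hx|<-]; [|rewrite rpow_0; ring].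
  rewrite rpow_pos_eq by assumption. replace 2 with (1 + 1) by ring.
  rewrite Rpower_plus, Rpower_1 by assumption. reflexivity.
Qed.

Lemma rpow_le_sq x p : 0 <= x <= 1 -> 2 <= p -> rpow x p <= x * x.
Proof. intros Hx Hp. rewrite <- rpow_2 by lra. apply rpow_exp_anti; assumption. Qed.

Variable p : R.
Hypothesis p_ge2 : 2 <= p.

Definition root (x : R) : R := rpow x (/ p).

Lemma inv_p : 0 < / p <= 1 / 2.
Proof.
  split; [apply Rinv_0_lt_compat; lra|]. unfold Rdiv. rewrite Rmult_1_l.
  apply Rinv_le_contravar; lra.
Qed.

Lemma root_nonneg x : 0 <= root x.
Proof. apply rpow_nonneg. Qed.

Lemma root_le x y : 0 <= x <= y -> root x <= root y.
Proof. apply rpow_le. pose proof inv_p; lra. Qed.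

Lemma root_mult x y : 0 <= x -> 0 <= y -> root (x * y) = root x * root y.
Proof. apply rpow_mult. Qed.

Lemma rpow_root x : 0 <= x -> rpow (root x) p = x.
Proof.
  intros Hx. unfold root. rewrite rpow_rpow by assumption.
  rewrite Rinv_l by lra. apply rpow_one; assumption.
Qed.

Lemma root_rpow x : 0 <= x -> root (rpow x p) = x.
Proof.
  intros Hx. unfold root. rewrite rpow_rpow by assumption.
  rewrite Rinv_r by lra. apply rpow_one; assumption.
Qed.

Lemma root_le_self x : 1 <= x -> root x <= x.
Proof.
  intros Hx. rewrite <- (rpow_one x) at 2 by lra. apply rpow_exp_le; [assumption|pose proof inv_p; lra].
Qed.

Lemma root_ge1 x : 1 <= x -> 1 <= root x.
Proof. intros Hx. unfold root. rewrite <- (rpow_1 (/ p)). apply rpow_le; [pose proof inv_p; lra|lra]. Qed.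

(** The exponent 2 / p is at most 1; in this form [p >= 2] makes the recursion of [arc_flat]
    contract. *)
Lemma root_sq x : 1 <= x -> root (x * x) <= x.
Proof.
  intros Hx. unfold root. rewrite <- rpow_2 by lra. rewrite rpow_rpow by lra.
  rewrite <- (rpow_one x) at 2 by lra. apply rpow_exp_le; [assumption|pose proof inv_p; lra].
Qed.

(* [t |-> t * root (1 / t)] is nondecreasing, so only an upper bound on [L] matters. *)
Lemma scaled_root_le L s k e : 0 < L -> 0 < s -> 1 <= k -> L <= k * s -> 0 <= e ->
  L * root (e / L) <= k * s * root (e / s).
Proof.
  intros HL Hs Hk HLs He.
  pose proof (root_nonneg (e / s)).
  destruct (Rle_lt_dec s L) as [H1|H1].
  - assert (root (e / L) <= root (e / s)).
    { apply root_le. split; [apply Rmult_le_pos; [lra|left; apply Rinv_0_lt_compat; lra]|].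
      apply Rmult_le_compat_l; [lra|]. apply Rinv_le_contravar; lra. }
    pose proof (root_nonneg (e / L)). nra.
  - replace (e / L) with (s / L * (e / s)) by (field; lra).
    assert (Hq : 1 <= s / L) by (apply Rmult_le_reg_r with L; [lra|]; unfold Rdiv; rewrite Rmult_assoc, Rinv_l by lra; lra).
    rewrite root_mult by (first [lra | apply Rmult_le_pos; [lra|left; apply Rinv_0_lt_compat; lra]]).
    pose proof (root_le_self _ Hq) as Hr.
    assert (E : L * (s / L) = s) by (field; lra).
    assert (L * root (s / L) <= s) by nra.
    assert (L * root (s/L) * root (e/s) <= s * root (e / s)) by nra.
    assert (s * root (e / s) <= k * s * root (e / s)) by (apply Rmult_le_compat_r; nra).
    lra.
Qed.
End RealPower.

(** * Uniform convexity *)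

(** Stated on the whole unit ball because [displacement_half] applies it to difference vectors
    divided by upper bounds of their norms. *)
Definition power_convex (X : Banach) (c p : R) : Prop :=
  forall x y : X, Bnorm x <= 1 -> Bnorm y <= 1 ->
    Bnorm (Badd x y) <= 2 - 2 * c * rpow (Bnorm (Bsub x y)) p.

Lemma Bnorm_normalize (X : Banach) (x : X) : 0 < Bnorm x -> Bnorm (Bscal (/ Bnorm x) x) = 1.
Proof.
  intros H. rewrite Bnorm_scal_nonneg by (left; apply Rinv_0_lt_compat; assumption).
  apply Rinv_l; lra.
Qed.

(* The modulus of convexity only speaks about unit vectors; up to a constant it controls the whole
   unit ball: either the deficit [1 - |x|] or [1 - |y|] is comparable to [|x - y|], or the normalized
   vectors are still [|x - y| / 2] apart. *)
Lemma power_convex_of_modulus (X : Banach) (delta0 : R -> R) (c0 p : R) :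
  2 <= p -> 0 < c0 -> is_modulus_of_convexity X delta0 ->
  (forall eps, 0 < eps <= 2 -> delta0 eps >= c0 * Rpower eps p) ->
  power_convex X (Rmin (1 / 4) (c0 / 2) / rpow 2 p) p.
Proof.
  intros Hp Hc0 Hmod Hpow.
  set (c := Rmin (1 / 4) (c0 / 2) / rpow 2 p).
  assert (H2p : 0 < rpow 2 p) by (apply rpow_pos; lra).
  assert (Hc : c * rpow 2 p = Rmin (1/4) (c0/2)) by (unfold c; field; lra).
  pose proof (Rmin_l (1/4) (c0/2)) as Hl. pose proof (Rmin_r (1/4) (c0/2)) as Hr.
  assert (Hm : 0 < Rmin (1/4) (c0/2)) by (apply Rmin_glb_lt; lra).
  assert (Key : forall x y : X, Bnorm x <= 1 -> Bnorm y <= Bnorm x ->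
    Bnorm (Badd x y) <= 2 - 2 * c * rpow (Bnorm (Bsub x y)) p).
  { intros x y Hx Hyx.
    pose proof (Bnorm_nonneg y) as Hy0.
    set (d := Bnorm (Bsub x y)).
    assert (Hd0 : 0 <= d) by apply Bnorm_nonneg.
    pose proof (Bnorm_triangle _ x y) as Htri.
    assert (Hd2 : d <= Bnorm x + Bnorm y).
    { unfold d, Bsub. rewrite <- (Bnorm_opp y). apply Bnorm_triangle. }
    assert (Hdp : rpow d p = rpow 2 p * rpow (d / 2) p).
    { rewrite <- rpow_mult by lra. f_equal. field. }
    pose proof (rpow_nonneg (d/2) p) as Hn.
    assert (Hsq : rpow (d/2) p <= d/2 * (d/2)) by (apply rpow_le_sq; lra).
    assert (Hcd : c * rpow d p = Rmin (1/4) (c0/2) * rpow (d/2) p) by (rewrite Hdp, <- Rmult_assoc, Hc; ring).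
    replace (2 * c * rpow d p) with (2 * (c * rpow d p)) by ring. rewrite Hcd.
    destruct (Rle_lt_dec (d / 2) ((1 - Bnorm x) + (1 - Bnorm y))) as [HA|HB].
    { nra. }
    (* A short [y] leaves |x + y| <= 3/2, which the 1/4 in the constant allows for. Otherwise
       scaling the deficit of the unit vectors by [Bnorm y > 1/2] costs the half in [c0 / 2]. *)
    destruct (Rle_lt_dec (Bnorm y) (1/2)) as [Hb|Hb]; [nra|].
    assert (Hy : 0 < Bnorm y) by lra. assert (Hx0 : 0 < Bnorm x) by lra.
    set (x' := Bscal (/ Bnorm x) x). set (y' := Bscal (/ Bnorm y) y).
    assert (Hx1 : Bnorm x' = 1) by (apply Bnorm_normalize; assumption).
    assert (Hy1 : Bnorm y' = 1) by (apply Bnorm_normalize; assumption).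
    assert (Ex : x = Bscal (Bnorm x) x') by (unfold x'; rewrite Bscal_assoc, Rinv_r by lra; symmetry; apply Bscal_one).
    assert (Ey : y = Bscal (Bnorm y) y') by (unfold y'; rewrite Bscal_assoc, Rinv_r by lra; symmetry; apply Bscal_one).
    assert (Hd' : d / 2 < Bdist x' y').
    { assert (d <= (1 - Bnorm x) + (1 - Bnorm y) + Bdist x' y'); [|lra].
      unfold d. rewrite Ex at 1. rewrite Ey at 1. generalize dependent (Bnorm x). generalize dependent (Bnorm y).
      intros b **. unfold Bdist.
      replace (Bsub (Bscal r x') (Bscal b y')) with
        (Badd (Badd (Bscal (- (1 - r)) x') (Bscal (1 - b) y')) (Bsub x' y')) by vlin.
      eapply Rle_trans; [apply Bnorm_triangle|].
      apply Rplus_le_compat_r. eapply Rle_trans; [apply Bnorm_triangle|].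
      rewrite !Bnorm_scal, Hx1, Hy1, Rabs_Ropp, !Rabs_pos_eq by lra. lra. }
    assert (Hd'2 : Bdist x' y' <= 2).
    { unfold Bdist, Bsub. eapply Rle_trans; [apply Bnorm_triangle|]. rewrite Bnorm_opp. lra. }
    assert (Hdelta : c0 * rpow (d / 2) p <= 1 - Bnorm (Badd x' y') / 2).
    { destruct (Hmod (Bdist x' y')) as [Hlow _]; [lra|].
      specialize (Hlow _ (ex_intro _ x' (ex_intro _ y' (conj Hx1 (conj Hy1 (conj (Rge_refl _) eq_refl)))))).
      specialize (Hpow (Bdist x' y')). rewrite <- rpow_pos_eq in Hpow by lra.
      assert (rpow (d/2) p <= rpow (Bdist x' y') p) by (apply rpow_le; lra).
      assert (delta0 (Bdist x' y') >= c0 * rpow (Bdist x' y') p) by (apply Hpow; lra).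
      nra. }
    assert (Hsum : Bnorm (Badd x y) <= Bnorm y * Bnorm (Badd x' y') + (Bnorm x - Bnorm y)).
    { rewrite Ex at 1. rewrite Ey at 1.
      replace (Badd (Bscal (Bnorm x) x') (Bscal (Bnorm y) y')) with
        (Badd (Bscal (Bnorm y) (Badd x' y')) (Bscal (Bnorm x - Bnorm y) x')) by vlin.
      eapply Rle_trans; [apply Bnorm_triangle|]. rewrite !Bnorm_scal_nonneg by lra. rewrite Hx1. lra. }
    assert (Bnorm (Badd x' y') <= 2 - 2 * (c0 * rpow (d/2) p)) by lra.
    assert (Bnorm y * Bnorm (Badd x' y') <= Bnorm y * (2 - 2 * (c0 * rpow (d/2) p))) by (apply Rmult_le_compat_l; lra).
    assert (0 <= c0 * rpow (d/2) p) by nra.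
    assert (Rmin (1/4) (c0/2) * rpow (d/2) p <= c0 * rpow (d/2) p / 2) by nra.
    nra. }
  intros x y Hx Hy. destruct (Rle_lt_dec (Bnorm y) (Bnorm x)) as [H|H].
  - apply Key; assumption.
  - rewrite Badd_comm. fold (Bdist x y). rewrite Bdist_sym. apply Key; lra.
Qed.

(** With a = (y - u) / s and b = (v - y) / t in the unit ball, v - u = s (a + b) + (t - s) b, so
    convexity turns the excess [e] into a bound on |a - b|^p; and [y] minus the point at fraction s
    / (s + t) of the segment equals s t / (s + t) times a - b. The case [s <= t] keeps the
    coefficient t - s nonnegative. *)
Lemma displacement_half (X : Banach) (c p : R) (u v y : X) (s t e : R) :
  2 <= p -> 0 < c -> power_convex X c p ->
  0 < s -> s <= t -> Bdist y u <= s -> Bdist v y <= t -> s + t - e <= Bdist v u ->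
  Bdist y (Badd u (Bscal (s / (s + t)) (Bsub v u))) <= (s + t) * root p (e / (s + t) * / c).
Proof.
  intros Hp Hc Huc Hs Hst Hyu Hvy Hvu.
  set (a := Bscal (/ s) (Bsub y u)). set (b := Bscal (/ t) (Bsub v y)).
  assert (Ha : Bnorm a <= 1).
  { unfold a. rewrite Bnorm_scal_nonneg by (left; apply Rinv_0_lt_compat; lra). fold (Bdist y u).
    apply Rmult_le_reg_l with s; [lra|]. rewrite <- Rmult_assoc, Rinv_r by lra. lra. }
  assert (Hb : Bnorm b <= 1).
  { unfold b. rewrite Bnorm_scal_nonneg by (left; apply Rinv_0_lt_compat; lra). fold (Bdist v y).
    apply Rmult_le_reg_l with t; [lra|]. rewrite <- Rmult_assoc, Rinv_r by lra. lra. }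
  set (d := Bnorm (Bsub a b)). assert (Hd : 0 <= d) by apply Bnorm_nonneg.
  pose proof (rpow_nonneg d p) as Hdp.
  assert (He : 2 * s * c * rpow d p <= e).
  { assert (Bdist v u <= s * Bnorm (Badd a b) + (t - s)).
    { unfold Bdist. replace (Bsub v u) with (Badd (Bscal s (Badd a b)) (Bscal (t - s) b)).
      - eapply Rle_trans; [apply Bnorm_triangle|]. rewrite !Bnorm_scal_nonneg by lra. nra.
      - unfold a, b. vlin; field; lra. }
    specialize (Huc a b Ha Hb). fold d in Huc. nra. }
  assert (Hdisp : Bdist y (Badd u (Bscal (s / (s + t)) (Bsub v u))) <= s * d).
  { unfold Bdist. replace (Bsub y (Badd u (Bscal (s / (s + t)) (Bsub v u)))) with (Bscal (s * t / (s + t)) (Bsub a b)).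
    - assert (0 <= s * t / (s + t)) by (apply Rmult_le_pos; [nra|left; apply Rinv_0_lt_compat; lra]).
      rewrite Bnorm_scal_nonneg by assumption. fold d.
      apply Rmult_le_compat_r; [assumption|].
      apply Rmult_le_reg_r with (s + t); [lra|]. unfold Rdiv. rewrite Rmult_assoc, Rinv_l by lra. nra.
    - unfold a, b. vlin; field; lra. }
  eapply Rle_trans; [exact Hdisp|].
  (* [He] controls d^p by e / s only, which is poor when s is much smaller than t; the factor m in s
     d = (s + t) m d compensates because m^p <= m. *)
  set (m := s / (s + t)).
  assert (Hm : 0 < m <= 1).
  { unfold m. split; [apply Rdiv_lt_0_compat; lra|].
    apply Rmult_le_reg_r with (s + t); [lra|]. unfold Rdiv. rewrite Rmult_assoc, Rinv_l by lra. lra. }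
  assert (Em : s = (s + t) * m) by (unfold m; field; lra).
  replace (s * d) with ((s + t) * (m * d)) by (rewrite <- Rmult_assoc, <- Em; reflexivity).
  apply Rmult_le_compat_l; [lra|].
  rewrite <- (root_rpow p Hp (m * d)) by nra.
  apply root_le; [assumption|]. split; [apply rpow_nonneg|].
  rewrite rpow_mult by lra.
  assert (rpow m p <= m * m) by (apply rpow_le_sq; lra).
  assert (0 < c * (s + t)) by nra.
  replace (e / (s + t) * / c) with (e / (c * (s + t))) by (field; lra).
  apply Rmult_le_reg_r with (c * (s + t)); [assumption|].
  unfold Rdiv. rewrite (Rmult_assoc e), Rinv_l, Rmult_1_r by lra.
  assert (rpow m p <= m) by nra.
  assert (rpow m p * rpow d p <= m * rpow d p) by (apply Rmult_le_compat_r; assumption).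
  assert (0 <= m * rpow d p) by nra.
  assert (0 <= rpow m p * rpow d p) by (apply Rmult_le_pos; apply rpow_nonneg).
  eapply Rle_trans; [apply Rmult_le_compat_r; [lra|eassumption]|].
  replace (m * rpow d p * (c * (s + t))) with (((s + t) * m) * c * rpow d p) by ring. rewrite <- Em.
  assert (0 <= s * c * rpow d p) by (apply Rmult_le_pos; nra). lra.
Qed.

Lemma displacement (X : Banach) (c p : R) (u v y : X) (s t e : R) :
  2 <= p -> 0 < c -> power_convex X c p ->
  0 <= s -> 0 <= t -> 0 < s + t -> Bdist y u <= s -> Bdist v y <= t -> s + t - e <= Bdist v u ->
  Bdist y (Badd u (Bscal (s / (s + t)) (Bsub v u))) <= (s + t) * root p (e / (s + t) * / c).
Proof.
  intros Hp Hc Huc Hs Ht Hst Hyu Hvy Hvu.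
  destruct (Req_dec s 0) as [E|Hs0].
  { subst s. assert (y = u) by (apply Bdist_eq0; pose proof (Bdist_nonneg y u); lra). subst y.
    replace (Badd u (Bscal (0 / (0 + t)) (Bsub v u))) with u by (vlin; field; lra).
    rewrite Bdist_refl. apply Rmult_le_pos; [lra|apply root_nonneg]. }
  destruct (Req_dec t 0) as [E|Ht0].
  { subst t. assert (v = y) by (apply Bdist_eq0; pose proof (Bdist_nonneg v y); lra). subst y.
    replace (Badd u (Bscal (s / (s + 0)) (Bsub v u))) with v by (vlin; field; lra).
    rewrite Bdist_refl. apply Rmult_le_pos; [lra|apply root_nonneg]. }
  destruct (Rle_lt_dec s t) as [H|H].
  - apply displacement_half; try assumption; lra.
  - replace (Badd u (Bscal (s / (s + t)) (Bsub v u))) with (Badd v (Bscal (t / (t + s)) (Bsub u v)))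
      by (vlin; field; lra).
    rewrite (Rplus_comm s t). apply displacement_half; try assumption; try lra;
    rewrite Bdist_sym; lra.
Qed.

(** * Nested arcs of a polygonal walk *)

Fixpoint psum (f : nat -> R) (m : nat) : R :=
  match m with O => 0 | S k => psum f k + f k end.

Lemma psum_mono f a b : (forall i, 0 <= f i) -> (a <= b)%nat -> psum f a <= psum f b.
Proof.
  intros Hf Hab. induction Hab as [|b Hab IH]; [lra|]. simpl. pose proof (Hf b); lra.
Qed.

Lemma psum_le f g m : (forall i, (i < m)%nat -> f i <= g i) -> psum f m <= psum g m.
Proof.
  induction m as [|m IH]; intros H; simpl; [lra|].
  pose proof (H m (Nat.lt_succ_diag_r m)). assert (psum f m <= psum g m) by (apply IH; intros; apply H; lia). lra.
Qed.

Lemma psum_ext f g m : (forall i, (i < m)%nat -> f i = g i) -> psum f m = psum g m.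
Proof. intros H. apply Rle_antisym; apply psum_le; intros i Hi; rewrite H by assumption; lra. Qed.

Lemma psum_add f g m : psum (fun i => f i + g i) m = psum f m + psum g m.
Proof. induction m as [|m IH]; simpl; [ring|rewrite IH; ring]. Qed.

Lemma psum_scal c f m : psum (fun i => c * f i) m = c * psum f m.
Proof. induction m as [|m IH]; simpl; [ring|rewrite IH; ring]. Qed.

Lemma psum_nonneg f m : (forall i, (i < m)%nat -> 0 <= f i) -> 0 <= psum f m.
Proof.
  intros H. replace 0 with (psum (fun _ => 0) m) by (clear; induction m; simpl; lra).
  apply psum_le. exact H.
Qed.

Lemma psum_const f a b : (a <= b)%nat -> (forall i, (a <= i < b)%nat -> f i = 0) -> psum f b = psum f a.
Proof.
  intros Hab. induction Hab as [|b Hab IH]; intros H; [reflexivity|]. simpl.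
  rewrite IH, (H b); [ring|lia|]. intros i Hi; apply H; lia.
Qed.

Lemma psum_term f a c b : (forall i, 0 <= f i) -> (a <= c < b)%nat -> f c <= psum f b - psum f a.
Proof.
  intros Hf Hc. assert (psum f a <= psum f c) by (apply psum_mono; [assumption|lia]).
  assert (psum f (S c) <= psum f b) by (apply psum_mono; [assumption|lia]). simpl in *. lra.
Qed.

(** A difference over [J] consecutive scales splits into [J] telescoping sums, each at most the
    total range [B]. This is where comparing contents at distant scales costs a logarithm. *)
Lemma psum_shift_diff f J B m :
  (forall i, 0 <= f i <= B) -> psum (fun i => f i - f (i + J)%nat) m <= INR J * B.
Proof.
  intros Hf. induction J as [|J IH].
  - simpl. rewrite (psum_ext _ (fun _ => 0)) by (intros; rewrite Nat.add_0_r; ring).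
    rewrite Rmult_0_l. clear. induction m; simpl; lra.
  - rewrite S_INR.
    rewrite (psum_ext _ (fun i => (f i - f (i + J)%nat) + (f (i + J)%nat - f (S (i + J))))).
    2:{ intros i _. rewrite Nat.add_succ_r. ring. }
    rewrite psum_add.
    assert (E : psum (fun i => f (i + J)%nat - f (S (i + J))) m = f J - f (m + J)%nat).
    { clear. induction m as [|m IH]; simpl; [ring|rewrite IH; ring]. }
    rewrite E. pose proof (Hf J). pose proof (Hf (m + J)%nat). lra.
Qed.

(** The default [d] is a working value: for [ceilv] and [jump] it is the last index [n], so that
    running out of candidates ends the walk, and for [midpt] it is the initial vertex of the arc. *)
Definition least (P : nat -> Prop) (d : nat) : nat :=
  if excluded_middle_informative (exists j, P j)
  then epsilon (inhabits d) (fun j => P j /\ forall i, P i -> (j <= i)%nat) else d.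

Lemma least_spec P d : (exists j, P j) -> P (least P d) /\ forall i, P i -> (least P d <= i)%nat.
Proof.
  intros H. unfold least. destruct (excluded_middle_informative _) as [_|N]; [|contradiction].
  apply epsilon_spec. destruct H as [j Hj]. revert Hj. induction j as [j IH] using lt_wf_ind. intros Hj.
  destruct (classic (exists i, (i < j)%nat /\ P i)) as [[i [Hi HP]]|N]; [eauto|].
  exists j. split; [assumption|]. intros i Hi. apply Nat.nlt_ge. intros L. apply N; eauto.
Qed.

Lemma least_default P d : ~ (exists j, P j) -> least P d = d.
Proof. intros H. unfold least. destruct (excluded_middle_informative _); [contradiction|reflexivity]. Qed.

(** * Vertex sets on the walk and sums over the blocks between vertices *)

Section Vertices.
Variables (n : nat) (V : nat -> Prop).
Hypothesis V_n : V n.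
Hypothesis V_le : forall i, V i -> (i <= n)%nat.

Definition ceilv (i : nat) : nat := least (fun j => (i <= j)%nat /\ V j) n.
Definition nextv (i : nat) : nat := ceilv (S i).

(** Yields 0 when no positive vertex is at most [t], even if 0 is no vertex, and a midpoint
    hierarchy need not contain 0; hence the recurring assumption that [floorv t] is a vertex. *)
Fixpoint floorv (t : nat) : nat :=
  match t with
  | O => O
  | S t' => if excluded_middle_informative (V (S t')) then S t' else floorv t'
  end.

Lemma ceilv_spec i : (i <= n)%nat ->
  V (ceilv i) /\ (i <= ceilv i <= n)%nat /\ forall j, (i <= j)%nat -> V j -> (ceilv i <= j)%nat.
Proof.
  intros Hi. destruct (least_spec (fun j => (i <= j)%nat /\ V j) n) as [[H1 H2] H3]; [exists n; auto|].
  fold (ceilv i) in *. repeat split; try assumption; [apply V_le; assumption|auto].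
Qed.

Lemma ceilv_vertex i : V i -> ceilv i = i.
Proof.
  intros Hi. destruct (ceilv_spec i (V_le _ Hi)) as [_ [H1 H2]].
  specialize (H2 i (Nat.le_refl i) Hi). lia.
Qed.

Lemma ceilv_nonvertex i : (i < n)%nat -> ~ V i -> ceilv i = ceilv (S i).
Proof.
  intros Hi HV. destruct (ceilv_spec i) as [A1 [A2 A3]]; [lia|].
  destruct (ceilv_spec (S i)) as [B1 [B2 B3]]; [lia|].
  assert (ceilv i <> i) by (intros E; rewrite E in A1; contradiction).
  specialize (A3 (ceilv (S i)) ltac:(lia) B1). specialize (B3 (ceilv i) ltac:(lia) A1). lia.
Qed.

Lemma nextv_spec i : (i < n)%nat ->
  V (nextv i) /\ (i < nextv i <= n)%nat /\ forall j, (i < j)%nat -> V j -> (nextv i <= j)%nat.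
Proof. intros Hi. apply (ceilv_spec (S i)). lia. Qed.

Lemma floorv_le t : (floorv t <= t)%nat.
Proof. induction t as [|t IH]; simpl; [lia|]. destruct (excluded_middle_informative _); lia. Qed.

Lemma floorv_spec t u : V u -> (u <= t)%nat ->
  V (floorv t) /\ forall j, (j <= t)%nat -> V j -> (j <= floorv t)%nat.
Proof.
  intros Hu. induction t as [|t IH]; intros Hut; simpl.
  - replace u with O in Hu by lia. split; [assumption|intros; lia].
  - destruct (excluded_middle_informative _) as [H|H]; [split; [assumption|intros; lia]|].
    assert (u <> S t) by (intros ->; contradiction).
    destruct IH as [I1 I2]; [lia|]. split; [assumption|]. intros j Hj Vj.
    apply I2; [|assumption]. assert (j <> S t) by (intros ->; contradiction). lia.
Qed.

Lemma floorv_eq t u : V u -> (u <= t < nextv u)%nat -> (t < n)%nat -> floorv t = u.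
Proof.
  intros Vu Ht Htn. destruct (floorv_spec t u Vu) as [A B]; [lia|].
  pose proof (floorv_le t). specialize (B u ltac:(lia) Vu).
  destruct (Nat.eq_dec (floorv t) u) as [|N]; [assumption|].
  destruct (nextv_spec u) as [_ [_ C]]; [lia|]. specialize (C (floorv t) ltac:(lia) A). lia.
Qed.

Lemma floorv_next t : (t < n)%nat -> V (floorv t) -> (floorv t <= t < nextv (floorv t))%nat.
Proof.
  intros Ht H. split; [apply floorv_le|]. pose proof (floorv_le t).
  destruct (nextv_spec (floorv t)) as [A [B C]]; [lia|].
  apply Nat.nle_gt. intros L. destruct (floorv_spec t (floorv t) H) as [_ D]; [lia|].
  specialize (D _ L A). lia.
Qed.

(** Defined on all indices and not only on vertices, so that levels with different vertex sets are
    compared by [psum] over one range. *)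
Definition blocksum (f : nat -> R) (i : nat) : R :=
  if excluded_middle_informative (V i) then psum f (nextv i) - psum f i else 0.

(** The blocks begun before [m] end at the vertex closing the last of them, hence [ceilv m]. Indices
    before the first vertex belong to no block, hence only an inequality. *)
Lemma blocksum_sum f m : (forall i, 0 <= f i) -> (m <= n)%nat -> psum (blocksum f) m <= psum f (ceilv m).
Proof.
  intros Hf. induction m as [|m IH]; intros Hm.
  - simpl. apply psum_nonneg; auto.
  - simpl. specialize (IH ltac:(lia)). unfold blocksum at 2.
    destruct (excluded_middle_informative (V m)) as [H|H].
    + rewrite (ceilv_vertex m H) in IH. unfold nextv. lra.
    + rewrite <- (ceilv_nonvertex m) by (assumption || lia). lra.
Qed.

Lemma blocksum_total f : (forall i, 0 <= f i) -> psum (blocksum f) n <= psum f n.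
Proof.
  intros Hf. rewrite <- (ceilv_vertex n V_n) at 2. apply blocksum_sum; auto.
Qed.
End Vertices.

(** * Deviation of nested arcs from their chords *)

Section Hierarchy.
Context {X : Banach}.
Variables (gam : nat -> X) (n : nat) (V : nat -> nat -> Prop) (sc : nat -> R).
Variables (c p : R).
Hypothesis p_ge2 : 2 <= p.
Hypothesis c_pos : 0 < c.
Hypothesis X_convex : power_convex X c p.
Hypothesis V_n : forall l, V l n.
Hypothesis V_le : forall l i, V l i -> (i <= n)%nat.
Hypothesis V_0 : forall i, (i <= n)%nat -> V 0%nat i.
Hypothesis V_nested : forall l i, V (S l) i -> V l i.
Hypothesis sc_pos : forall l, 0 < sc l.
Hypothesis sc_step : forall l, sc (S l) = 32 * sc l.
Hypothesis arc_size : forall l u i, V l u -> (u < n)%nat -> (u <= i <= nextv n (V l) u)%nat ->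
  Bdist (gam i) (gam u) <= 4 * sc l.

Notation nx l := (nextv n (V l)).
Notation fl l := (floorv (V l)).

Definition segpt (u v : X) (a : R) : X := Badd u (Bscal a (Bsub v u)).

Definition chord (l i : nat) : R :=
  if excluded_middle_informative (V l i) then Bdist (gam (nx l i)) (gam i) else 0.

Definition excess (l i : nat) : R := blocksum n (V (S l)) (chord l) i - chord (S l) i.

(* Geometrically weighted excess below the arc of level [l] starting at [i]. *)
Fixpoint wexcess (l i : nat) : R :=
  match l with
  | O => 0
  | S l' => excess l' i + / 2 * blocksum n (V (S l')) (wexcess l') i
  end.

(* Position, as a fraction of arc length, of [i] on the polygon formed by the level [l - 1] vertices
   of its level [l] arc, after replacing [i] by its approximation on a level [l - 1] chord.  On an
   arc of zero length both numerator and denominator vanish and the value is 0. *)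
Fixpoint arcpos (l i : nat) : R :=
  match l with
  | O => 0
  | S l' => let u := fl (S l') i in let w := fl l' i in
      (psum (chord l') w - psum (chord l') u + arcpos l' i * chord l' w) /
      (psum (chord l') (nx (S l') u) - psum (chord l') u)
  end.

Lemma chord_nonneg l i : 0 <= chord l i.
Proof. unfold chord. destruct (excluded_middle_informative _); [apply Bdist_nonneg|lra]. Qed.

Lemma chord_psum_next l u : V l u -> (u < n)%nat ->
  psum (chord l) (nx l u) = psum (chord l) u + Bdist (gam (nx l u)) (gam u).
Proof.
  intros Vu Hu. destruct (nextv_spec n (V l) (V_n l) (V_le l) u Hu) as [A [B C]].
  rewrite (psum_const (chord l) (S u) (nx l u)).
  - simpl. unfold chord at 2. destruct (excluded_middle_informative _); [reflexivity|contradiction].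
  - lia.
  - intros i Hi. unfold chord. destruct (excluded_middle_informative _) as [Vi|]; [|reflexivity].
    specialize (C i ltac:(lia) Vi). lia.
Qed.

(** Stopping at [ceilv] allows induction one index at a time: a nonvertex changes neither side. *)
Lemma polygon_ceil l u k : V l u -> (u + k <= n)%nat ->
  Bdist (gam (ceilv n (V l) (u + k))) (gam u) <= psum (chord l) (u + k) - psum (chord l) u.
Proof.
  intros Vu. induction k as [|k IH]; intros Hk.
  - rewrite Nat.add_0_r, (ceilv_vertex n (V l) (V_n l) (V_le l)), Bdist_refl by assumption. lra.
  - specialize (IH ltac:(lia)). rewrite Nat.add_succ_r. simpl. unfold chord at 2.
    destruct (excluded_middle_informative _) as [H|H].
    + rewrite (ceilv_vertex n (V l) (V_n l) (V_le l)) in IH by assumption.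
      pose proof (Bdist_triangle (gam (ceilv n (V l) (S (u + k)))) (gam (u + k)%nat) (gam u)).
      unfold nextv. lra.
    + rewrite <- (ceilv_nonvertex n (V l) (V_n l) (V_le l)) by (assumption || lia). lra.
Qed.

Lemma polygon l u w : V l u -> V l w -> (u <= w)%nat ->
  Bdist (gam w) (gam u) <= psum (chord l) w - psum (chord l) u.
Proof.
  intros Vu Vw Huw. pose proof (V_le l w Vw).
  pose proof (polygon_ceil l u (w - u) Vu ltac:(lia)) as H1.
  replace (u + (w - u))%nat with w in H1 by lia.
  rewrite (ceilv_vertex n (V l) (V_n l) (V_le l)) in H1 by assumption. exact H1.
Qed.

Lemma excess_nonneg l i : (i < n)%nat -> 0 <= excess l i.
Proof.
  intros Hi. unfold excess, blocksum, chord at 3.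
  destruct (excluded_middle_informative _) as [H|H]; [|lra].
  destruct (nextv_spec n (V (S l)) (V_n _) (V_le _) i Hi) as [A [B _]].
  pose proof (polygon l i (nx (S l) i) (V_nested _ _ H) (V_nested _ _ A) ltac:(lia)). lra.
Qed.

Lemma excess_top l : excess l n = 0.
Proof.
  assert (E : forall l', nx l' n = n).
  { intros l'. apply least_default. intros [j [H1 H2]]. apply V_le in H2. lia. }
  unfold excess, blocksum, chord at 3. rewrite E, Bdist_refl.
  destruct (excluded_middle_informative _); lra.
Qed.

Lemma excess_nonneg' l i : 0 <= excess l i.
Proof.
  destruct (lt_eq_lt_dec i n) as [[H|H]|H].
  - apply excess_nonneg; assumption.
  - subst; rewrite excess_top; lra.
  - unfold excess, blocksum, chord at 3.
    destruct (excluded_middle_informative _) as [H'|H']; [apply V_le in H'; lia|lra].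
Qed.

Lemma next_le l i : V l i -> (i <= nx l i)%nat.
Proof.
  intros H. pose proof (V_le _ _ H).
  destruct (Nat.eq_dec i n) as [->|].
  - unfold nextv, ceilv. rewrite least_default; [lia|]. intros [j [H1 H2]]. apply V_le in H2. lia.
  - destruct (nextv_spec n (V l) (V_n _) (V_le _) i) as [_ [B _]]; lia.
Qed.

Lemma blocksum_nonneg l f i : (forall j, 0 <= f j) -> 0 <= blocksum n (V l) f i.
Proof.
  intros Hf. unfold blocksum. destruct (excluded_middle_informative _) as [H|H]; [|lra].
  pose proof (psum_mono f i (nx l i) Hf (next_le _ _ H)). lra.
Qed.

Lemma wexcess_nonneg l i : 0 <= wexcess l i.
Proof.
  revert i; induction l as [|l IH]; intros i; simpl; [lra|].
  pose proof (excess_nonneg' l i). pose proof (blocksum_nonneg (S l) (wexcess l) i IH). lra.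
Qed.

(** Summed over all arcs, the excess is at most the loss of polygon length from one level to the
    next, and the inherited part enters with its weight 1/2. *)
Lemma wexcess_level l :
  psum (wexcess (S l)) n <= (psum (chord l) n - psum (chord (S l)) n) + / 2 * psum (wexcess l) n.
Proof.
  simpl. rewrite psum_add, psum_scal. unfold excess.
  rewrite (psum_ext (fun i => blocksum n (V (S l)) (chord l) i - chord (S l) i)
    (fun i => blocksum n (V (S l)) (chord l) i + (-1) * chord (S l) i)) by (intros; ring).
  rewrite psum_add, psum_scal.
  pose proof (blocksum_total n (V (S l)) (V_n _) (V_le _) (chord l) (chord_nonneg l)).
  pose proof (blocksum_total n (V (S l)) (V_n _) (V_le _) (wexcess l) (wexcess_nonneg l)).
  lra.
Qed.

Lemma wexcess_total m :
  psum (fun l => psum (wexcess l) n) m <= 2 * psum (chord 0) n.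
Proof.
  set (Om := fun l => psum (wexcess l) n). set (G := fun l => psum (chord l) n).
  assert (HG : forall l, Om (S l) <= G l - G (S l) + / 2 * Om l) by exact wexcess_level.
  (* Counting the last term twice absorbs the inherited half, since 2 Om (k + 1) <= 2 (G k - G (k +
     1)) + Om k. *)
  assert (H : forall k, psum Om (S k) + Om k <= 2 * (G 0%nat - G k)).
  { induction k as [|k IH].
    - assert (Om 0%nat = 0) by (unfold Om; apply (psum_const _ 0 n); [lia|reflexivity]).
      simpl psum. lra.
    - change (psum Om (S (S k))) with (psum Om (S k) + Om (S k)). specialize (HG k). lra. }
  specialize (H m). change (psum Om (S m)) with (psum Om m + Om m) in H.
  assert (0 <= Om m) by (apply psum_nonneg; intros; apply wexcess_nonneg).
  assert (0 <= G m) by (apply psum_nonneg; intros; apply chord_nonneg).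
  unfold G in *. lra.
Qed.

Lemma chord0 i : (i < n)%nat -> chord 0 i = Bdist (gam (S i)) (gam i).
Proof.
  intros Hi. unfold chord. destruct (excluded_middle_informative _) as [H|H]; [|exfalso; apply H, V_0; lia].
  unfold nextv. rewrite (ceilv_vertex n (V 0%nat) (V_n _) (V_le _)); [reflexivity|]. apply V_0; lia.
Qed.

Lemma arc_child l i : (i < n)%nat -> V (S l) (fl (S l) i) ->
  V l (fl l i) /\ (fl (S l) i <= fl l i <= i)%nat /\ (i < nx l (fl l i) <= nx (S l) (fl (S l) i))%nat.
Proof.
  intros Hi HV. pose proof (floorv_next n (V (S l)) (V_n _) (V_le _) i Hi HV) as HF.
  destruct (floorv_spec (V l) i (fl (S l) i)) as [A B]; [apply V_nested; assumption|lia|].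
  pose proof (floorv_next n (V l) (V_n _) (V_le _) i Hi A) as HG.
  destruct (nextv_spec n (V (S l)) (V_n _) (V_le _) (fl (S l) i)) as [C1 [C2 C3]]; [lia|].
  destruct (nextv_spec n (V l) (V_n _) (V_le _) (fl l i)) as [D1 [D2 D3]]; [lia|].
  specialize (D3 (nx (S l) (fl (S l) i)) ltac:(lia) (V_nested _ _ C1)).
  specialize (B (fl (S l) i) ltac:(lia) (V_nested _ _ HV)).
  repeat split; try assumption; lia.
Qed.

Lemma arcpos_bounds l i : (i < n)%nat -> V l (fl l i) -> 0 <= arcpos l i <= 1.
Proof.
  revert i; induction l as [|l IH]; intros i Hi HV; [simpl; lra|].
  destruct (arc_child l i Hi HV) as [HV' [H1 H2]].
  specialize (IH i Hi HV'). cbn [arcpos]. cbv zeta.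
  set (u := fl (S l) i) in *. set (w := fl l i) in *.
  pose proof (chord_psum_next l w HV' ltac:(lia)) as E.
  assert (Ew : chord l w = Bdist (gam (nx l w)) (gam w)).
  { unfold chord. destruct (excluded_middle_informative _); [reflexivity|contradiction]. }
  rewrite <- Ew in E. pose proof (chord_nonneg l w) as Hc.
  assert (psum (chord l) u <= psum (chord l) w) by (apply psum_mono; [apply chord_nonneg|lia]).
  assert (psum (chord l) (nx l w) <= psum (chord l) (nx (S l) u)) by (apply psum_mono; [apply chord_nonneg|lia]).
  set (D := psum (chord l) (nx (S l) u) - psum (chord l) u) in *.
  set (N := psum (chord l) w - psum (chord l) u + arcpos l i * chord l w) in *.
  assert (0 <= arcpos l i * chord l w <= chord l w) by nra.
  assert (HN : 0 <= N <= D) by (unfold N, D; lra).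
  destruct (Req_dec D 0) as [E0|E0].
  - replace N with 0 by lra. unfold Rdiv. rewrite Rmult_0_l. lra.
  - assert (0 < D) by lra. split; [apply Rmult_le_pos; [lra|left; apply Rinv_0_lt_compat; lra]|].
    apply Rmult_le_reg_r with D; [lra|]. unfold Rdiv. rewrite Rmult_assoc, Rinv_l by lra. lra.
Qed.

(** Inside one child arc this is the induction; for different child arcs the later one starts, in
    polygon length, after the chord of the earlier one ends. Monotonicity is what makes distances
    along a flat arc additive up to the deviation. *)
Lemma arcpos_mono l i i' : (i <= i' < n)%nat -> V l (fl l i) -> fl l i = fl l i' ->
  arcpos l i <= arcpos l i'.
Proof.
  revert i i'; induction l as [|l IH]; intros i i' Hi HV HE; [simpl; lra|].
  destruct (arc_child l i ltac:(lia) HV) as [HV1 [H1 H2]].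
  destruct (arc_child l i' ltac:(lia) ltac:(rewrite <- HE; assumption)) as [HV2 [H3 H4]].
  pose proof (arcpos_bounds l i ltac:(lia) HV1) as B1.
  pose proof (arcpos_bounds l i' ltac:(lia) HV2) as B2.
  cbn [arcpos]. cbv zeta. rewrite <- HE in *.
  set (u := fl (S l) i) in *.
  set (D := psum (chord l) (nx (S l) u) - psum (chord l) u).
  assert (HD : 0 <= / D).
  { assert (psum (chord l) u <= psum (chord l) (nx (S l) u)) by (apply psum_mono; [apply chord_nonneg|lia]).
    assert (0 <= D) by (unfold D; lra).
    destruct (Req_dec D 0) as [->|]; [rewrite Rinv_0; lra|left; apply Rinv_0_lt_compat; lra]. }
  unfold Rdiv. apply Rmult_le_compat_r; [assumption|].
  pose proof (chord_nonneg l (fl l i)). pose proof (chord_nonneg l (fl l i')).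
  destruct (Nat.eq_dec (fl l i) (fl l i')) as [E|E].
  - specialize (IH i i' ltac:(lia) HV1 E). rewrite <- E in *. nra.
  - assert (nx l (fl l i) <= fl l i')%nat.
    { destruct (floorv_spec (V l) i' (fl l i)) as [_ B]; [assumption|lia|].
      specialize (B (fl l i) ltac:(lia) HV1).
      destruct (nextv_spec n (V l) (V_n _) (V_le _) (fl l i)) as [_ [_ C]]; [lia|].
      apply C; [lia|assumption]. }
    pose proof (chord_psum_next l (fl l i) HV1 ltac:(lia)) as E1.
    assert (Ew : chord l (fl l i) = Bdist (gam (nx l (fl l i))) (gam (fl l i))).
    { unfold chord. destruct (excluded_middle_informative _); [reflexivity|contradiction]. }
    rewrite <- Ew in E1.
    assert (psum (chord l) (nx l (fl l i)) <= psum (chord l) (fl l i')) by (apply psum_mono; [apply chord_nonneg|lia]).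
    nra.
Qed.

(** For an arc of scale s and excess e <= s the polygon of children has length at most 4 s + e <= 5
    s, and [displacement] supplies the root of 1 / c. For e > s the crude bound 12 s + 4 s suffices,
    as the root of e / s is at least 1. The outer 2 leaves room for the deviation inherited from the
    child arc. *)
Definition flat_const : R := 2 * (5 * root p (/ c) + 16).

Lemma flat_const_pos : 32 <= flat_const.
Proof. unfold flat_const. pose proof (root_nonneg p (/ c)). lra. Qed.

Lemma segpt_dist (u v : X) a b : Bdist (segpt u v a) (segpt u v b) = Rabs (a - b) * Bdist v u.
Proof.
  unfold Bdist, segpt. rewrite <- Bnorm_scal. f_equal. vlin.
Qed.

Lemma segpt_0 (u v : X) : segpt u v 0 = u.
Proof. unfold segpt. vlin. Qed.

Lemma segpt_1 (u v : X) : segpt u v 1 = v.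
Proof. unfold segpt. vlin. Qed.

(** The approximation [y] of [gam i] on its child chord splits the polygon of children into lengths
    [sg] and [tau] with sum [Lp], so [displacement] applies with excess [Lp] minus the chord. The
    inherited deviation returns with a quarter of the constant, the new displacement with half of
    it. *)
Theorem arc_flat l i : (i < n)%nat -> V l (fl l i) ->
  Bdist (gam i) (segpt (gam (fl l i)) (gam (nx l (fl l i))) (arcpos l i)) <=
  flat_const * sc l * root p (wexcess l (fl l i) / sc l).
Proof.
  pose proof flat_const_pos as HK.
  revert i; induction l as [|l IH]; intros i Hi HV.
  - assert (E : fl 0 i = i).
    { apply (floorv_eq n (V 0%nat) (V_n _) (V_le _)); [apply V_0; lia| |assumption].
      destruct (nextv_spec n (V 0%nat) (V_n _) (V_le _) i Hi). lia. }
    rewrite E. simpl arcpos. rewrite segpt_0, Bdist_refl.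
    apply Rmult_le_pos; [|apply root_nonneg]. pose proof (sc_pos 0). nra.
  - destruct (arc_child l i Hi HV) as [HV' [H1 H2]].
    specialize (IH i Hi HV').
    pose proof (arcpos_bounds l i Hi HV') as Ha.
    cbn [arcpos]. cbv zeta.
    set (u := fl (S l) i) in *. set (w := fl l i) in *.
    set (v := nx (S l) u) in *. set (w' := nx l w) in *.
    set (y := segpt (gam w) (gam w') (arcpos l i)) in *.
    destruct (nextv_spec n (V (S l)) (V_n _) (V_le _) u ltac:(lia)) as [Vv [Hv _]]. fold v in Vv, Hv.
    destruct (nextv_spec n (V l) (V_n _) (V_le _) w ltac:(lia)) as [Vw' [Hw' _]]. fold w' in Vw', Hw'.
    pose proof (chord_psum_next l w HV' ltac:(lia)) as Ec. fold w' in Ec.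
    assert (Ew : chord l w = Bdist (gam w') (gam w)).
    { unfold chord. destruct (excluded_middle_informative _); [reflexivity|contradiction]. }
    pose proof (polygon l u w (V_nested _ _ HV) HV' ltac:(lia)) as P1.
    pose proof (polygon l w' v Vw' (V_nested _ _ Vv) ltac:(lia)) as P2.
    rewrite Ew.
    set (sg := psum (chord l) w - psum (chord l) u + arcpos l i * Bdist (gam w') (gam w)).
    set (Lp := psum (chord l) v - psum (chord l) u).
    set (tau := psum (chord l) v - psum (chord l) w' + (1 - arcpos l i) * Bdist (gam w') (gam w)).
    assert (EL : sg + tau = Lp) by (unfold sg, tau, Lp; lra).
    pose proof (Bdist_nonneg (gam w') (gam w)) as Hd.
    pose proof (Bdist_nonneg (gam w) (gam u)) as Hd1.
    pose proof (Bdist_nonneg (gam v) (gam w')) as Hd2.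
    assert (Hsg : 0 <= sg) by (unfold sg; nra).
    assert (Htau : 0 <= tau) by (unfold tau; nra).
    assert (Yw : Bdist y (gam w) = arcpos l i * Bdist (gam w') (gam w)).
    { unfold y. rewrite <- (segpt_0 (gam w) (gam w')) at 2. rewrite segpt_dist, Rminus_0_r, Rabs_pos_eq by lra. reflexivity. }
    assert (Yw' : Bdist (gam w') y = (1 - arcpos l i) * Bdist (gam w') (gam w)).
    { unfold y. rewrite <- (segpt_1 (gam w) (gam w')) at 1. rewrite segpt_dist, Rabs_pos_eq by lra. reflexivity. }
    assert (Hyu : Bdist y (gam u) <= sg).
    { pose proof (Bdist_triangle y (gam w) (gam u)). unfold sg. lra. }
    assert (Hvy : Bdist (gam v) y <= tau).
    { pose proof (Bdist_triangle (gam v) (gam w') y). unfold tau. lra. }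
    set (e := Lp - Bdist (gam v) (gam u)).
    (* The excess is the first summand of [wexcess]; the child's weighted excess is one term of the
       block sum, with factor 1/2. *)
    assert (We : e <= wexcess (S l) u /\ / 2 * wexcess l w <= wexcess (S l) u).
    { assert (Eu : chord (S l) u = Bdist (gam v) (gam u)).
      { unfold chord. destruct (excluded_middle_informative _); [reflexivity|contradiction]. }
      simpl. unfold excess, blocksum. rewrite Eu.
      destruct (excluded_middle_informative _) as [_|N]; [|contradiction].
      fold v. pose proof (psum_term (wexcess l) u w v (wexcess_nonneg l) ltac:(lia)).
      pose proof (wexcess_nonneg l w).
      pose proof (polygon l u v (V_nested _ _ HV) (V_nested _ _ Vv) ltac:(lia)).
      unfold e, Lp. split; lra. }
    destruct We as [We1 We2].
    assert (He : 0 <= e).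
    { pose proof (polygon l u v (V_nested _ _ HV) (V_nested _ _ Vv) ltac:(lia)). unfold e, Lp. lra. }
    pose proof (sc_pos (S l)) as Hs. set (s := sc (S l)) in *.
    assert (Hsl : sc l = s / 32) by (unfold s; rewrite sc_step; field).
    assert (Hroote : 0 <= root p (e / s)) by apply root_nonneg.
    assert (Hdisp : Bdist y (segpt (gam u) (gam v) (sg / Lp)) <= (5 * root p (/ c) + 16) * s * root p (e / s)).
    { pose proof (root_nonneg p (/ c)) as Hrc.
      destruct (Req_dec Lp 0) as [E0|E0].
      - assert (E1 : sg = 0) by lra. rewrite E1. unfold Rdiv. rewrite Rmult_0_l, segpt_0.
        assert (0 <= (5 * root p (/ c) + 16) * s * root p (e / s)) by (apply Rmult_le_pos; nra).
        unfold Rdiv in *. lra.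
      - destruct (Rle_lt_dec e s) as [Hes|Hes].
        + pose proof (displacement X c p (gam u) (gam v) y sg tau e p_ge2 c_pos X_convex Hsg Htau
            ltac:(lra) Hyu Hvy ltac:(rewrite EL; unfold e; lra)) as HD.
          rewrite EL in HD. fold (segpt (gam u) (gam v) (sg / Lp)) in HD.
          assert (Bdist (gam v) (gam u) <= 4 * s) by (apply arc_size; [assumption|lia|fold v; lia]).
          assert (HL : Lp <= 5 * s) by (unfold e in Hes; lra).
          rewrite root_mult in HD by (try lra; (apply Rmult_le_pos; [lra|left; apply Rinv_0_lt_compat; lra]) || (left; apply Rinv_0_lt_compat; lra)).
          pose proof (scaled_root_le p p_ge2 Lp s 5 e ltac:(lra) Hs ltac:(lra) HL He) as HS.
          assert (Lp * (root p (e / Lp) * root p (/ c)) <= 5 * s * root p (e / s) * root p (/ c)).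
          { rewrite <- Rmult_assoc. apply Rmult_le_compat_r; assumption. }
          assert (0 <= s * root p (e / s)) by (apply Rmult_le_pos; lra). lra.
        + assert (1 <= root p (e / s)).
          { apply root_ge1; [assumption|]. apply Rmult_le_reg_r with s; [lra|].
            unfold Rdiv; rewrite Rmult_assoc, Rinv_l by lra. lra. }
          assert (A1 : Bdist (gam v) (gam u) <= 4 * s) by (apply arc_size; [assumption|lia|fold v; lia]).
          assert (A2 : Bdist (gam w) (gam u) <= 4 * s) by (apply arc_size; [assumption|lia|fold v; lia]).
          assert (A3 : Bdist (gam w') (gam u) <= 4 * s) by (apply arc_size; [assumption|lia|fold v; lia]).
          assert (Hfr : 0 <= sg / Lp <= 1).
          { split; [apply Rmult_le_pos; [lra|left; apply Rinv_0_lt_compat; lra]|].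
            apply Rmult_le_reg_r with Lp; [lra|]. unfold Rdiv; rewrite Rmult_assoc, Rinv_l by lra. lra. }
          assert (B1 : Bdist (segpt (gam u) (gam v) (sg / Lp)) (gam u) <= 4 * s).
          { rewrite <- (segpt_0 (gam u) (gam v)) at 2. rewrite segpt_dist, Rminus_0_r, Rabs_pos_eq by lra.
            pose proof (Bdist_nonneg (gam v) (gam u)). nra. }
          assert (B2 : Bdist (gam w') (gam w) <= 8 * s).
          { pose proof (Bdist_triangle (gam w') (gam u) (gam w)). rewrite (Bdist_sym (gam u)) in *. lra. }
          assert (Bdist y (gam w) <= 8 * s) by nra.
          pose proof (Bdist_triangle y (gam w) (gam u)).
          pose proof (Bdist_triangle y (gam u) (segpt (gam u) (gam v) (sg / Lp))) as T.
          rewrite (Bdist_sym (gam u)) in T.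
          assert (0 <= 5 * root p (/ c) * s * root p (e / s)) by (apply Rmult_le_pos; nra).
          nra. }
    pose proof (Bdist_triangle (gam i) y (segpt (gam u) (gam v) (sg / Lp))) as T.
    set (W := wexcess (S l) u) in *.
    assert (HW : 0 <= W) by apply wexcess_nonneg.
    assert (HWs : 0 <= W / s) by (apply Rmult_le_pos; [lra|left; apply Rinv_0_lt_compat; lra]).
    assert (R1 : root p (e / s) <= root p (W / s)).
    { apply root_le; [assumption|]. split; [apply Rmult_le_pos; [lra|left; apply Rinv_0_lt_compat; lra]|].
      apply Rmult_le_compat_r; [left; apply Rinv_0_lt_compat; lra|lra]. }
    assert (R2 : root p (wexcess l w / sc l) <= 8 * root p (W / s)).
    { apply Rle_trans with (root p (8 * 8 * (W / s))).
      - apply root_le; [assumption|]. rewrite Hsl. pose proof (wexcess_nonneg l w).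
        replace (wexcess l w / (s / 32)) with (32 * wexcess l w * / s) by (field; lra).
        replace (8 * 8 * (W / s)) with (64 * W * / s) by (field; lra).
        assert (0 < / s) by (apply Rinv_0_lt_compat; lra). split; [apply Rmult_le_pos; lra|].
        apply Rmult_le_compat_r; lra.
      - rewrite root_mult by lra. apply Rmult_le_compat_r; [apply root_nonneg|]. apply root_sq; lra. }
    rewrite Hsl in IH.
    pose proof (root_nonneg p (W / s)).
    assert (I1 : Bdist (gam i) y <= flat_const * (s / 32) * (8 * root p (W / s))).
    { eapply Rle_trans; [exact IH|]. rewrite <- Hsl in *. apply Rmult_le_compat_l; [nra|].
      exact R2. }
    assert (I2 : (5 * root p (/ c) + 16) * s * root p (e / s) <= flat_const / 2 * s * root p (W / s)).
    { unfold flat_const. replace (2 * (5 * root p (/ c) + 16) / 2) with (5 * root p (/ c) + 16) by field.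
      apply Rmult_le_compat_l; [|assumption]. pose proof (root_nonneg p (/ c)). nra. }
    assert (0 <= flat_const * s * root p (W / s)) by (apply Rmult_le_pos; nra).
    nra.
Qed.

Lemma arc_param l t : (t < n)%nat -> V l (fl l t) ->
  let u := fl l t in let v := nx l u in
  exists psi : nat -> R,
    (forall i, (u <= i <= v)%nat ->
       Bdist (gam i) (segpt (gam u) (gam v) (psi i)) <= flat_const * sc l * root p (wexcess l u / sc l)) /\
    (forall i j, (u <= i <= j)%nat -> (j <= v)%nat -> psi i <= psi j).
Proof.
  intros Ht HV u v.
  destruct (nextv_spec n (V l) (V_n _) (V_le _) u) as [_ [Hv _]]; [pose proof (floorv_le (V l) t); unfold u; lia|].
  fold v in Hv.
  assert (E : forall i, (u <= i < v)%nat -> fl l i = u).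
  { intros i Hi. apply (floorv_eq n (V l) (V_n _) (V_le _)); [assumption|assumption|lia]. }
  (* [floorv] assigns the end vertex [v] to the following arc, so its parameter 1 is set by hand. *)
  exists (fun i => if Nat.eqb i v then 1 else arcpos l i). split.
  - intros i Hi. destruct (Nat.eqb_spec i v) as [->|N].
    + rewrite segpt_1, Bdist_refl. apply Rmult_le_pos; [|apply root_nonneg].
      pose proof flat_const_pos. pose proof (sc_pos l). nra.
    + pose proof (arc_flat l i ltac:(lia)) as H. rewrite (E i ltac:(lia)) in H. fold v in H. exact (H HV).
  - intros i j Hi Hj. destruct (Nat.eqb_spec j v) as [->|N]; destruct (Nat.eqb_spec i v) as [E1|N1]; try lra; try lia.
    + apply arcpos_bounds; [lia|]. rewrite E by lia. exact HV.
    + apply arcpos_mono; [lia| |]; rewrite ?E by lia; [exact HV|reflexivity].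
Qed.
End Hierarchy.

(** * Two interleaved greedy hierarchies *)

Section Greedy.
Context {X : Banach}.
Variables (gam : nat -> X) (n : nat) (s0 : R).
Hypothesis s0_pos : 0 < s0.
Hypothesis gam_step : forall i, (i < n)%nat -> Bdist (gam (S i)) (gam i) <= s0.

Definition scale (l : nat) : R := 32 ^ l * s0.

Definition jump (W : nat -> Prop) (s : R) (u : nat) : nat :=
  least (fun j => (u < j)%nat /\ (j <= n)%nat /\ W j /\ s <= Bdist (gam j) (gam u)) n.

(** Each level jumps among the vertices of the level below, which makes nesting automatic; the
    overshoot this causes is at most an arc of the lower level. *)
Fixpoint greedy (l : nat) : nat -> Prop :=
  match l with
  | O => fun i => (i <= n)%nat
  | S l' => fun i => exists m, Nat.iter m (jump (greedy l') (scale l)) 0%nat = i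
  end.

Notation nx l := (nextv n (greedy l)).

(** The midpoint of an arc is the midpoint of one of its child arcs, hence again a midpoint on every
    lower level; this makes [greedy_mid] nested. The child chosen is the first to start half a scale
    away. *)
Fixpoint midpt (l u : nat) : nat :=
  match l with
  | O => u
  | S l' => midpt l' (least (fun w => (u <= w)%nat /\ (w < nx (S l') u)%nat /\ greedy l' w /\
                                      scale (S l') / 2 <= Bdist (gam w) (gam u)) u)
  end.

Definition greedy_mid (l i : nat) : Prop :=
  i = n \/ exists u, (u < n)%nat /\ greedy l u /\ midpt l u = i.

Lemma scale_pos l : 0 < scale l.
Proof. unfold scale. apply Rmult_lt_0_compat; [apply pow_lt; lra|assumption]. Qed.

Lemma scale_S l : scale (S l) = 32 * scale l.
Proof. unfold scale. simpl. ring. Qed.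

Lemma jump_cases W s u :
  (jump W s u = n /\ forall j, (u < j <= n)%nat -> W j -> Bdist (gam j) (gam u) < s) \/
  ((u < jump W s u <= n)%nat /\ W (jump W s u) /\ s <= Bdist (gam (jump W s u)) (gam u) /\
   forall j, (u < j < jump W s u)%nat -> W j -> Bdist (gam j) (gam u) < s).
Proof.
  unfold jump. set (P := fun j => _).
  destruct (classic (exists j, P j)) as [H|H].
  - right. destruct (least_spec P n H) as [[H1 [H2 [H3 H4]]] H5]. repeat split; try assumption.
    intros j Hj HW. apply Rnot_le_lt. intros HR.
    assert (HPj : P j) by (repeat split; try assumption; lia). specialize (H5 j HPj). lia.
  - left. split; [apply least_default; assumption|]. intros j Hj HW. apply Rnot_le_lt. intros HR.
    apply H. exists j. repeat split; try assumption; lia.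
Qed.

Lemma jump_gt W s u : (u < n)%nat -> (u < jump W s u <= n)%nat.
Proof. intros Hu. destruct (jump_cases W s u) as [[-> _]|[H _]]; lia. Qed.

Lemma jump_top W s : jump W s n = n.
Proof. destruct (jump_cases W s n) as [[-> _]|[H _]]; lia. Qed.

Lemma iter_jump_le W s m : (Nat.iter m (jump W s) 0 <= n)%nat.
Proof.
  induction m as [|m IH]; simpl; [lia|].
  destruct (Nat.eq_dec (Nat.iter m (jump W s) 0%nat) n) as [E|E].
  - rewrite E, jump_top; lia.
  - apply jump_gt; lia.
Qed.

Lemma iter_jump_mono W s a b : (a <= b)%nat -> (Nat.iter a (jump W s) 0 <= Nat.iter b (jump W s) 0)%nat.
Proof.
  intros H. induction H as [|b H IH]; [lia|]. simpl.
  pose proof (iter_jump_le W s b).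
  destruct (Nat.eq_dec (Nat.iter b (jump W s) 0%nat) n) as [E|E].
  - rewrite E in *. rewrite jump_top. lia.
  - pose proof (jump_gt W s (Nat.iter b (jump W s) 0%nat)). lia.
Qed.

Lemma iter_jump_end W s : Nat.iter n (jump W s) 0%nat = n.
Proof.
  assert (H : forall m, (m <= n)%nat -> (m <= Nat.iter m (jump W s) 0)%nat).
  { induction m as [|m IH]; intros Hm; simpl; [lia|]. specialize (IH ltac:(lia)).
    pose proof (iter_jump_le W s m).
    destruct (Nat.eq_dec (Nat.iter m (jump W s) 0%nat) n) as [E|E].
    - rewrite E, jump_top; lia.
    - pose proof (jump_gt W s (Nat.iter m (jump W s) 0%nat)). lia. }
  pose proof (H n (Nat.le_refl n)). pose proof (iter_jump_le W s n). lia.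
Qed.

Lemma greedy_n l : greedy l n.
Proof. destruct l as [|l]; simpl; [lia|]. exists n. apply iter_jump_end. Qed.

Lemma greedy_0 l : greedy l 0.
Proof. destruct l as [|l]; simpl; [lia|]. exists 0%nat. reflexivity. Qed.

Lemma greedy_le l i : greedy l i -> (i <= n)%nat.
Proof. destruct l as [|l]; simpl; [auto|]. intros [m <-]. apply iter_jump_le. Qed.

Lemma greedy_nested l i : greedy (S l) i -> greedy l i.
Proof.
  intros [m <-]. destruct m as [|m]; [apply greedy_0|]. simpl Nat.iter.
  set (u := Nat.iter m _ _).
  destruct (jump_cases (greedy l) (scale (S l)) u) as [[-> _]|[_ [H _]]]; [apply greedy_n|exact H].
Qed.

Hint Resolve greedy_n greedy_le greedy_0 greedy_nested : core.

Lemma greedy_next l u : greedy (S l) u -> (u < n)%nat -> nx (S l) u = jump (greedy l) (scale (S l)) u.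
Proof.
  intros [a Ha] Hu.
  destruct (nextv_spec n (greedy (S l)) (greedy_n _) (greedy_le _) u Hu) as [[b Hb] [B C]].
  pose (J := jump (greedy l) (scale (S l))). change (nx (S l) u = J u).
  assert (HJ : greedy (S l) (J u)) by (exists (S a); exact (f_equal J Ha)).
  specialize (C (J u) (proj1 (jump_gt _ _ u Hu)) HJ).
  assert (a < b)%nat.
  { apply Nat.nle_gt. intros L. pose proof (iter_jump_mono (greedy l) (scale (S l)) b a L).
    rewrite Ha, Hb in H. lia. }
  pose proof (iter_jump_mono (greedy l) (scale (S l)) (S a) b H) as M.
  change (Nat.iter (S a) (jump (greedy l) (scale (S l))) 0%nat) with (J (Nat.iter a (jump (greedy l) (scale (S l))) 0%nat)) in M.
  rewrite Ha, Hb in M. lia.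
Qed.

Lemma next_far l u : greedy (S l) u -> (nx (S l) u < n)%nat -> (u < n)%nat ->
  scale (S l) <= Bdist (gam (nx (S l) u)) (gam u).
Proof.
  intros H Hn Hu. rewrite greedy_next in * by assumption.
  destruct (jump_cases (greedy l) (scale (S l)) u) as [[E _]|[_ [_ [H1 _]]]]; [lia|assumption].
Qed.

Lemma before_next_near l u w : greedy (S l) u -> (u < n)%nat -> greedy l w -> (u <= w < nx (S l) u)%nat ->
  Bdist (gam w) (gam u) <= scale (S l).
Proof.
  intros H Hu Hw Huw. pose proof (scale_pos (S l)).
  destruct (Nat.eq_dec u w) as [->|N]; [rewrite Bdist_refl; lra|].
  rewrite greedy_next in Huw by assumption.
  destruct (jump_cases (greedy l) (scale (S l)) u) as [[E H1]|[_ [_ [_ H1]]]].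
  - specialize (H1 w ltac:(lia) Hw). lra.
  - specialize (H1 w ltac:(lia) Hw). lra.
Qed.

(** A constant K works once 1 + K / 32 <= K: a point of the arc lies on a child arc that starts
    within one scale of [u]. Taking the child of [i - 1] includes the right end of the arc. *)
Lemma greedy_arc_size l u i : greedy l u -> (u < n)%nat -> (u <= i <= nx l u)%nat ->
  Bdist (gam i) (gam u) <= 17 / 16 * scale l.
Proof.
  revert u i; induction l as [|l IH]; intros u i Vu Hu Hi.
  - destruct (nextv_spec n (greedy 0) (greedy_n _) (greedy_le _) u Hu) as [_ [_ C]].
    specialize (C (S u) ltac:(lia) ltac:(simpl; lia)).
    unfold scale; simpl. assert (i = u \/ i = S u) as [-> | ->] by lia.
    + rewrite Bdist_refl; lra.
    + specialize (gam_step u Hu). lra.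
  - pose proof (scale_pos l). pose proof (scale_S l).
    destruct (Nat.eq_dec i u) as [->|N]; [rewrite Bdist_refl; lra|].
    destruct (nextv_spec n (greedy (S l)) (greedy_n _) (greedy_le _) u Hu) as [A [B _]].
    destruct (floorv_spec (greedy l) (i - 1) u) as [F1 F2]; [auto|lia|].
    pose proof (floorv_next n (greedy l) (greedy_n _) (greedy_le _) (i - 1) ltac:(lia) F1) as F3.
    set (w := floorv (greedy l) (i - 1)) in *.
    specialize (F2 u ltac:(lia) ltac:(auto)).
    specialize (IH w i F1 ltac:(lia) ltac:(lia)).
    pose proof (before_next_near l u w Vu Hu F1 ltac:(lia)).
    pose proof (Bdist_triangle (gam i) (gam w) (gam u)). lra.
Qed.

(** The child before [w] starts less than half a scale away and adds at most 17/16 of the lower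
    scale. A long arc does have such a [w], because its last child starts close to the far end. *)
Lemma midpt_step l u : greedy (S l) u -> (u < n)%nat ->
  exists w, midpt (S l) u = midpt l w /\ greedy l w /\ (u <= w < nx (S l) u)%nat /\
    (scale (S l) <= Bdist (gam (nx (S l) u)) (gam u) ->
     scale (S l) / 2 <= Bdist (gam w) (gam u) <= scale (S l) / 2 + 17 / 16 * scale l).
Proof.
  intros Vu Hu.
  set (P := fun w => (u <= w)%nat /\ (w < nx (S l) u)%nat /\ greedy l w /\
                     scale (S l) / 2 <= Bdist (gam w) (gam u)).
  exists (least P u). split; [reflexivity|].
  destruct (nextv_spec n (greedy (S l)) (greedy_n _) (greedy_le _) u Hu) as [A [B _]].
  pose proof (scale_pos l) as Hs. pose proof (scale_S l) as Es.
  destruct (classic (exists j, P j)) as [H|H].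
  - destruct (least_spec P u H) as [[H1 [H2 [H3 H4]]] H5].
    set (w := least P u) in *. split; [assumption|]. split; [lia|]. intros _. split; [assumption|].
    assert (Huw : u <> w) by (intros E; rewrite <- E, Bdist_refl in H4; lra).
    destruct (floorv_spec (greedy l) (w - 1) u) as [F1 F2]; [auto|lia|].
    pose proof (floorv_next n (greedy l) (greedy_n _) (greedy_le _) (w - 1) ltac:(lia) F1) as F3.
    set (w1 := floorv (greedy l) (w - 1)) in *. specialize (F2 u ltac:(lia) ltac:(auto)).
    destruct (nextv_spec n (greedy l) (greedy_n _) (greedy_le _) w1 ltac:(lia)) as [_ [_ N3]].
    specialize (N3 w ltac:(lia) H3).
    pose proof (greedy_arc_size l w1 w F1 ltac:(lia) ltac:(lia)) as S1.
    assert (Bdist (gam w1) (gam u) < scale (S l) / 2).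
    { apply Rnot_le_lt. intros L. assert (HP : P w1) by (repeat split; try assumption; lia).
      specialize (H5 _ HP). lia. }
    pose proof (Bdist_triangle (gam w) (gam w1) (gam u)). lra.
  - rewrite least_default by assumption. split; [auto|]. split; [lia|].
    intros HF. exfalso. apply H.
    destruct (floorv_spec (greedy l) (nx (S l) u - 1) u) as [F1 F2]; [auto|lia|].
    pose proof (floorv_next n (greedy l) (greedy_n _) (greedy_le _) (nx (S l) u - 1) ltac:(lia) F1) as F3.
    set (w := floorv (greedy l) (nx (S l) u - 1)) in *. specialize (F2 u ltac:(lia) ltac:(auto)).
    pose proof (greedy_arc_size l w (nx (S l) u) F1 ltac:(lia) ltac:(lia)) as S1.
    exists w. repeat split; try assumption; try lia.
    pose proof (Bdist_triangle (gam (nx (S l) u)) (gam w) (gam u)). lra.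
Qed.

Lemma midpt_range l u : greedy l u -> (u < n)%nat -> (u <= midpt l u < nx l u)%nat.
Proof.
  revert u; induction l as [|l IH]; intros u Vu Hu.
  - change (midpt 0 u) with u. destruct (nextv_spec n (greedy 0) (greedy_n _) (greedy_le _) u Hu). lia.
  - destruct (midpt_step l u Vu Hu) as [w [-> [Vw [Hw _]]]].
    destruct (nextv_spec n (greedy (S l)) (greedy_n _) (greedy_le _) u Hu) as [A [B _]].
    specialize (IH w Vw ltac:(lia)).
    destruct (nextv_spec n (greedy l) (greedy_n _) (greedy_le _) w ltac:(lia)) as [_ [_ C]].
    specialize (C (nx (S l) u) ltac:(lia) ltac:(auto)). lia.
Qed.

Lemma midpt_far l u : greedy (S l) u -> (u < n)%nat ->
  scale (S l) <= Bdist (gam (nx (S l) u)) (gam u) ->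
  scale (S l) / 4 <= Bdist (gam (midpt (S l) u)) (gam u) /\
  scale (S l) / 4 <= Bdist (gam (nx (S l) u)) (gam (midpt (S l) u)).
Proof.
  intros Vu Hu HF. destruct (midpt_step l u Vu Hu) as [w [-> [Vw [Hw HD]]]].
  specialize (HD HF). pose proof (scale_pos l). pose proof (scale_S l).
  destruct (nextv_spec n (greedy (S l)) (greedy_n _) (greedy_le _) u Hu) as [A [B _]].
  pose proof (midpt_range l w Vw ltac:(lia)) as HM.
  pose proof (greedy_arc_size l w (midpt l w) Vw ltac:(lia) ltac:(lia)) as S1.
  set (z := midpt l w) in *. set (v := nx (S l) u) in *.
  pose proof (Bdist_triangle (gam w) (gam z) (gam u)) as T1. rewrite (Bdist_sym (gam w) (gam z)) in T1.
  pose proof (Bdist_triangle (gam v) (gam z) (gam u)) as T2.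
  pose proof (Bdist_triangle (gam z) (gam w) (gam u)) as T3. lra.
Qed.

Lemma greedy_mid_n l : greedy_mid l n.
Proof. left; reflexivity. Qed.

Lemma greedy_mid_le l i : greedy_mid l i -> (i <= n)%nat.
Proof.
  intros [->|[u [Hu [Vu <-]]]]; [lia|]. pose proof (midpt_range l u Vu Hu).
  destruct (nextv_spec n (greedy l) (greedy_n _) (greedy_le _) u Hu). lia.
Qed.

Lemma greedy_mid_all i : (i <= n)%nat -> greedy_mid 0 i.
Proof.
  intros Hi. destruct (Nat.eq_dec i n); [left; assumption|]. right. exists i.
  simpl. repeat split; lia.
Qed.

Lemma greedy_mid_nested l i : greedy_mid (S l) i -> greedy_mid l i.
Proof.
  intros [->|[u [Hu [Vu <-]]]]; [left; reflexivity|].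
  destruct (midpt_step l u Vu Hu) as [w [-> [Vw [Hw _]]]].
  destruct (nextv_spec n (greedy (S l)) (greedy_n _) (greedy_le _) u Hu) as [A [B _]].
  right. exists w. repeat split; [lia|assumption].
Qed.

Hint Resolve greedy_mid_n greedy_mid_le : core.

Lemma midpt_mono l u u' : greedy l u -> greedy l u' -> (u < u' < n)%nat -> (midpt l u < u')%nat.
Proof.
  intros Vu Vu' H. pose proof (midpt_range l u Vu ltac:(lia)).
  destruct (nextv_spec n (greedy l) (greedy_n _) (greedy_le _) u ltac:(lia)) as [_ [_ C]].
  specialize (C u' ltac:(lia) Vu'). lia.
Qed.

(** A midpoint lies in the half-open arc of its own vertex, so midpoints and greedy vertices
    interleave. *)
Lemma greedy_mid_next l u : greedy l u -> (u < n)%nat ->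
  ((nx l u < n)%nat -> nextv n (greedy_mid l) (midpt l u) = midpt l (nx l u)) /\
  (nx l u = n -> nextv n (greedy_mid l) (midpt l u) = n).
Proof.
  intros Vu Hu. pose proof (midpt_range l u Vu Hu) as HM.
  destruct (nextv_spec n (greedy l) (greedy_n _) (greedy_le _) u Hu) as [A [B C]].
  destruct (nextv_spec n (greedy_mid l) (greedy_mid_n _) (greedy_mid_le _) (midpt l u) ltac:(lia)) as [D [E F]].
  assert (G : nextv n (greedy_mid l) (midpt l u) = n \/
     exists u', (u' < n)%nat /\ greedy l u' /\ midpt l u' = nextv n (greedy_mid l) (midpt l u) /\ (nx l u <= u')%nat).
  { destruct D as [D|[u' [Hu' [Vu' D]]]]; [left; assumption|]. right. exists u'. repeat split; try assumption.
    apply C; [|assumption]. apply Nat.nle_gt. intros L.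
    destruct (Nat.eq_dec u' u) as [->|N]; [lia|].
    pose proof (midpt_mono l u' u Vu' Vu ltac:(lia)). lia. }
  split.
  - intros Hn. pose proof (midpt_range l (nx l u) A Hn) as HM2.
    pose proof (F (midpt l (nx l u)) ltac:(lia) ltac:(right; exists (nx l u); auto)) as F1.
    destruct G as [G|[u' [Hu' [Vu' [G1 G2]]]]].
    + destruct (nextv_spec n (greedy l) (greedy_n _) (greedy_le _) (nx l u) Hn). lia.
    + destruct (Nat.eq_dec u' (nx l u)) as [->|N]; [symmetry; exact G1|].
      pose proof (midpt_mono l (nx l u) u' A Vu' ltac:(lia)).
      pose proof (midpt_range l u' Vu' Hu'). lia.
  - intros Hn. destruct G as [G|[u' [Hu' [Vu' [G1 G2]]]]]; [assumption|]. lia.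
Qed.

(** An arc between midpoints lies in two consecutive greedy arcs; three distances of 17/16 fit into
    4, the size allowed in both hierarchies. *)
Lemma greedy_mid_arc_size l w i : greedy_mid l w -> (w < n)%nat ->
  (w <= i <= nextv n (greedy_mid l) w)%nat -> Bdist (gam i) (gam w) <= 4 * scale l.
Proof.
  intros [->|[u [Hu [Vu <-]]]] Hw Hi; [lia|].
  pose proof (midpt_range l u Vu Hu) as HM. pose proof (scale_pos l).
  destruct (nextv_spec n (greedy l) (greedy_n _) (greedy_le _) u Hu) as [A [B C]].
  destruct (greedy_mid_next l u Vu Hu) as [N1 N2].
  pose proof (greedy_arc_size l u (midpt l u) Vu Hu ltac:(lia)) as S1.
  pose proof (greedy_arc_size l u (nx l u) Vu Hu ltac:(lia)) as S2.
  pose proof (Bdist_triangle (gam i) (gam u) (gam (midpt l u))) as T1.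
  rewrite (Bdist_sym (gam u) (gam (midpt l u))) in T1.
  destruct (Nat.le_gt_cases i (nx l u)) as [L|L].
  - pose proof (greedy_arc_size l u i Vu Hu ltac:(lia)). lra.
  - assert (Hn : (nx l u < n)%nat).
    { destruct (nextv_spec n (greedy_mid l) (greedy_mid_n _) (greedy_mid_le _) (midpt l u) ltac:(lia)). lia. }
    rewrite N1 in Hi by assumption.
    pose proof (midpt_range l (nx l u) A Hn).
    pose proof (greedy_arc_size l (nx l u) i A Hn ltac:(lia)) as S3.
    pose proof (Bdist_triangle (gam i) (gam (nx l u)) (gam u)). lra.
Qed.

Definition exits (W : nat -> Prop) (r : R) (t : nat) : Prop :=
  W (floorv W t) /\ exists a b, (floorv W t <= a <= t)%nat /\ (t <= b <= nextv n W (floorv W t))%nat /\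
    r <= Bdist (gam a) (gam t) /\ r <= Bdist (gam b) (gam t).

(* Points near a vertex of the greedy hierarchy are well inside an arc of the midpoint hierarchy. *)
Lemma exits_some l t r : (t < n)%nat -> r <= scale (S l) / 8 ->
  let u := floorv (greedy (S l)) t in
  u = 0%nat \/ nx (S l) u = n \/ nx (S l) (nx (S l) u) = n \/
  exits (greedy (S l)) r t \/ exits (greedy_mid (S l)) r t.
Proof.
  intros Ht Hr u.
  destruct (floorv_spec (greedy (S l)) t 0 (greedy_0 _)) as [Vu _]; [lia|]. fold u in Vu.
  pose proof (floorv_next n (greedy (S l)) (greedy_n _) (greedy_le _) t Ht Vu) as Hut. fold u in Hut.
  destruct (nextv_spec n (greedy (S l)) (greedy_n _) (greedy_le _) u ltac:(lia)) as [Vv [Huv _]].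
  set (v := nx (S l) u) in *. set (s := scale (S l)) in *.
  assert (Hs : 0 < s) by apply scale_pos.
  (* Only arcs that do not end at [n] are known to be long. The argument needs this for the arc of
     [t] and for the next one, and it needs a preceding arc. *)
  destruct (Nat.eq_dec u 0) as [|Hu0]; [auto|].
  destruct (Nat.eq_dec v n) as [|Hvn]; [auto|].
  destruct (Nat.eq_dec (nx (S l) v) n) as [|Hvvn]; [auto|].
  right; right; right.
  assert (Fuv : s <= Bdist (gam v) (gam u)) by (apply next_far; fold v; try assumption; lia).
  destruct (nextv_spec n (greedy (S l)) (greedy_n _) (greedy_le _) v ltac:(lia)) as [Vvv [Hvv _]].
  assert (Fvv : s <= Bdist (gam (nx (S l) v)) (gam v)) by (apply next_far; try assumption; lia).
  destruct (midpt_far l u Vu ltac:(lia) Fuv) as [M1 M2]. fold s v in M1, M2.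
  destruct (midpt_far l v Vv ltac:(lia) Fvv) as [M3 _]. fold s in M3.
  pose proof (midpt_range (S l) u Vu ltac:(lia)) as Hw. fold v in Hw.
  pose proof (midpt_range (S l) v Vv ltac:(lia)) as Hw'.
  set (w := midpt (S l) u) in *.
  pose proof (Bdist_triangle (gam w) (gam t) (gam u)) as T1.
  pose proof (Bdist_triangle (gam v) (gam t) (gam w)) as T2.
  pose proof (Bdist_triangle (gam v) (gam t) (gam u)) as T3.
  rewrite (Bdist_sym (gam t) (gam u)) in T1, T3. rewrite (Bdist_sym (gam t) (gam w)) in T2.
  assert (Hcase : (r <= Bdist (gam u) (gam t) /\ r <= Bdist (gam v) (gam t)) \/
    Bdist (gam u) (gam t) < r \/ Bdist (gam v) (gam t) < r).
  { destruct (Rle_lt_dec r (Bdist (gam u) (gam t))); destruct (Rle_lt_dec r (Bdist (gam v) (gam t))); auto. }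
  destruct Hcase as [[C1 C2]|Hcase].
  { left. split; [exact Vu|]. exists u, v. fold u. fold v. repeat split; try lia; assumption. }
  (* Now [t] is within s / 8 of a vertex. The adjacent midpoints are at least s / 4 from that
     vertex, hence at least s / 8 from [t]. *)
  right.
  destruct (Nat.le_gt_cases w t) as [L|L].
  - assert (Vw : greedy_mid (S l) w) by (right; exists u; repeat split; [lia|assumption]).
    destruct (greedy_mid_next (S l) u Vu ltac:(lia)) as [N1 _]. fold v w in N1. specialize (N1 ltac:(lia)).
    assert (E : floorv (greedy_mid (S l)) t = w).
    { apply (floorv_eq n (greedy_mid (S l)) (greedy_mid_n _) (greedy_mid_le _)); [assumption|rewrite N1; lia|assumption]. }
    unfold exits. rewrite E, N1. split; [assumption|].
    destruct Hcase as [Hc|Hc].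
    + exists w, v. repeat split; try lia; lra.
    + exists w, (midpt (S l) v).
      pose proof (Bdist_triangle (gam (midpt (S l) v)) (gam t) (gam v)) as T4.
      rewrite (Bdist_sym (gam t) (gam v)) in T4.
      repeat split; try lia; lra.
  - destruct (floorv_spec (greedy (S l)) (u - 1) 0 (greedy_0 _)) as [Vu1 _]; [lia|].
    pose proof (floorv_next n (greedy (S l)) (greedy_n _) (greedy_le _) (u - 1) ltac:(lia) Vu1) as Hu1.
    set (u1 := floorv (greedy (S l)) (u - 1)) in *.
    destruct (nextv_spec n (greedy (S l)) (greedy_n _) (greedy_le _) u1 ltac:(lia)) as [_ [_ C]].
    specialize (C u ltac:(lia) Vu). assert (E1 : nx (S l) u1 = u) by lia.
    assert (F1 : s <= Bdist (gam u) (gam u1)) by (rewrite <- E1; apply next_far; try assumption; lia).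
    destruct (midpt_far l u1 Vu1 ltac:(lia) ltac:(rewrite E1; exact F1)) as [_ M4]. rewrite E1 in M4. fold s in M4.
    pose proof (midpt_range (S l) u1 Vu1 ltac:(lia)) as Hw1. rewrite E1 in Hw1.
    destruct (greedy_mid_next (S l) u1 Vu1 ltac:(lia)) as [N1 _]. rewrite E1 in N1. specialize (N1 ltac:(lia)). fold w in N1.
    set (w1 := midpt (S l) u1) in *.
    assert (Vw : greedy_mid (S l) w1) by (right; exists u1; repeat split; [lia|assumption]).
    assert (E : floorv (greedy_mid (S l)) t = w1).
    { apply (floorv_eq n (greedy_mid (S l)) (greedy_mid_n _) (greedy_mid_le _)); [assumption|rewrite N1; lia|assumption]. }
    unfold exits. rewrite E, N1. split; [assumption|].
    destruct Hcase as [Hc|Hc].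
    + exists w1, w.
      pose proof (Bdist_triangle (gam u) (gam t) (gam w1)) as T4. rewrite (Bdist_sym (gam t) (gam w1)) in T4.
      repeat split; try lia; lra.
    + exists u, w. repeat split; try lia; lra.
Qed.
End Greedy.

(** * Finite sums and covers of a walk *)

Lemma Rinf_spec (S : R -> Prop) : (exists t, S t) -> (exists m, forall t, S t -> m <= t) -> is_glb S (Rinf S).
Proof.
  intros [t0 H0] [m Hm]. unfold Rinf. apply epsilon_spec.
  destruct (completeness (fun x => S (- x))) as [s [Hs1 Hs2]].
  - exists (- m). intros x Hx. specialize (Hm _ Hx). lra.
  - exists (- t0). rewrite Ropp_involutive. assumption.
  - exists (- s). split.
    + intros t Ht. assert (- t <= s) by (apply Hs1; rewrite Ropp_involutive; assumption). lra.
    + intros m' Hm'. assert (s <= - m') by (apply Hs2; intros x Hx; specialize (Hm' _ Hx); lra). lra.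
Qed.

Lemma Rsup_spec (S : R -> Prop) : (exists t, S t) -> (exists m, forall t, S t -> t <= m) -> is_lub S (Rsup S).
Proof.
  intros H0 [m Hm]. unfold Rsup. apply epsilon_spec.
  destruct (completeness S) as [s Hs]; [exists m; exact Hm|exact H0|eauto].
Qed.

Definition lsum {T : Type} (f : T -> R) (l : list T) : R := fold_right (fun x a => f x + a) 0 l.

Definition sel {T : Type} (P : T -> Prop) (l : list T) : list T :=
  filter (fun x => if excluded_middle_informative (P x) then true else false) l.

Section Lists.
Context {T : Type}.
Implicit Types (l : list T) (f g : T -> R) (P : T -> Prop).

Lemma In_sel P l x : In x (sel P l) <-> In x l /\ P x.
Proof.
  unfold sel. rewrite filter_In. destruct (excluded_middle_informative (P x)); split; intros [? ?]; auto; discriminate.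
Qed.

Lemma sel_cons_true P x l : P x -> sel P (x :: l) = x :: sel P l.
Proof. intros H. unfold sel; simpl. destruct (excluded_middle_informative (P x)); [reflexivity|contradiction]. Qed.

Lemma sel_cons_false P x l : ~ P x -> sel P (x :: l) = sel P l.
Proof. intros H. unfold sel; simpl. destruct (excluded_middle_informative (P x)); [contradiction|reflexivity]. Qed.

Lemma sel_ext P P' l : (forall x, In x l -> (P x <-> P' x)) -> sel P l = sel P' l.
Proof.
  induction l as [|x l IH]; intros H; [reflexivity|].
  destruct (classic (P x)) as [Hx|Hx].
  - rewrite !sel_cons_true; [f_equal; apply IH; intros; apply H; simpl; auto| |assumption].
    apply H; simpl; auto.
  - rewrite !sel_cons_false; [apply IH; intros; apply H; simpl; auto| |assumption].
    rewrite <- (H x); simpl; auto.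
Qed.

Lemma sel_sel P P' l : sel P (sel P' l) = sel (fun x => P x /\ P' x) l.
Proof.
  induction l as [|x l IH]; [reflexivity|].
  destruct (classic (P' x)) as [H'|H'].
  - rewrite (sel_cons_true P') by assumption. destruct (classic (P x)) as [H|H].
    + rewrite !sel_cons_true by auto. f_equal; assumption.
    + rewrite !sel_cons_false by tauto. assumption.
  - rewrite !(sel_cons_false) by tauto. assumption.
Qed.

Lemma NoDup_sel P l : NoDup l -> NoDup (sel P l).
Proof. apply NoDup_filter. Qed.

Lemma length_sel_le P P' l : (forall x, In x l -> P x -> P' x) -> (length (sel P l) <= length (sel P' l))%nat.
Proof.
  induction l as [|x l IH]; intros H; [simpl; lia|].
  assert (IH' : (length (sel P l) <= length (sel P' l))%nat) by (apply IH; intros; apply H; simpl; auto).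
  destruct (classic (P x)) as [Hx|Hx].
  - rewrite !sel_cons_true; [simpl; lia|apply H; simpl; auto|assumption].
  - rewrite (sel_cons_false P) by assumption. destruct (classic (P' x)) as [Hx'|Hx'].
    + rewrite sel_cons_true by assumption. simpl; lia.
    + rewrite sel_cons_false by assumption. assumption.
Qed.

Lemma length_sel_split P l : (length l = length (sel P l) + length (sel (fun x => ~ P x) l))%nat.
Proof.
  induction l as [|x l IH]; [reflexivity|]. destruct (classic (P x)) as [H|H].
  - rewrite (sel_cons_true P), (sel_cons_false (fun x => ~ P x)) by tauto. simpl; lia.
  - rewrite (sel_cons_false P), (sel_cons_true (fun x => ~ P x)) by tauto. simpl; lia.
Qed.

Lemma lsum_cons f x l : lsum f (x :: l) = f x + lsum f l.
Proof. reflexivity. Qed.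

Lemma lsum_app f l l' : lsum f (l ++ l') = lsum f l + lsum f l'.
Proof. induction l as [|x l IH]; [unfold lsum; simpl; ring|]. rewrite <- app_comm_cons, !lsum_cons, IH. ring. Qed.

Lemma lsum_le f g l : (forall x, In x l -> f x <= g x) -> lsum f l <= lsum g l.
Proof.
  induction l as [|x l IH]; intros H; [simpl; lra|]. rewrite !lsum_cons.
  pose proof (H x (or_introl eq_refl)). assert (lsum f l <= lsum g l) by (apply IH; intros; apply H; simpl; auto). lra.
Qed.

Lemma lsum_nonneg f l : (forall x, In x l -> 0 <= f x) -> 0 <= lsum f l.
Proof.
  intros H. replace 0 with (lsum (fun _ : T => 0) l) by (clear; induction l; simpl; lra).
  apply lsum_le; assumption.
Qed.

Lemma lsum_const c l : lsum (fun _ => c) l = INR (length l) * c.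
Proof.
  induction l as [|x l IH]; [simpl; ring|]. rewrite lsum_cons, IH. simpl length. rewrite S_INR. ring.
Qed.

Lemma lsum_add f g l : lsum (fun x => f x + g x) l = lsum f l + lsum g l.
Proof. induction l as [|x l IH]; [unfold lsum; simpl; ring|]. rewrite !lsum_cons, IH. ring. Qed.

Lemma lsum_scal c f l : lsum (fun x => c * f x) l = c * lsum f l.
Proof. induction l as [|x l IH]; [unfold lsum; simpl; ring|]. rewrite !lsum_cons, IH. ring. Qed.

Lemma lsum_sel_split f P l : lsum f l = lsum f (sel P l) + lsum f (sel (fun x => ~ P x) l).
Proof.
  induction l as [|x l IH]; [simpl; ring|]. destruct (classic (P x)) as [H|H].
  - rewrite (sel_cons_true P), (sel_cons_false (fun x => ~ P x)) by tauto. rewrite !lsum_cons, IH; ring.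
  - rewrite (sel_cons_false P), (sel_cons_true (fun x => ~ P x)) by tauto. rewrite !lsum_cons, IH; ring.
Qed.

Lemma lsum_sel_indicator f P l :
  lsum (fun x => if excluded_middle_informative (P x) then f x else 0) l = lsum f (sel P l).
Proof.
  induction l as [|x l IH]; [reflexivity|]. rewrite lsum_cons, IH. unfold sel; simpl.
  destruct (excluded_middle_informative (P x)); simpl; [reflexivity|ring].
Qed.

Lemma lsum_Permutation f l l' : Permutation l l' -> lsum f l = lsum f l'.
Proof. induction 1; rewrite ?lsum_cons; lra. Qed.

End Lists.

(** * Crowded groups and sparse lists *)

Section Separation.
Context {T : Type}.
Variable near : T -> T -> Prop.
Hypothesis near_refl : forall x, near x x.
Hypothesis near_sym : forall x y, near x y -> near y x.
Variable N : nat.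

Definition sparse (l : list T) : Prop := forall x, In x l -> (length (sel (near x) l) < N)%nat.

Lemma sparse_sub P l : sparse l -> sparse (sel P l).
Proof.
  intros H x Hx. apply In_sel in Hx. destruct Hx as [Hx _].
  eapply Nat.le_lt_trans; [|apply (H x Hx)]. rewrite sel_sel.
  apply length_sel_le. tauto.
Qed.

Lemma Permutation_sel_split P (l : list T) : Permutation l (sel P l ++ sel (fun x => ~ P x) l).
Proof.
  induction l as [|x l IH]; [constructor|]. destruct (classic (P x)) as [H|H].
  - rewrite (sel_cons_true P), (sel_cons_false (fun x => ~ P x)) by tauto. simpl. constructor. assumption.
  - rewrite (sel_cons_false P), (sel_cons_true (fun x => ~ P x)) by tauto.
    apply Permutation_cons_app. assumption.
Qed.

(** As long as some point has at least [N] near points, its whole neighbourhood is split off as a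
    group. The centre of a group later bounds the size of the set into which the group is merged. *)
Lemma crowded_split (l : list T) : (0 < N)%nat -> exists G l2,
  Permutation l (concat G ++ l2) /\ sparse l2 /\
  forall g, In g G -> (N <= length g)%nat /\ exists x, In x g /\ forall y, In y g -> near x y.
Proof.
  intros HN. remember (length l) as k eqn:Ek. revert l Ek.
  induction k as [k IH] using lt_wf_ind. intros l Ek.
  destruct (classic (sparse l)) as [H|H].
  - exists nil, l. simpl. split; [reflexivity|]. split; [assumption|]. intros g [].
  - apply not_all_ex_not in H. destruct H as [x H]. apply imply_to_and in H. destruct H as [Hx H].
    pose proof (length_sel_split (near x) l).
    destruct (IH (length (sel (fun y => ~ near x y) l)) ltac:(lia) _ eq_refl) as [G [l2 [H1 [H2 H3]]]].
    exists (sel (near x) l :: G), l2. split; [|split; [assumption|]].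
    + simpl. rewrite <- app_assoc. rewrite <- H1. apply Permutation_sel_split.
    + intros g [<-|Hg]; [|auto]. split; [lia|]. exists x. rewrite In_sel. split; [auto|].
      intros y Hy. apply In_sel in Hy. tauto.
Qed.

(** Greedy choice: keeping a point discards fewer than [N] points, itself included. *)
Lemma sparse_thin (l : list T) : sparse l -> exists Y,
  incl Y l /\ ForallOrdPairs (fun x y => ~ near x y) Y /\ (length l <= N * length Y)%nat.
Proof.
  remember (length l) as k eqn:Ek. revert l Ek.
  induction k as [k IH] using lt_wf_ind. intros l Ek Hl.
  destruct l as [|x l'] eqn:El; [exists nil; simpl in *; repeat split; [intros ? []|constructor|lia]|].
  rewrite <- El in *.
  assert (Hx : In x l) by (rewrite El; simpl; auto).
  pose proof (length_sel_split (near x) l) as HS.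
  assert (Hxx : (0 < length (sel (near x) l))%nat).
  { assert (In x (sel (near x) l)) by (apply In_sel; auto). destruct (sel (near x) l); [contradiction|simpl; lia]. }
  destruct (IH (length (sel (fun y => ~ near x y) l)) ltac:(lia) _ eq_refl (sparse_sub _ _ Hl)) as [Y [H1 [H2 H3]]].
  exists (x :: Y). split; [|split].
  - intros y [<-|Hy]; [assumption|]. apply H1 in Hy. apply In_sel in Hy. tauto.
  - constructor; [|assumption]. apply Forall_forall. intros y Hy. apply H1, In_sel in Hy. tauto.
  - specialize (Hl x Hx). simpl. nia.
Qed.
End Separation.

Lemma fiber_sum {T : Type} (f : T -> nat) (W : nat -> R) (N : nat) (l : list T) (m : nat) :
  (forall i, 0 <= W i) -> (forall x, In x l -> (f x < m)%nat) ->
  (forall i, (length (sel (fun x => f x = i) l) <= N)%nat) ->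
  lsum (fun x => W (f x)) l <= INR N * psum W m.
Proof.
  intros HW. revert l. induction m as [|m IH]; intros l Hl HN.
  - destruct l as [|x l]; [simpl; lra|]. specialize (Hl x (or_introl eq_refl)). lia.
  - rewrite (lsum_sel_split _ (fun x => f x = m)). simpl psum. rewrite Rmult_plus_distr_l, Rplus_comm.
    apply Rplus_le_compat.
    + apply IH.
      * intros x Hx. apply In_sel in Hx. destruct Hx as [Hx Hm]. specialize (Hl x Hx). lia.
      * intros i. rewrite sel_sel. eapply Nat.le_trans; [|apply (HN i)]. apply length_sel_le. tauto.
    + apply Rle_trans with (lsum (fun _ => W m) (sel (fun x => f x = m) l)).
      * apply lsum_le. intros x Hx. apply In_sel in Hx. destruct Hx as [_ ->]. lra.
      * rewrite lsum_const. apply Rmult_le_compat_r; [apply HW|]. apply le_INR, HN.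
Qed.

(** * Covers of the walk and their cost *)

Section Covers.
Context {X : Banach}.
Variables (gam : nat -> X) (n : nat) (rho : R).
Hypothesis rho_pos : 0 < rho.
Hypothesis gam_step : forall i, (i < n)%nat -> Bdist (gam (S i)) (gam i) <= rho.

(** The number is the size charged for the set. It only has to dominate the diameter, so no supremum
    is ever computed for a merged set. *)
Notation cset := ((nat -> Prop) * R)%type.

Definition cost (C : list cset) : R := lsum snd C.

Definition meets (V : nat -> Prop) (E : cset) : Prop := exists i, (i <= n)%nat /\ fst E i /\ V i.

(* The extra [rho] absorbs the steps of the walk: the sets of a cover behave as if they covered a
   connected set. *)
Definition admissible (delta : R) (E : cset) : Prop :=
  0 <= snd E <= delta /\
  forall i j, (i <= n)%nat -> (j <= n)%nat -> fst E i -> fst E j -> Bdist (gam i) (gam j) + rho <= snd E.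

Definition is_cover (delta : R) (C : list cset) : Prop :=
  (forall E, In E C -> admissible delta E) /\ forall i, (i <= n)%nat -> exists E, In E C /\ fst E i.

Lemma cost_nonneg delta C : (forall E, In E C -> admissible delta E) -> 0 <= cost C.
Proof. intros H. apply lsum_nonneg. intros E HE. apply H in HE. apply HE. Qed.

(** Take a set containing [a], go to its last index a' up to [b], discard the set and restart at a'
    + 1, where the other sets still cover. The step from a' to a' + 1 is paid by the [rho] in
    [admissible]. *)
Lemma chain_cost delta C a b : (forall E, In E C -> admissible delta E) -> (a <= b <= n)%nat ->
  (forall i, (a <= i <= b)%nat -> exists E, In E C /\ fst E i) ->
  Bdist (gam b) (gam a) + rho <= cost C.
Proof.
  remember (length C) as k eqn:Ek. revert C a Ek.
  induction k as [k IH] using lt_wf_ind. intros C a Ek HC Hab Hcov.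
  destruct (Hcov a ltac:(lia)) as [E [HE Ea]].
  apply in_split in HE as HE'. destruct HE' as [C1 [C2 EC]].
  destruct (floorv_spec (fst E) b a Ea ltac:(lia)) as [F1 F2].
  pose proof (floorv_le (fst E) b) as F3. set (a' := floorv (fst E) b) in *.
  pose proof (F2 a ltac:(lia) Ea) as F4.
  destruct (HC E HE) as [_ HE1].
  pose proof (HE1 a' a ltac:(lia) ltac:(lia) F1 Ea) as D1.
  assert (HC' : forall E0, In E0 (C1 ++ C2) -> admissible delta E0).
  { intros E0 H0. apply HC. rewrite EC. apply in_or_app. apply in_app_or in H0. simpl. tauto. }
  assert (Ecost : cost C = snd E + cost (C1 ++ C2)).
  { unfold cost. rewrite EC, !lsum_app, lsum_cons. ring. }
  rewrite Ecost. destruct (Nat.eq_dec a' b) as [Eb|Nb].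
  - rewrite Eb in D1. pose proof (cost_nonneg delta _ HC'). lra.
  - assert (IHC : Bdist (gam b) (gam (S a')) + rho <= cost (C1 ++ C2)).
    { apply (IH (length (C1 ++ C2))); try assumption; try lia.
      - rewrite Ek, EC, !length_app. simpl. lia.
      - intros i Hi. destruct (Hcov i ltac:(lia)) as [E0 [H0 Hi0]]. exists E0. split; [|assumption].
        rewrite EC in H0. apply in_or_app. apply in_app_or in H0. destruct H0 as [H0|[H0|H0]]; auto.
        subst E0. specialize (F2 i ltac:(lia) Hi0). lia. }
    pose proof (gam_step a' ltac:(lia)).
    pose proof (Bdist_triangle (gam b) (gam (S a')) (gam a)).
    pose proof (Bdist_triangle (gam (S a')) (gam a') (gam a)). lra.
Qed.

Lemma region_cost delta C V a b : is_cover delta C -> (a <= b <= n)%nat ->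
  (forall i, (a <= i <= b)%nat -> V i) ->
  Bdist (gam b) (gam a) + rho <= cost (sel (meets V) C).
Proof.
  intros [H1 H2] Hab HV. apply (chain_cost delta); [|assumption|].
  - intros E HE. apply In_sel in HE. apply H1. tauto.
  - intros i Hi. destruct (H2 i ltac:(lia)) as [E [HE Ei]]. exists E. split; [|assumption].
    apply In_sel. split; [assumption|]. exists i. repeat split; [lia|assumption|apply HV; lia].
Qed.

Definition iball (t : nat) (r : R) : nat -> Prop := fun i => Bdist (gam i) (gam t) < r.

(** The stretch from [t] up to the first exit from the ball has extent at least r - rho, and
    [region_cost] adds the missing [rho]. The exit is sought forwards or backwards according to the
    position of [j]. *)
Lemma ball_cost delta C t j r : is_cover delta C -> (t <= n)%nat -> (j <= n)%nat ->
  0 < r <= Bdist (gam j) (gam t) -> r <= cost (sel (meets (iball t r)) C).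
Proof.
  intros HC Ht Hj Hr. unfold iball.
  destruct (lt_eq_lt_dec t j) as [[L|L]|L].
  - destruct (least_spec (fun i => (t < i)%nat /\ r <= Bdist (gam i) (gam t)) j) as [[A1 A2] A3]; [exists j; split; [assumption|lra]|].
    set (e := least _ j) in *. assert (e <= j)%nat by (apply A3; split; [assumption|lra]).
    assert (H1 : Bdist (gam (e - 1)%nat) (gam t) + rho <= cost (sel (meets (iball t r)) C)).
    { apply (region_cost delta); [assumption|lia|]. intros i Hi. unfold iball. apply Rnot_le_lt. intros HL.
      destruct (Nat.eq_dec i t) as [->|N]; [rewrite Bdist_refl in HL; lra|].
      assert (e <= i)%nat by (apply A3; split; [lia|assumption]). lia. }
    pose proof (gam_step (e - 1) ltac:(lia)) as S1. replace (S (e - 1)) with e in S1 by lia.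
    pose proof (Bdist_triangle (gam e) (gam (e - 1)%nat) (gam t)). unfold iball in *. lra.
  - subst. rewrite Bdist_refl in Hr. lra.
  - destruct (floorv_spec (fun i => r <= Bdist (gam i) (gam t)) t j) as [A1 A2]; [lra|lia|].
    pose proof (floorv_le (fun i => r <= Bdist (gam i) (gam t)) t).
    set (e := floorv _ t) in *.
    assert (e <> t) by (intros E; rewrite E, Bdist_refl in A1; lra).
    assert (H1 : Bdist (gam t) (gam (S e)) + rho <= cost (sel (meets (iball t r)) C)).
    { apply (region_cost delta); [assumption|lia|]. intros i Hi. unfold iball. apply Rnot_le_lt. intros HL.
      specialize (A2 i ltac:(lia) HL). lia. }
    pose proof (gam_step e ltac:(lia)) as S1.
    pose proof (Bdist_triangle (gam t) (gam (S e)) (gam e)). rewrite (Bdist_sym (gam e)) in A1.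
    unfold iball in *. lra.
Qed.

Section Merging.
Context {T : Type}.
Variables (reg : T -> nat -> Prop).

Definition separates (C : list cset) (ts : list T) : Prop :=
  forall E, In E C -> ForallOrdPairs (fun x y => ~ (meets (reg x) E /\ meets (reg y) E)) ts.

(** The sets meeting no region stay in the inequality because [merge] reuses them. *)
Lemma disjoint_cost m C ts : separates C ts ->
  (forall x, In x ts -> m x <= cost (sel (meets (reg x)) C)) ->
  lsum m ts + cost (sel (fun E => forall x, In x ts -> ~ meets (reg x) E) C) <= cost C.
Proof.
  revert C; induction ts as [|x ts IH]; intros C HS Hm.
  - simpl. assert (E : sel (fun E => forall x, False -> ~ meets (reg x) E) C = C); [|rewrite E; lra].
    clear. induction C as [|E C IH]; [reflexivity|]. rewrite sel_cons_true by tauto. f_equal; assumption.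
  - rewrite lsum_cons. set (C' := sel (fun E => ~ meets (reg x) E) C).
    assert (E1 : cost C = cost (sel (meets (reg x)) C) + cost C') by (exact (lsum_sel_split snd (meets (reg x)) C)).
    assert (HS' : separates C' ts).
    { intros E HE. apply In_sel in HE. destruct HE as [HE _]. specialize (HS E HE). inversion HS; assumption. }
    assert (E2 : forall y, In y ts -> sel (meets (reg y)) C' = sel (meets (reg y)) C).
    { intros y Hy. unfold C'. rewrite sel_sel. apply sel_ext. intros E HE. split; [tauto|]. intros HM.
      split; [assumption|]. intros HM'. specialize (HS E HE). inversion HS as [|? ? HF _]; subst.
      rewrite Forall_forall in HF. apply (HF y Hy). tauto. }
    specialize (IH C' HS' ltac:(intros y Hy; rewrite E2 by assumption; apply Hm; simpl; auto)).
    unfold C' in IH at 1. rewrite sel_sel in IH.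
    rewrite (sel_ext _ (fun E => (forall y, In y ts -> ~ meets (reg y) E) /\ ~ meets (reg x) E)).
    + specialize (Hm x (or_introl eq_refl)). lra.
    + intros E _. split; [intros H; split; [intros; apply H; simpl; auto|apply H; simpl; auto]|].
      intros [H1 H2] y [<-|Hy]; auto.
Qed.

(** For each [x] all sets meeting its region are replaced by their union, charged [w]. By separation
    no set is used for two regions, so the savings [m] add up. *)
Lemma merge m w delta' delta C ts : is_cover delta' C -> delta' <= delta -> 0 <= w <= delta ->
  separates C ts ->
  (forall x, In x ts -> w + m x <= cost (sel (meets (reg x)) C)) ->
  (forall x E E', In x ts -> In E C -> In E' C -> meets (reg x) E -> meets (reg x) E' ->
     forall i j, (i <= n)%nat -> (j <= n)%nat -> fst E i -> fst E' j -> Bdist (gam i) (gam j) + rho <= w) ->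
  exists C', is_cover delta C' /\ cost C' + lsum m ts <= cost C.
Proof.
  intros [HC1 HC2] Hd Hw HS Hm Hdiam.
  pose proof (disjoint_cost (fun x => w + m x) C ts HS Hm) as HD.
  rewrite lsum_add, lsum_const in HD.
  exists (map (fun x => (fun i => exists E, In E C /\ meets (reg x) E /\ fst E i, w)) ts ++
     sel (fun E => forall x, In x ts -> ~ meets (reg x) E) C).
  split; [split|].
  - intros E HE. apply in_app_or in HE. destruct HE as [HE|HE].
    + apply in_map_iff in HE. destruct HE as [x [<- Hx]]. split; [exact Hw|]. simpl.
      intros i j Hi Hj [E1 [A1 [A2 A3]]] [E2 [B1 [B2 B3]]]. apply (Hdiam x E1 E2); assumption.
    + apply In_sel in HE. destruct (HC1 E) as [A B]; [tauto|]. split; [lra|assumption].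
  - intros i Hi. destruct (HC2 i Hi) as [E [HE Ei]].
    destruct (classic (exists x, In x ts /\ meets (reg x) E)) as [[x [Hx HM]]|N].
    + eexists. split; [apply in_or_app; left; apply in_map_iff; exists x; split; [reflexivity|assumption]|].
      simpl. eauto.
    + exists E. split; [|assumption]. apply in_or_app; right. apply In_sel. split; [assumption|].
      intros x Hx HM. apply N; eauto.
  - unfold cost in *. rewrite lsum_app.
    assert (E : lsum snd (map (fun x => (fun i => exists E, In E C /\ meets (reg x) E /\ fst E i, w)) ts) = INR (length ts) * w).
    { clear. induction ts as [|x ts IH]; [simpl; ring|]. simpl map. rewrite lsum_cons, IH. simpl length. rewrite S_INR. simpl. ring. }
    rewrite E. lra.
Qed.
End Merging.

(** * Discretized Hausdorff content *)

Definition content (delta : R) : R := Rinf (fun t => exists C, is_cover delta C /\ t = cost C).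

(** The cost does not depend on [delta], so one bound holds for all contents; it is the budget of
    every telescoping sum. *)
Lemma singleton_cover delta : rho <= delta -> exists C, is_cover delta C /\ cost C = INR (S n) * rho.
Proof.
  intros Hd. exists (map (fun i => (fun j => j = i, rho)) (seq 0 (S n))). split; [split|].
  - intros E HE. apply in_map_iff in HE. destruct HE as [i [<- _]]. split; [simpl; lra|]. simpl.
    intros a b _ _ -> ->. rewrite Bdist_refl. lra.
  - intros i Hi. exists (fun j => j = i, rho). split; [|reflexivity].
    apply in_map_iff. exists i. split; [reflexivity|]. apply in_seq. lia.
  - rewrite <- (length_seq (S n) 0) at 2. generalize (seq 0 (S n)). clear.
    intros l. unfold cost. induction l as [|x l IH]; [simpl; ring|].
    simpl map. rewrite lsum_cons, IH. simpl length. rewrite S_INR. simpl. ring.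
Qed.

Lemma content_glb delta : rho <= delta -> is_glb (fun t => exists C, is_cover delta C /\ t = cost C) (content delta).
Proof.
  intros Hd. apply Rinf_spec.
  - destruct (singleton_cover delta Hd) as [C [HC _]]. eauto.
  - exists 0. intros t [C [[HC _] ->]]. eapply cost_nonneg; eassumption.
Qed.

Lemma content_bounds delta : rho <= delta -> 0 <= content delta <= INR (S n) * rho.
Proof.
  intros Hd. destruct (content_glb delta Hd) as [H1 H2]. split.
  - apply H2. intros t [C [[HC _] ->]]. eapply cost_nonneg; eassumption.
  - destruct (singleton_cover delta Hd) as [C [HC E]]. apply H1. eauto.
Qed.

Lemma content_gain delta' delta g : rho <= delta' -> rho <= delta ->
  (forall C, is_cover delta' C -> exists C', is_cover delta C' /\ cost C' + g <= cost C) ->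
  content delta + g <= content delta'.
Proof.
  intros H1 H2 H. destruct (content_glb delta' H1) as [_ G]. apply G. intros t [C [HC ->]].
  destruct (H C HC) as [C' [HC' HE]]. destruct (content_glb delta H2) as [G' _].
  specialize (G' (cost C') (ex_intro _ C' (conj HC' eq_refl))). lra.
Qed.

Lemma content_anti delta' delta : rho <= delta' <= delta -> content delta <= content delta'.
Proof.
  intros H. enough (content delta + 0 <= content delta') by lra.
  apply content_gain; try lra. intros C [H1 H2]. exists C. split; [|lra]. split; [|assumption].
  intros E HE. destruct (H1 E HE). split; [lra|assumption].
Qed.
End Covers.

(** * Merging covers *)

Section Savings.
Context {X : Banach}.
Variables (gam : nat -> X) (n : nat) (rho : R).
Hypothesis rho_pos : 0 < rho.
Hypothesis gam_step : forall i, (i < n)%nat -> Bdist (gam (S i)) (gam i) <= rho.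

Notation is_cover := (is_cover gam n rho).
Notation meets := (meets n).
Notation iball := (iball gam).
Notation content := (content gam n rho).

(** [thick_gain] compares this cost with the size 2 R0 + B R0 / 256 + rho of one merged set, where B
    < 2 b. All fine covers are quantified over because the content is an infimum. *)
Definition thick (R0 b : R) (t : nat) : Prop :=
  forall delta C, is_cover delta C -> delta <= b * R0 / 256 ->
    2 * R0 + b * R0 / 45 <= cost (sel (meets (iball t R0)) C).

(* A flat arc crosses the ball in both directions, hence costs nearly [2 * R0]; a point of the walk
   at distance [b * R0 / 4] from the axis of the arc costs another multiple of [b * R0]. *)
Lemma thick_of_flat (t u v : nat) (psi : nat -> R) (eta R0 b : R) :
  (u <= t <= v)%nat -> (v <= n)%nat -> 0 < R0 -> 0 < b <= 2 ->
  (forall i, (u <= i <= v)%nat -> Bdist (gam i) (segpt (gam u) (gam v) (psi i)) <= eta) ->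
  (forall i j, (u <= i <= j)%nat -> (j <= v)%nat -> psi i <= psi j) ->
  eta <= b * R0 / 1000 -> rho <= b * R0 / 100000 ->
  (exists a, (u <= a <= t)%nat /\ R0 <= Bdist (gam a) (gam t)) ->
  (exists a, (t <= a <= v)%nat /\ R0 <= Bdist (gam a) (gam t)) ->
  (forall a w : X, w <> Bzero -> exists z, (z <= n)%nat /\ Bdist (gam z) (gam t) <= R0 / 2 /\
      forall s, b * R0 / 4 <= Bdist (gam z) (Badd a (Bscal s w))) ->
  thick R0 b t.
Proof.
  intros Ht Hv HR Hb Hflat Hmono Heta Hrho [a0 [Ha0 Da0]] [b0 [Hb0 Db0]] Hline delta C HC Hdelta.
  assert (Heta0 : 0 <= eta) by (eapply Rle_trans; [|apply (Hflat t); lia]; apply Bdist_nonneg).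
  assert (HbR : 0 < b * R0) by nra.
  assert (HbR2 : b * R0 <= 2 * R0) by nra.
  set (D := Bdist (gam v) (gam u)).
  assert (Hseg : forall i j, (u <= i <= j)%nat -> (j <= v)%nat ->
    Bdist (segpt (gam u) (gam v) (psi j)) (segpt (gam u) (gam v) (psi i)) = (psi j - psi i) * D).
  { intros i j Hi Hj. rewrite segpt_dist, Rabs_pos_eq; [reflexivity|]. pose proof (Hmono i j Hi Hj). lra. }
  assert (Happ : forall i j, (u <= i <= j)%nat -> (j <= v)%nat ->
    (psi j - psi i) * D - 2 * eta <= Bdist (gam j) (gam i) <= (psi j - psi i) * D + 2 * eta).
  { intros i j Hi Hj. pose proof (Hflat i ltac:(lia)) as F1. pose proof (Hflat j ltac:(lia)) as F2.
    rewrite <- (Hseg i j Hi Hj).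
    set (pi := segpt (gam u) (gam v) (psi i)) in *. set (pj := segpt (gam u) (gam v) (psi j)) in *.
    pose proof (Bdist_triangle pj (gam j) pi) as T1. pose proof (Bdist_triangle (gam j) (gam i) pi) as T2.
    pose proof (Bdist_triangle (gam j) pj (gam i)) as T3. pose proof (Bdist_triangle pj pi (gam i)) as T4.
    rewrite (Bdist_sym pj (gam j)) in T1. rewrite (Bdist_sym pi (gam i)) in T4. lra. }
  assert (HD : Bsub (gam v) (gam u) <> Bzero).
  { intros E. assert (D = 0) by (unfold D, Bdist; rewrite E; apply Bnorm_zero).
    pose proof (Happ t b0 ltac:(lia) ltac:(lia)) as H1. rewrite H in H1. nra. }
  destruct (Hline (gam u) _ HD) as [z [Hz [Dz Lz]]].
  assert (Far : forall i, (u <= i <= v)%nat -> b * R0 / 4 - b * R0 / 1000 <= Bdist (gam z) (gam i)).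
  { intros i Hi. specialize (Lz (psi i)). pose proof (Hflat i Hi) as F. unfold segpt in F.
    pose proof (Bdist_triangle (gam z) (gam i) (Badd (gam u) (Bscal (psi i) (Bsub (gam v) (gam u))))). lra. }
  destruct (floorv_spec (fun i => R0 <= Bdist (gam i) (gam t)) t a0 Da0 ltac:(lia)) as [A1 A2].
  pose proof (floorv_le (fun i => R0 <= Bdist (gam i) (gam t)) t) as A3.
  set (a := floorv _ t) in *. pose proof (A2 a0 ltac:(lia) Da0) as A4.
  assert (A5 : a <> t) by (intros E; rewrite E, Bdist_refl in A1; lra).
  destruct (least_spec (fun i => (t <= i)%nat /\ R0 <= Bdist (gam i) (gam t)) n) as [[B1 B2] B3]; [exists b0; split; [lia|assumption]|].
  set (e := least _ n) in *.
  assert (B4 : (e <= b0)%nat) by (apply B3; split; [lia|assumption]).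
  assert (B5 : e <> t) by (intros E; rewrite E, Bdist_refl in B2; lra).
  (* [U1] is the stretch of the arc around [t] before it leaves the ball, [U2] a small ball about
     the far point [z]. The distance of [z] from the arc, nearly b R0 / 4, exceeds b R0 / 32 plus
     the size b R0 / 256 of a covering set, so no set meets both. *)
  set (U1 := fun i => (S a <= i <= e - 1)%nat).
  set (U2 := iball z (b * R0 / 32)).
  assert (S1 : forall i, U1 i -> iball t R0 i).
  { intros i Hi. unfold iball. apply Rnot_le_lt. intros HL. unfold U1 in Hi.
    destruct (Nat.le_gt_cases t i).
    - assert (e <= i)%nat by (apply B3; split; assumption). lia.
    - specialize (A2 i ltac:(lia) HL). lia. }
  assert (S2 : forall i, U2 i -> iball t R0 i).
  { intros i Hi. unfold U2, iball in *. pose proof (Bdist_triangle (gam i) (gam z) (gam t)). lra. }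
  set (C' := sel (meets (iball t R0)) C).
  assert (SC : forall U : nat -> Prop, (forall i, U i -> iball t R0 i) -> sel (meets U) C' = sel (meets U) C).
  { intros U HU. unfold C'. rewrite sel_sel. apply sel_ext. intros E _. split; [tauto|].
    intros HM. split; [assumption|]. destruct HM as [i [M1 [M2 M3]]]. exists i. auto. }
  pose proof (disjoint_cost n (fun x : bool => if x then U1 else U2)
    (fun x : bool => if x then 2 * R0 - 6 * eta - rho else b * R0 / 32) C' (true :: false :: nil)) as HDC.
  (* Additivity along the arc is used three times, at 2 eta each; dropping the ends [a] and [e]
     loses two steps, of which [region_cost] returns one. With the share of [U2] this leaves 1/32 -
     6/1000 - 1/100000 > 1/45. *)
  assert (HC1 : 2 * R0 - 6 * eta - rho <= cost (sel (meets U1) C)).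
  { pose proof (region_cost gam n rho gam_step delta C U1 (S a) (e - 1) HC ltac:(lia) ltac:(auto)) as RC.
    pose proof (Happ a t ltac:(lia) ltac:(lia)) as P1. pose proof (Happ t e ltac:(lia) ltac:(lia)) as P2.
    pose proof (Happ a e ltac:(lia) ltac:(lia)) as P3.
    pose proof (gam_step a ltac:(lia)) as G1. pose proof (gam_step (e - 1) ltac:(lia)) as G2.
    replace (S (e - 1)) with e in G2 by lia.
    pose proof (Bdist_triangle (gam e) (gam (e - 1)%nat) (gam a)).
    pose proof (Bdist_triangle (gam (e - 1)%nat) (gam (S a)) (gam a)).
    rewrite (Bdist_sym (gam a)) in A1. nra. }
  assert (HC2 : b * R0 / 32 <= cost (sel (meets U2) C)).
  { apply (ball_cost gam n rho gam_step delta C z t); try assumption; [lia|].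
    pose proof (Far t ltac:(lia)) as F. rewrite Bdist_sym in F. lra. }
  assert (HSep : separates n (fun x : bool => if x then U1 else U2) C' (true :: false :: nil)).
  { intros E HE. apply In_sel in HE. destruct HE as [HE _].
    constructor; [|constructor; [constructor|constructor]]. constructor; [|constructor].
    intros [[i [M1 [M2 M3]]] [j [N1 [N2 N3]]]].
    destruct HC as [HC _]. destruct (HC E HE) as [Q1 Q2]. specialize (Q2 i j M1 N1 M2 N2).
    unfold U1 in M3. pose proof (Far i ltac:(lia)) as F. unfold U2, iball in N3.
    pose proof (Bdist_triangle (gam z) (gam j) (gam i)) as T.
    rewrite (Bdist_sym (gam z) (gam j)), (Bdist_sym (gam j) (gam i)) in T. lra. }
  specialize (HDC HSep).
  assert (Hpre : forall x : bool, In x (true :: false :: nil) ->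
    (if x then 2 * R0 - 6 * eta - rho else b * R0 / 32) <= cost (sel (meets (if x then U1 else U2)) C')).
  { intros [|] _; rewrite SC by assumption; assumption. }
  specialize (HDC Hpre). simpl in HDC.
  assert (0 <= cost (sel (fun E => forall x : bool, true = x \/ false = x \/ False -> ~ meets (if x then U1 else U2) E) C')).
  { apply (cost_nonneg gam n rho delta). intros E HE. apply In_sel in HE. destruct HE as [HE _].
    apply In_sel in HE. destruct HC as [HC _]. apply HC. tauto. }
  unfold C' in *. lra.
Qed.

Lemma ForallOrdPairs_impl_in {T} (P Q : T -> T -> Prop) (l : list T) :
  (forall x y, In x l -> In y l -> P x y -> Q x y) -> ForallOrdPairs P l -> ForallOrdPairs Q l.
Proof.
  intros H HP. induction HP as [|x l Hx HP IH]; [constructor|]. constructor.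
  - rewrite Forall_forall in *. intros y Hy. apply H; simpl; auto.
  - apply IH. intros; apply H; simpl; auto.
Qed.

Lemma NoDup_ForallOrdPairs {T} (l : list T) : NoDup l -> ForallOrdPairs (fun x y => x <> y) l.
Proof.
  induction 1 as [|x l Hx Hl IH]; constructor; [|assumption].
  apply Forall_forall. intros y Hy ->. contradiction.
Qed.

Lemma NoDup_app_notin {T} (l l' : list T) x : NoDup (l ++ l') -> In x l -> ~ In x l'.
Proof.
  intros H Hx Hx'. apply in_split in Hx. destruct Hx as [l1 [l2 ->]].
  rewrite <- app_assoc in H. simpl in H. apply NoDup_remove_2 in H. apply H.
  rewrite !in_app_iff. auto.
Qed.

Lemma NoDup_concat_disjoint {T} (G : list (list T)) : NoDup (concat G) ->
  ForallOrdPairs (fun g g' => forall x y, In x g -> In y g' -> x <> y) G.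
Proof.
  induction G as [|g G IH]; intros H; constructor; simpl in H.
  - apply Forall_forall. intros g' Hg' x y Hx Hy ->.
    apply (NoDup_app_notin _ _ y H Hx).
    apply in_concat. eauto.
  - apply IH. apply NoDup_app_remove_l in H. assumption.
Qed.

Lemma NoDup_concat_in {T} (G : list (list T)) g : NoDup (concat G) -> In g G -> NoDup g.
Proof.
  induction G as [|g' G IH]; intros H [].
  - subst. simpl in H. apply NoDup_app_remove_r in H. assumption.
  - simpl in H. apply IH; [apply NoDup_app_remove_l in H|]; assumption.
Qed.

(** An admissible set that contains an index has size at least [rho], so there are no covers at
    scales below [rho]; freezing the content there lets the sums telescope over all indices. *)
Definition capped (delta : R) : R := content (Rmax rho delta).

Lemma capped_bounds delta : 0 <= capped delta <= INR (S n) * rho.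
Proof. apply content_bounds; [assumption|apply Rmax_l]. Qed.

Lemma capped_anti delta' delta : delta' <= delta -> capped delta <= capped delta'.
Proof.
  intros H. apply content_anti; [assumption|]. split; [apply Rmax_l|].
  apply Rmax_lub; [apply Rmax_l|]. eapply Rle_trans; [exact H|apply Rmax_r].
Qed.

Lemma capped_eq delta : rho <= delta -> capped delta = content delta.
Proof. intros H. unfold capped. rewrite Rmax_right by assumption. reflexivity. Qed.

(* Merging all small sets that meet a crowded group of well separated points. *)
Lemma crowded_gain (G : list (list nat)) (r D : R) (N : nat) :
  0 < r -> 0 <= D -> 32 * D + 64 <= INR N -> rho <= r / 16 ->
  NoDup (concat G) -> (forall t, In t (concat G) -> (t <= n)%nat) ->
  (forall s t, In s (concat G) -> In t (concat G) -> s <> t -> r <= Bdist (gam s) (gam t)) ->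
  (forall g, In g G -> (N <= length g)%nat /\ exists x, In x g /\ forall y, In y g -> Bdist (gam x) (gam y) <= D * r) ->
  INR (length (concat G)) * r / 16 <= capped (r / 16) - capped ((2 * D + 2) * r).
Proof.
  intros Hr HD HN Hrho Hnd Hle Hsep HG.
  assert (HDr : 0 <= D * r) by nra.
  rewrite !capped_eq by lra.
  assert (Elen : INR (length (concat G)) * r / 16 = lsum (fun g => INR (length g) * r / 16) G).
  { clear. induction G as [|g G IH]; [simpl; lra|]. rewrite lsum_cons. simpl concat. rewrite length_app, plus_INR, <- IH. field. }
  rewrite Elen. enough (content ((2 * D + 2) * r) + lsum (fun g => INR (length g) * r / 16) G <= content (r / 16)) by lra.
  apply content_gain; [assumption|assumption|lra|]. intros C HC.
  set (reg := fun (g : list nat) j => exists t, In t g /\ iball t (r / 4) j).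
  assert (InG : forall g t, In g G -> In t g -> In t (concat G)) by (intros g t Hg Ht; apply in_concat; eauto).
  assert (HE : forall E, In E C -> forall s t, In s (concat G) -> In t (concat G) -> s <> t ->
     ~ (meets (iball s (r / 4)) E /\ meets (iball t (r / 4)) E)).
  { intros E HE s t Hs Ht Hst [[i [M1 [M2 M3]]] [j [N1 [N2 N3]]]].
    destruct HC as [HC _]. destruct (HC E HE) as [Q1 Q2]. specialize (Q2 i j M1 N1 M2 N2).
    specialize (Hsep s t Hs Ht Hst). unfold iball in *.
    pose proof (Bdist_triangle (gam s) (gam i) (gam t)) as T1.
    pose proof (Bdist_triangle (gam i) (gam j) (gam t)) as T2.
    rewrite (Bdist_sym (gam s) (gam i)) in T1. lra. }
  (* A group g costs at least r / 4 per point, while |g| >= 32 D + 64 keeps the merged size (2 D +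
     2) r below |g| r / 16. *)
  apply (merge gam n rho reg (fun g => INR (length g) * r / 16) ((2 * D + 2) * r) (r / 16)); try assumption; try lra.
  - intros E HEC. apply (ForallOrdPairs_impl_in (fun g g' => forall x y, In x g -> In y g' -> x <> y)).
    + intros g g' Hg Hg' Hne [[i [M1 [M2 [s [Hs M3]]]]] [j [N1 [N2 [t [Ht N3]]]]]].
      apply (HE E HEC s t); [eauto|eauto|apply Hne; assumption|].
      split; [exists i|exists j]; auto.
    + apply NoDup_concat_disjoint; assumption.
  - intros g Hg. destruct (HG g Hg) as [Hlen _].
    set (C' := sel (meets (reg g)) C).
    assert (Hnd' : NoDup g) by (eapply NoDup_concat_in; eassumption).
    assert (HNR : INR N <= INR (length g)) by (apply le_INR; assumption).
    pose proof (disjoint_cost n (fun t => iball t (r / 4)) (fun _ => r / 4) C' g) as HDC.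
    assert (HS : separates n (fun t => iball t (r / 4)) C' g).
    { intros E HEC. apply In_sel in HEC. destruct HEC as [HEC _].
      apply (ForallOrdPairs_impl_in (fun x y => x <> y)); [|apply NoDup_ForallOrdPairs; assumption].
      intros s t Hs Ht Hst. apply (HE E HEC); eauto. }
    specialize (HDC HS).
    assert (Hpre : forall t, In t g -> r / 4 <= cost (sel (meets (iball t (r / 4))) C')).
    { intros t Ht. assert (Esel : sel (meets (iball t (r / 4))) C' = sel (meets (iball t (r / 4))) C).
      { unfold C'. rewrite sel_sel. apply sel_ext. intros E _. split; [tauto|]. intros HM. split; [assumption|].
        destruct HM as [i [M1 [M2 M3]]]. exists i. split; [assumption|]. split; [assumption|]. exists t; auto. }
      rewrite Esel.
      (* A second point of the group forces the walk to leave the small ball about [t]. *)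
      assert (exists t', In t' g /\ t' <> t) as [t' [Ht' Hne]].
      { destruct g as [|x [|y g']]; [destruct Ht| |].
        - simpl in HNR. lra.
        - destruct (Nat.eq_dec x t) as [->|Hxt]; [|exists x; simpl; auto].
          exists y. split; [simpl; auto|]. intros ->. inversion Hnd'; subst. simpl in *; tauto. }
      apply (ball_cost gam n rho gam_step (r / 16) C t t'); try assumption; [apply Hle; eauto|apply Hle; eauto|].
      pose proof (Hsep t' t ltac:(eauto) ltac:(eauto) Hne). lra. }
    specialize (HDC Hpre). rewrite lsum_const in HDC.
    assert (0 <= cost (sel (fun E => forall x, In x g -> ~ meets (iball x (r / 4)) E) C')).
    { apply (cost_nonneg gam n rho (r / 16)). intros E HEC. apply In_sel in HEC. destruct HEC as [HEC _].
      apply In_sel in HEC. destruct HC as [HC _]. apply HC. tauto. }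
    unfold C' in *. nra.
  - intros g E E' Hg HE1 HE2 [i' [M1 [M2 [s [Hs M3]]]]] [j' [N1 [N2 [t [Ht N3]]]]] i j Hi Hj Ei Ej.
    destruct HC as [HC _]. destruct (HC E HE1) as [Q1 Q2]. specialize (Q2 i i' Hi M1 Ei M2).
    destruct (HC E' HE2) as [Q3 Q4]. specialize (Q4 j' j N1 Hj N2 Ej).
    destruct (HG g Hg) as [_ [x [Hx Hnear]]]. pose proof (Hnear s Hs) as X1. pose proof (Hnear t Ht) as X2.
    unfold iball in *.
    pose proof (Bdist_triangle (gam i) (gam i') (gam j)) as T1.
    pose proof (Bdist_triangle (gam i') (gam s) (gam j)) as T2.
    pose proof (Bdist_triangle (gam s) (gam x) (gam j)) as T3.
    pose proof (Bdist_triangle (gam x) (gam t) (gam j)) as T4.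
    pose proof (Bdist_triangle (gam t) (gam j') (gam j)) as T5.
    rewrite (Bdist_sym (gam s) (gam x)) in T3. rewrite (Bdist_sym (gam t) (gam j')) in T5. lra.
Qed.

(** Thinning to points more than 3 R0 apart costs the factor [N] and ensures that no small set meets
    two of the balls. As b > B / 2, each merge saves at least 1/90 - 1/256 - 1/100000 > 1/150 of B
    R0. *)
Lemma thick_gain (l : list nat) (R0 B D r : R) (N : nat) (b : nat -> R) :
  0 < R0 -> 0 < B <= 2 -> 3 * R0 <= D * r ->
  (forall t, In t l -> (t <= n)%nat /\ B / 2 < b t <= B /\ rho <= b t * R0 / 100000 /\ thick R0 (b t) t) ->
  sparse (fun s t => Bdist (gam s) (gam t) <= D * r) N l ->
  INR (length l) * (B * R0 / 150) <= INR N * (capped (B * R0 / 512) - capped (3 * R0)).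
Proof.
  intros HR HB HDr Hl Hsp.
  assert (HBR : 0 < B * R0) by nra. assert (HBR2 : B * R0 <= 2 * R0) by nra.
  destruct l as [|t0 l0] eqn:El.
  { simpl. rewrite Rmult_0_l. apply Rmult_le_pos; [apply pos_INR|].
    pose proof (capped_anti (B * R0 / 512) (3 * R0)). lra. }
  rewrite <- El in *.
  assert (Hrho : rho <= B * R0 / 100000).
  { destruct (Hl t0) as [_ [H1 [H2 _]]]; [rewrite El; simpl; auto|]. nra. }
  rewrite !capped_eq by lra.
  destruct (sparse_thin (fun s t => Bdist (gam s) (gam t) <= D * r)
    ltac:(intros; cbv beta; rewrite Bdist_refl; lra) N l Hsp) as [Y [Y1 [Y2 Y3]]].
  assert (HY : INR (length l) <= INR N * INR (length Y)) by (rewrite <- mult_INR; apply le_INR; assumption).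
  assert (Hgain : content (3 * R0) + INR (length Y) * (B * R0 / 150) <= content (B * R0 / 512)).
  { rewrite <- lsum_const. apply content_gain; [assumption|lra|lra|]. intros C HC.
    apply (merge gam n rho (fun t => iball t R0) (fun _ => B * R0 / 150) (2 * R0 + B * R0 / 256 + rho) (B * R0 / 512)); try assumption; try lra.
    - intros E HE. revert Y2. apply ForallOrdPairs_impl_in. intros s t Hs Ht Hst [[i [M1 [M2 M3]]] [j [N1 [N2 N3]]]].
      apply Hst. destruct HC as [HC _]. destruct (HC E HE) as [Q1 Q2]. specialize (Q2 i j M1 N1 M2 N2).
      unfold iball in *.
      pose proof (Bdist_triangle (gam s) (gam i) (gam t)) as T1.
      pose proof (Bdist_triangle (gam i) (gam j) (gam t)) as T2.
      rewrite (Bdist_sym (gam s) (gam i)) in T1. lra.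
    - intros t Ht. destruct (Hl t (Y1 t Ht)) as [H1 [H2 [H3 H4]]].
      specialize (H4 (B * R0 / 512) C HC).
      assert (B * R0 / 2 < b t * R0) by nra.
      assert (2 * R0 + b t * R0 / 45 <= cost (sel (meets (iball t R0)) C)) by (apply H4; lra). lra.
    - intros t E E' Ht HE HE' [i' [M1 [M2 M3]]] [j' [N1 [N2 N3]]] i j Hi Hj Ei Ej.
      destruct HC as [HC _]. destruct (HC E HE) as [Q1 Q2]. specialize (Q2 i i' Hi M1 Ei M2).
      destruct (HC E' HE') as [Q3 Q4]. specialize (Q4 j' j N1 Hj N2 Ej). unfold iball in *.
      pose proof (Bdist_triangle (gam i) (gam i') (gam j)) as T1.
      pose proof (Bdist_triangle (gam i') (gam t) (gam j)) as T2.
      pose proof (Bdist_triangle (gam t) (gam j') (gam j)) as T3.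
      rewrite (Bdist_sym (gam t) (gam j')) in T3. lra. }
  assert (INR (length l) * (B * R0 / 150) <= INR N * INR (length Y) * (B * R0 / 150)) by (apply Rmult_le_compat_r; lra).
  pose proof (pos_INR N). nra.
Qed.
End Savings.

(** * Summation over all scales of a walk *)

Definition indic (P : Prop) (x : R) : R := if excluded_middle_informative P then x else 0.

Lemma indic_true (P : Prop) x : P -> indic P x = x.
Proof. intros H. unfold indic. destruct (excluded_middle_informative P); [reflexivity|contradiction]. Qed.

Lemma indic_nonneg (P : Prop) x : 0 <= x -> 0 <= indic P x.
Proof. intros H. unfold indic. destruct (excluded_middle_informative P); lra. Qed.

Lemma lsum_indic {T} (P : T -> Prop) f (l : list T) : lsum (fun x => indic (P x) (f x)) l = lsum f (sel P l).
Proof. apply lsum_sel_indicator. Qed.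

Lemma lsum_psum {T} (g : nat -> T -> R) m (l : list T) :
  lsum (fun x => psum (fun j => g j x) m) l = psum (fun j => lsum (g j) l) m.
Proof.
  induction m as [|m IH]; simpl.
  - rewrite lsum_const. ring.
  - rewrite lsum_add, IH. reflexivity.
Qed.

Lemma psum_psum (g : nat -> nat -> R) m k :
  psum (fun i => psum (fun j => g i j) k) m = psum (fun j => psum (fun i => g i j) m) k.
Proof.
  induction m as [|m IH]; simpl.
  - induction k as [|k IHk]; simpl; [reflexivity|rewrite <- IHk; ring].
  - rewrite IH, <- psum_add. reflexivity.
Qed.

Lemma psum_term_le (f : nat -> R) j m : (forall i, 0 <= f i) -> (j < m)%nat -> f j <= psum f m.
Proof. intros Hf Hj. pose proof (psum_term f 0 j m Hf ltac:(lia)). simpl in H. lra. Qed.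

Lemma psum_div5 (g : nat -> R) m : psum (fun i => g (i / 5)%nat) (5 * m) = 5 * psum g m.
Proof.
  induction m as [|m IH]; [simpl; ring|].
  replace (5 * S m)%nat with (S (S (S (S (S (5 * m)))))) by lia. cbn [psum].
  rewrite IH.
  assert (E : forall k, (k < 5)%nat -> ((5 * m + k) / 5 = m)%nat).
  { intros k Hk. rewrite Nat.mul_comm, Nat.div_add_l, (Nat.div_small k 5) by lia. lia. }
  replace (S (S (S (S (5 * m))))) with (5 * m + 4)%nat by lia.
  replace (S (S (S (5 * m)))) with (5 * m + 3)%nat by lia.
  replace (S (S (5 * m))) with (5 * m + 2)%nat by lia.
  replace (S (5 * m)) with (5 * m + 1)%nat by lia.
  pose proof (E 0%nat ltac:(lia)) as E0. rewrite Nat.add_0_r in E0. rewrite E0, !E by lia. ring.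
Qed.

Lemma psum_succ (f : nat -> R) m : psum (fun i => f (S i)) m = psum f (S m) - f 0%nat.
Proof. induction m as [|m IH]; simpl in *; [ring|rewrite IH; ring]. Qed.

(* The scales below and above [ell] each contribute a geometric series. *)
Lemma psum_min_geometric (r0 ell : R) m : 0 < r0 -> 0 < ell ->
  psum (fun i => Rmin (r0 * 2 ^ i) (ell * ell / (r0 * 2 ^ i))) m <= 4 * ell.
Proof.
  intros Hr Hl.
  assert (H : (r0 * 2 ^ m <= ell -> psum (fun i => Rmin (r0 * 2 ^ i) (ell * ell / (r0 * 2 ^ i))) m <= r0 * 2 ^ m) /\
    (ell < r0 * 2 ^ m -> psum (fun i => Rmin (r0 * 2 ^ i) (ell * ell / (r0 * 2 ^ i))) m
                          <= 4 * ell - 2 * (ell * ell / (r0 * 2 ^ m)) \/ m = 0%nat)).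
  { induction m as [|m [IH1 IH2]].
    - simpl. split; [intros; lra|auto].
    - simpl psum. set (x := r0 * 2 ^ m) in *.
      assert (Ex : r0 * 2 ^ S m = 2 * x) by (unfold x; simpl; ring). rewrite Ex.
      assert (Hx : 0 < x) by (unfold x; apply Rmult_lt_0_compat; [assumption|apply pow_lt; lra]).
      pose proof (Rmin_l x (ell * ell / x)) as M1. pose proof (Rmin_r x (ell * ell / x)) as M2.
      assert (Q : ell * ell / (2 * x) = ell * ell / x / 2) by (field; lra). rewrite Q.
      set (y := ell * ell / x) in *. assert (Hy : y * x = ell * ell) by (unfold y; field; lra).
      split; intros H.
      + specialize (IH1 ltac:(lra)). lra.
      + left. destruct (Rle_lt_dec x ell) as [L|L].
        * specialize (IH1 L). assert (y <= 4 * ell - 2 * x); [|lra].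
          apply Rmult_le_reg_r with x; [assumption|]. rewrite Hy. nra.
        * destruct (IH2 L) as [IH|E]; [lra|]. subst m. simpl in *.
          assert (y <= ell); [|lra]. apply Rmult_le_reg_r with x; [assumption|]. rewrite Hy. nra. }
  destruct H as [H1 H2]. destruct (Rle_lt_dec (r0 * 2 ^ m) ell) as [L|L].
  - specialize (H1 L). lra.
  - destruct (H2 L) as [H|E]; [|subst; simpl; lra].
    assert (0 <= ell * ell / (r0 * 2 ^ m)); [|lra].
    apply Rmult_le_pos; [nra|]. left. apply Rinv_0_lt_compat. apply Rmult_lt_0_compat; [assumption|apply pow_lt; lra].
Qed.

(** The weight of the class j against its j + 10 intermediate scales; the full series is 4 + 40. *)
Lemma psum_arith_geometric m : psum (fun j => 2 / 2 ^ j * INR (j + 10)) m <= 44.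
Proof.
  assert (H : psum (fun j => 2 / 2 ^ j * INR (j + 10)) m = 44 - (INR m + 11) * (4 / 2 ^ m)).
  { induction m as [|m IH]; [simpl; field|]. simpl psum. rewrite IH, S_INR, plus_INR.
    replace (INR 10) with 10 by (simpl; ring). simpl pow.
    assert (0 < 2 ^ m) by (apply pow_lt; lra). field. lra. }
  rewrite H. pose proof (pos_INR m).
  assert (0 < 4 / 2 ^ m) by (apply Rdiv_lt_0_compat; [lra|apply pow_lt; lra]). nra.
Qed.

Lemma dyadic_class x k : 2 / 2 ^ k < x <= 2 -> exists j, (j < k)%nat /\ 2 / 2 ^ j / 2 < x <= 2 / 2 ^ j.
Proof.
  induction k as [|k IH]; intros H; [simpl in H; lra|].
  destruct (Rle_lt_dec x (2 / 2 ^ k)) as [L|L].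
  - exists k. split; [lia|]. split; [|assumption].
    replace (2 / 2 ^ k / 2) with (2 / 2 ^ S k); [lra|]. simpl. assert (0 < 2 ^ k) by (apply pow_lt; lra). field. lra.
  - destruct IH as [j [Hj Hx]]; [lra|]. exists j. split; [lia|assumption].
Qed.

Lemma sparse_count {T} (near : T -> T -> Prop) N l (P : T -> Prop) : sparse near N l ->
  (forall s t, In s l -> In t l -> P s -> P t -> near s t) -> (length (sel P l) <= N)%nat.
Proof.
  intros Hs HP. destruct (classic (exists s, In s l /\ P s)) as [[s [H1 H2]]|H].
  - specialize (Hs s H1). enough (length (sel P l) <= length (sel (near s) l))%nat by lia.
    apply length_sel_le. intros t Ht HPt. apply HP; assumption.
  - destruct (sel P l) as [|s l'] eqn:E; [simpl; lia|]. exfalso. apply H. exists s.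
    apply In_sel. rewrite E. simpl; auto.
Qed.

Record hierarchy {X : Banach} (gam : nat -> X) (n : nat) (V : nat -> nat -> Prop) (sc : nat -> R) : Prop := {
  h_top : forall l, V l n;
  h_le : forall l i, V l i -> (i <= n)%nat;
  h_all : forall i, (i <= n)%nat -> V 0%nat i;
  h_nested : forall l i, V (S l) i -> V l i;
  h_size : forall l u i, V l u -> (u < n)%nat -> (u <= i <= nextv n (V l) u)%nat ->
    Bdist (gam i) (gam u) <= 4 * sc l }.

(** * Contributions of all balls to a single walk *)

Section Discrete.
Context {X : Banach}.
Variables (gam : nat -> X) (n : nat) (rho c p A r0 : R).
Variables (I : nat) (L : nat -> list nat) (b : nat -> nat -> R) (bmin : R) (N J0 : nat).
Hypothesis p_ge2 : 2 <= p.
Hypothesis c_pos : 0 < c.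
Hypothesis X_convex : power_convex X c p.
Hypothesis A_gt1 : 1 < A.
Hypothesis rho_pos : 0 < rho.
Hypothesis r0_rho : 16 * rho <= r0.
Hypothesis gam_step : forall i, (i < n)%nat -> Bdist (gam (S i)) (gam i) <= rho.

Definition rad (i : nat) : R := r0 * 2 ^ i.
(** Exceeds 4096 A: two points of one arc are within 8 scales of each other, and the scale of the
    level used is at most 128 times 4 A [rad i]. *)
Definition near_factor : R := 10240 * A.

Hypothesis N_large : 32 * near_factor + 64 <= INR N.
Hypothesis J0_large : 16 * (2 * near_factor + 2) <= 2 ^ J0.
Hypothesis L_nodup : forall i, (i < I)%nat -> NoDup (L i).
Hypothesis L_lt : forall i t, (i < I)%nat -> In t (L i) -> (t < n)%nat.
Hypothesis L_sep : forall i s t, (i < I)%nat -> In s (L i) -> In t (L i) -> s <> t ->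
  rad i <= Bdist (gam s) (gam t).
Hypothesis b_nonneg : forall i t, (i < I)%nat -> In t (L i) -> 0 <= b i t.
(** The beta numbers enter only through this lower bound. The radius is doubled to leave room for
    replacing points of the set by net points. *)
Hypothesis b_line : forall i t, (i < I)%nat -> In t (L i) -> forall a w : X, w <> Bzero ->
  exists z, (z <= n)%nat /\ Bdist (gam z) (gam t) <= 2 * A * rad i /\
    forall s, b i t * A * rad i <= Bdist (gam z) (Badd a (Bscal s w)).
Hypothesis b_large : forall i t, (i < I)%nat -> In t (L i) -> 0 < b i t ->
  bmin <= b i t /\ 100000 * rho <= b i t * r0.
Hypothesis bmin_pos : 0 < bmin.

(** [R0 i] is twice the radius in [b_line], so the far point lies in the half ball and its distance
    b A [rad i] reads b R0 / 4. One level serves five radii, as 2^5 = 32; the factor 16 in [s0]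
    makes its scale at least 8 [R0 i], as [exits_some] requires. *)
Notation R0 i := (4 * A * rad i).
Notation s0 := (16 * A * r0).
Notation lv i := (S (i / 5)).
Notation sc := (scale (16 * A * r0)).
Notation Vg := (greedy gam n (16 * A * r0)).
Notation Vm := (greedy_mid gam n (16 * A * r0)).
Notation term i t := (rpow (b i t) p * rad i).
Notation cc := (capped gam n rho).
Let ell : R := INR (S n) * rho.

Lemma r0_pos : 0 < r0.
Proof. lra. Qed.

Lemma s0_pos' : 0 < s0.
Proof. pose proof r0_pos. nra. Qed.

Lemma rad_pos i : 0 < rad i.
Proof. unfold rad. apply Rmult_lt_0_compat; [apply r0_pos|apply pow_lt; lra]. Qed.

Lemma Arad_pos i : 0 < A * rad i.
Proof. apply Rmult_lt_0_compat; [lra|apply rad_pos]. Qed.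

Lemma rad_ge i : r0 <= rad i.
Proof.
  unfold rad. pose proof r0_pos. assert (1 <= 2 ^ i) by (apply pow_R1_Rle; lra). nra.
Qed.

Lemma ell_pos : 0 < ell.
Proof. unfold ell. apply Rmult_lt_0_compat; [apply lt_0_INR; lia|assumption]. Qed.

Lemma step_s0 i : (i < n)%nat -> Bdist (gam (S i)) (gam i) <= s0.
Proof. intros Hi. specialize (gam_step i Hi). pose proof r0_pos. nra. Qed.

Lemma walk_dist s t : (s <= n)%nat -> (t <= n)%nat -> Bdist (gam s) (gam t) <= ell.
Proof.
  assert (H : forall k s, (s + k <= n)%nat -> Bdist (gam (s + k)%nat) (gam s) <= INR k * rho).
  { induction k as [|k IH]; intros s' Hs'; [rewrite Nat.add_0_r, Bdist_refl; simpl; lra|].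
    rewrite S_INR, Nat.add_succ_r. specialize (IH s' ltac:(lia)).
    pose proof (gam_step (s' + k) ltac:(lia)).
    pose proof (Bdist_triangle (gam (S (s' + k))) (gam (s' + k)%nat) (gam s')). lra. }
  assert (H' : forall k, (k <= n)%nat -> INR k * rho <= ell).
  { intros k Hk. unfold ell. apply Rmult_le_compat_r; [lra|]. apply le_INR; lia. }
  intros Hs Ht. destruct (Nat.le_ge_cases s t) as [Hst|Hst].
  - specialize (H (t - s)%nat s ltac:(lia)). replace (s + (t - s))%nat with t in H by lia.
    rewrite Bdist_sym. specialize (H' (t - s)%nat ltac:(lia)). lra.
  - specialize (H (s - t)%nat t ltac:(lia)). replace (t + (s - t))%nat with s in H by lia.
    specialize (H' (s - t)%nat ltac:(lia)). lra.
Qed.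

Lemma greedy_hierarchy : hierarchy gam n Vg sc.
Proof.
  split.
  - apply greedy_n.
  - apply greedy_le.
  - intros i Hi. exact Hi.
  - apply greedy_nested.
  - intros l u i Hu Hun Hi.
    pose proof (greedy_arc_size gam n s0 s0_pos' step_s0 l u i Hu Hun Hi).
    pose proof (scale_pos s0 s0_pos' l). lra.
Qed.

Lemma greedy_mid_hierarchy : hierarchy gam n Vm sc.
Proof.
  split.
  - apply greedy_mid_n.
  - apply (greedy_mid_le gam n s0 s0_pos' step_s0).
  - apply greedy_mid_all.
  - apply (greedy_mid_nested gam n s0 s0_pos' step_s0).
  - apply (greedy_mid_arc_size gam n s0 s0_pos' step_s0).
Qed.

Lemma scale_range i : 8 * R0 i <= sc (lv i) <= 128 * R0 i.
Proof.
  unfold scale, rad. pose proof r0_pos.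
  assert (E : 2 ^ i = 32 ^ (i / 5) * 2 ^ (i mod 5)).
  { rewrite (Nat.div_mod_eq i 5) at 1. rewrite pow_add, pow_mult. f_equal. f_equal. ring. }
  rewrite E.
  set (x := 32 ^ (i / 5)). assert (Hx : 0 < x) by (apply pow_lt; lra).
  assert (Hm : 1 <= 2 ^ (i mod 5) <= 16).
  { pose proof (Nat.mod_upper_bound i 5 ltac:(lia)).
    destruct (i mod 5)%nat as [|[|[|[|[|k]]]]]; simpl; try lra. lia. }
  set (y := 2 ^ (i mod 5)) in *.
  change (32 ^ S (i / 5)) with (32 * x).
  assert (0 < A * r0 * x) by (apply Rmult_lt_0_compat; [nra|assumption]).
  set (z := A * r0 * x) in *.
  assert (Z1 : z * 1 <= z * y) by (apply Rmult_le_compat_l; lra).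
  assert (Z2 : z * y <= z * 16) by (apply Rmult_le_compat_l; lra).
  replace (8 * (4 * A * (r0 * (x * y)))) with (32 * (z * y)) by (unfold z; ring).
  replace (128 * (4 * A * (r0 * (x * y)))) with (512 * (z * y)) by (unfold z; ring).
  replace (32 * x * (16 * A * r0)) with (512 * z) by (unfold z; ring).
  lra.
Qed.

(** Tested with a line through the centre: the far point is within 2 A [rad i] of the centre, and
    within the walk length [ell]. *)
Lemma b_le2 i t : (i < I)%nat -> In t (L i) -> b i t <= 2 /\ b i t <= ell / rad i.
Proof.
  intros Hi Ht. destruct (Bdim2 X) as [u [v Huv]].
  assert (Hu : u <> Bzero).
  { intros E. destruct (Huv 1 0) as [H _]; [|lra]. rewrite E. vlin. }
  destruct (b_line i t Hi Ht (gam t) u Hu) as [z [H1 [H2 H3]]].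
  specialize (H3 0). replace (Badd (gam t) (Bscal 0 u)) with (gam t) in H3 by vlin.
  pose proof (rad_pos i) as Hr. pose proof (b_nonneg i t Hi Ht).
  pose proof (walk_dist z t H1 ltac:(specialize (L_lt i t Hi Ht); lia)).
  pose proof (Arad_pos i). split.
  - apply Rmult_le_reg_r with (A * rad i); nra.
  - apply Rmult_le_reg_r with (rad i); [assumption|]. unfold Rdiv. rewrite Rmult_assoc, Rinv_l by lra.
    assert (b i t * rad i <= b i t * A * rad i); [|lra]. apply Rmult_le_compat_r; nra.
Qed.

(** Since b / 2 <= 1 and p >= 2, b^p is at most 2^p (b / 2)^2; with b <= ell / rad this gives the
    decay at large radii that pays for the arcs at the ends of the walk. *)
Lemma term_le i t : (i < I)%nat -> In t (L i) ->
  term i t <= rpow 2 p * rad i /\ term i t <= rpow 2 p * Rmin (rad i) (ell * ell / rad i).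
Proof.
  intros Hi Ht. destruct (b_le2 i t Hi Ht) as [B1 B2]. pose proof (b_nonneg i t Hi Ht) as B0.
  pose proof (rad_pos i) as Hr. pose proof (rpow_pos 2 p ltac:(lra)) as H2.
  assert (E : rpow (b i t) p = rpow 2 p * rpow (b i t / 2) p).
  { rewrite <- rpow_mult by lra. f_equal. field. }
  assert (Hsq : rpow (b i t / 2) p <= b i t / 2 * (b i t / 2)) by (apply rpow_le_sq; lra).
  pose proof (rpow_nonneg (b i t / 2) p) as Hn.
  assert (K : rpow (b i t / 2) p * rad i <= Rmin (rad i) (ell * ell / rad i)).
  { assert (b i t / 2 * (b i t / 2) <= 1) by nra.
    apply Rmin_glb; [assert (rpow (b i t / 2) p * rad i <= 1 * rad i) by (apply Rmult_le_compat_r; lra); lra|].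
    apply Rle_trans with (b i t * b i t * rad i); [apply Rmult_le_compat_r; nra|].
    assert (b i t * rad i <= ell) by (apply Rmult_le_reg_r with (/ rad i); [apply Rinv_0_lt_compat; assumption|]; rewrite Rmult_assoc, Rinv_r by lra; unfold Rdiv in B2; lra).
    apply Rmult_le_reg_r with (rad i); [assumption|]. unfold Rdiv. rewrite (Rmult_assoc (ell * ell)), Rinv_l by lra.
    assert (0 <= b i t * rad i) by nra. nra. }
  pose proof (Rmin_l (rad i) (ell * ell / rad i)).
  rewrite E, Rmult_assoc. split; apply Rmult_le_compat_l; lra.
Qed.

(** 128000 = 1000 * 128: an arc fails to be flat when its deviation exceeds b R0 / 1000, and its
    scale is at most 128 R0. *)
Definition arc_const : R := rpow (128000 * flat_const c p) p.

Lemma arc_const_nonneg : 0 <= arc_const.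
Proof. apply rpow_nonneg. Qed.

(** The deviation [eta] is compared with b R0 / 1000. If it is larger, the p-th power of the bound
    in [arc_flat] controls b^p by W / s, and s is at least [rad i]. *)
Lemma exits_cases V i t : hierarchy gam n V sc -> (i < I)%nat -> In t (L i) -> 0 < b i t ->
  exits gam n (V (lv i)) (R0 i) t ->
  term i t <= arc_const * wexcess gam n V (lv i) (floorv (V (lv i)) t) \/ thick gam n rho (R0 i) (b i t) t.
Proof.
  intros [H1 H2 H3 H4 H5] Hi Ht Hb [HV [x [y [Hx [Hy [Dx Dy]]]]]].
  pose proof (rad_pos i) as Hr. pose proof (scale_range i) as Hsc.
  pose proof (scale_pos s0 s0_pos') as Hsp.
  pose proof (L_lt i t Hi Ht) as Htn.
  destruct (arc_param gam n V sc c p p_ge2 c_pos X_convex H1 H2 H3 H4 Hsp (scale_S s0) H5 (lv i) t Htn HV)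
    as [psi [Hflat Hmono]].
  pose proof (floorv_next n (V (lv i)) (H1 _) (H2 _) t Htn HV) as HF.
  destruct (nextv_spec n (V (lv i)) (H1 _) (H2 _) (floorv (V (lv i)) t) ltac:(lia)) as [_ [HN _]].
  set (u := floorv (V (lv i)) t) in *. set (v := nextv n (V (lv i)) u) in *.
  set (W := wexcess gam n V (lv i) u) in *.
  assert (HW : 0 <= W) by (apply wexcess_nonneg; assumption).
  set (s := sc (lv i)) in *. assert (Hs : 0 < s) by apply Hsp.
  set (eta := flat_const c p * s * root p (W / s)) in *.
  assert (HR0 : 0 < R0 i) by nra.
  destruct (b_le2 i t Hi Ht) as [B1 _].
  destruct (Rle_lt_dec eta (b i t * R0 i / 1000)) as [Hc|Hc].
  - right. apply (thick_of_flat gam n rho rho_pos gam_step t u v psi eta (R0 i) (b i t)); try assumption; try lia; try lra.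
    + destruct (b_large i t Hi Ht Hb) as [_ HL]. pose proof (rad_ge i). pose proof r0_pos.
      assert (b i t * r0 <= b i t * R0 i) by (apply Rmult_le_compat_l; nra). lra.
    + exists x. split; assumption.
    + exists y. split; assumption.
    + intros a w Hw. destruct (b_line i t Hi Ht a w Hw) as [z [Z1 [Z2 Z3]]]. exists z.
      split; [assumption|]. split; [lra|]. intros q. specialize (Z3 q). lra.
  - left. unfold eta in Hc.
    assert (Hws : 0 <= W / s) by (apply Rmult_le_pos; [assumption|left; apply Rinv_0_lt_compat; assumption]).
    pose proof (root_nonneg p (W / s)) as Hrt. pose proof (flat_const_pos c p) as HK.
    assert (Hb1 : b i t <= 128000 * flat_const c p * root p (W / s)).
    { apply Rmult_le_reg_r with (R0 i); [assumption|].
      assert (flat_const c p * s * root p (W / s) <= flat_const c p * (128 * R0 i) * root p (W / s)).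
      { apply Rmult_le_compat_r; [assumption|]. apply Rmult_le_compat_l; lra. }
      lra. }
    assert (Hb2 : rpow (b i t) p <= arc_const * (W / s)).
    { unfold arc_const. rewrite <- (rpow_root p p_ge2 (W / s)) by assumption. rewrite <- rpow_mult by lra.
      apply rpow_le; lra. }
    pose proof arc_const_nonneg as HA.
    apply Rle_trans with (arc_const * (W / s) * rad i); [apply Rmult_le_compat_r; lra|].
    rewrite Rmult_assoc. apply Rmult_le_compat_l; [assumption|].
    apply Rmult_le_reg_r with s; [assumption|].
    replace (W / s * rad i * s) with (W * rad i) by (field; lra).
    apply Rmult_le_compat_l; [assumption|]. nra.
Qed.

Lemma item_cases i t : (i < I)%nat -> In t (L i) -> 0 < b i t ->
  let u := floorv (Vg (lv i)) t in
  u = 0%nat \/ nextv n (Vg (lv i)) u = n \/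
  ((nextv n (Vg (lv i)) u < n)%nat /\ nextv n (Vg (lv i)) (nextv n (Vg (lv i)) u) = n) \/
  term i t <= arc_const * wexcess gam n Vg (lv i) u \/
  (Vm (lv i) (floorv (Vm (lv i)) t) /\
   term i t <= arc_const * wexcess gam n Vm (lv i) (floorv (Vm (lv i)) t)) \/
  thick gam n rho (R0 i) (b i t) t.
Proof.
  intros Hi Ht Hb u.
  pose proof (scale_range i) as Hsc. pose proof (L_lt i t Hi Ht) as Htn.
  destruct (floorv_spec (Vg (lv i)) t 0 (greedy_0 _ _ _ _)) as [Vu _]; [lia|]. fold u in Vu.
  pose proof (floorv_le (Vg (lv i)) t) as Hut. fold u in Hut.
  destruct (nextv_spec n (Vg (lv i)) (greedy_n _ _ _ _) (greedy_le _ _ _ _) u ltac:(lia)) as [_ [Hv _]].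
  destruct (exits_some gam n s0 s0_pos' step_s0 (i / 5) t (R0 i) Htn ltac:(lra)) as [H|[H|[H|[H|H]]]].
  - left; exact H.
  - right; left; exact H.
  (* Recording that the next vertex is below [n] makes [next_inj] applicable twice when these items
     are counted. *)
  - destruct (Nat.eq_dec (nextv n (Vg (lv i)) u) n) as [E|E]; [right; left; exact E|].
    right; right; left. split; [lia|exact H].
  - destruct (exits_cases Vg i t greedy_hierarchy Hi Ht Hb H) as [H'|H']; [right; right; right; left; exact H'|].
    right; right; right; right; right; exact H'.
  - destruct (exits_cases Vm i t greedy_mid_hierarchy Hi Ht Hb H) as [H'|H'].
    + right; right; right; right; left. split; [apply H|exact H'].
    + right; right; right; right; right; exact H'.
Qed.

Notation near i := (fun s t => Bdist (gam s) (gam t) <= near_factor * rad i).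

Lemma arc_near V i s t : hierarchy gam n V sc -> (s < n)%nat -> (t < n)%nat ->
  V (lv i) (floorv (V (lv i)) s) -> floorv (V (lv i)) t = floorv (V (lv i)) s ->
  Bdist (gam s) (gam t) <= near_factor * rad i.
Proof.
  intros [H1 H2 H3 H4 H5] Hs Ht HV E. pose proof (scale_range i) as Hsc.
  pose proof (floorv_next n (V (lv i)) (H1 _) (H2 _) s Hs HV) as F1.
  pose proof (floorv_next n (V (lv i)) (H1 _) (H2 _) t Ht ltac:(rewrite E; exact HV)) as F2. rewrite E in F2.
  pose proof (H5 (lv i) _ s HV ltac:(lia) ltac:(lia)) as S1.
  pose proof (H5 (lv i) _ t HV ltac:(lia) ltac:(lia)) as S2.
  pose proof (Bdist_triangle (gam s) (gam (floorv (V (lv i)) s)) (gam t)) as T.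
  rewrite (Bdist_sym (gam (floorv (V (lv i)) s)) (gam t)) in T. unfold near_factor. pose proof (rad_pos i).
  pose proof (Arad_pos i). lra.
Qed.

Lemma next_inj V (H1 : V n) (H2 : forall j, V j -> (j <= n)%nat) u u' : V u -> V u' ->
  (u < n)%nat -> (u' < n)%nat -> nextv n V u = nextv n V u' -> u = u'.
Proof.
  intros Vu Vu' Hu Hu' E.
  destruct (nextv_spec n V H1 H2 u Hu) as [_ [A1 A2]].
  destruct (nextv_spec n V H1 H2 u' Hu') as [_ [B1 B2]].
  destruct (lt_eq_lt_dec u u') as [[Hlt|Heq]|Hlt]; [|assumption|].
  - specialize (A2 u' Hlt Vu'). lia.
  - specialize (B2 u Hlt Vu). lia.
Qed.

Definition klass (i j t : nat) : Prop :=
  thick gam n rho (R0 i) (b i t) t /\ 2 / 2 ^ j / 2 < b i t <= 2 / 2 ^ j.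

(** The 150 of [thick_gain] against [R0 i >= 4 rad i] gives 75/2, the square (B / 2)^2 another 1/4,
    and 75/8 <= 10. *)
Definition thick_const : R := 10 * INR N * rpow 2 p.

(** Of the two factors B in B^p <= 2^p B^2 / 4 one becomes a difference of contents through
    [thick_gain]; the other remains and makes the sum over the classes converge. *)
Lemma klass_sum i j l2 : (i < I)%nat -> incl l2 (L i) -> sparse (near i) N l2 ->
  lsum (fun t => term i t) (sel (klass i j) l2) <=
  thick_const * (2 / 2 ^ j) * (cc (2 / 2 ^ j * R0 i / 512) - cc (3 * R0 i)).
Proof.
  intros Hi Hincl Hsp. pose proof (rad_pos i) as Hr.
  set (B := 2 / 2 ^ j).
  assert (H2j : 1 <= 2 ^ j) by (apply pow_R1_Rle; lra).
  assert (HB : 0 < B <= 2).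
  { unfold B. split; [apply Rdiv_lt_0_compat; lra|]. apply Rmult_le_reg_r with (2 ^ j); [lra|].
    unfold Rdiv. rewrite Rmult_assoc, Rinv_l by lra. lra. }
  set (q := sel (klass i j) l2).
  assert (Hq : forall t, In t q -> In t (L i) /\ klass i j t).
  { intros t Ht. apply In_sel in Ht. split; [apply Hincl|]; tauto. }
  assert (HR0 : 0 < R0 i) by nra.
  assert (HG : INR (length q) * (B * R0 i / 150) <= INR N * (cc (B * R0 i / 512) - cc (3 * R0 i))).
  { apply (thick_gain gam n rho rho_pos q (R0 i) B near_factor (rad i) N (b i)); try assumption.
    - unfold near_factor. pose proof (Arad_pos i). lra.
    - intros t Ht. destruct (Hq t Ht) as [H1 [H3 H4]]. specialize (L_lt i t Hi H1).
      split; [lia|]. split; [exact H4|]. split; [|exact H3].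
      destruct (b_large i t Hi H1) as [_ HL]; [unfold B in HB; lra|]. pose proof (rad_ge i). pose proof r0_pos.
      assert (b i t * r0 <= b i t * R0 i) by (apply Rmult_le_compat_l; [unfold B in HB; lra|nra]). lra.
    - apply sparse_sub; assumption. }
  pose proof (rpow_pos 2 p ltac:(lra)) as H2.
  assert (HBp : rpow B p <= rpow 2 p * (B * B / 4)).
  { replace B with (2 * (B / 2)) at 1 by field. rewrite rpow_mult by lra. apply Rmult_le_compat_l; [lra|].
    replace (B * B / 4) with (B / 2 * (B / 2)) by field. apply rpow_le_sq; lra. }
  assert (HS : lsum (fun t => term i t) q <= INR (length q) * (rpow B p * rad i)).
  { rewrite <- lsum_const. apply lsum_le. intros t Ht. destruct (Hq t Ht) as [H1 [_ H4]].
    apply Rmult_le_compat_r; [lra|]. apply rpow_le; [lra|]. split; [apply b_nonneg; assumption|exact (proj2 H4)]. }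
  pose proof (pos_INR (length q)) as Hlen. set (m := INR (length q)) in *.
  set (Dl := cc (B * R0 i / 512) - cc (3 * R0 i)) in *.
  assert (K1 : m * B * rad i <= 75 / 2 * (INR N * Dl)).
  { assert (m * B * rad i <= m * B * (A * rad i)) by (apply Rmult_le_compat_l; nra). nra. }
  eapply Rle_trans; [exact HS|].
  apply Rle_trans with (m * (rpow 2 p * (B * B / 4) * rad i)).
  { apply Rmult_le_compat_l; [assumption|]. apply Rmult_le_compat_r; lra. }
  unfold thick_const.
  replace (m * (rpow 2 p * (B * B / 4) * rad i)) with (rpow 2 p * B * (m * B * rad i) / 4) by field.
  assert (0 < rpow 2 p * B) by nra.
  assert (0 <= m * B * rad i) by (apply Rmult_le_pos; nra).
  assert (0 <= INR N * Dl) by lra.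
  replace (10 * INR N * rpow 2 p * B * Dl) with (rpow 2 p * B * (10 * (INR N * Dl))) by ring.
  nra.
Qed.

Notation tot V l := (psum (wexcess gam n V l) n).

Lemma fiber_bound V i l2 : hierarchy gam n V sc -> (i < I)%nat -> incl l2 (L i) -> sparse (near i) N l2 ->
  lsum (fun t => arc_const * wexcess gam n V (lv i) (floorv (V (lv i)) t))
    (sel (fun t => V (lv i) (floorv (V (lv i)) t)) l2) <= INR N * arc_const * tot V (lv i).
Proof.
  intros HV Hi Hincl Hsp. rewrite lsum_scal. pose proof arc_const_nonneg.
  replace (INR N * arc_const * tot V (lv i)) with (arc_const * (INR N * tot V (lv i))) by ring.
  apply Rmult_le_compat_l; [assumption|].
  apply (fiber_sum (fun t => floorv (V (lv i)) t)).
  - intros u. destruct HV. apply wexcess_nonneg; assumption.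
  - intros t Ht. apply In_sel in Ht. destruct Ht as [Ht _]. pose proof (floorv_le (V (lv i)) t).
    specialize (L_lt i t Hi (Hincl t Ht)). lia.
  - intros u. rewrite sel_sel. apply (sparse_count (near i)); [assumption|].
    intros s t Hs Ht [E1 V1] [E2 V2]. apply (arc_near V i s t HV).
    + apply (L_lt i); auto.
    + apply (L_lt i); auto.
    + exact V1.
    + rewrite E1, E2. reflexivity.
Qed.

Lemma exceptional_bound (P : nat -> Prop) i l2 E : 0 <= E -> (i < I)%nat -> incl l2 (L i) ->
  sparse (near i) N l2 ->
  (forall s t, In s l2 -> In t l2 -> P s -> P t -> floorv (Vg (lv i)) t = floorv (Vg (lv i)) s) ->
  lsum (fun _ => E) (sel P l2) <= INR N * E.
Proof.
  intros HE Hi Hincl Hsp HP. rewrite lsum_const. apply Rmult_le_compat_r; [assumption|]. apply le_INR.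
  apply (sparse_count (near i)); [assumption|]. intros s t Hs Ht Ps Pt.
  apply (arc_near Vg i s t greedy_hierarchy).
  - apply (L_lt i); auto.
  - apply (L_lt i); auto.
  - apply (floorv_spec (Vg (lv i)) s 0 (greedy_0 _ _ _ _)). lia.
  - apply HP; assumption.
Qed.

Lemma sparse_scale_sum i l2 Jm : (i < I)%nat -> incl l2 (L i) -> sparse (near i) N l2 -> 2 / 2 ^ Jm < bmin ->
  lsum (fun t => term i t) l2 <=
  INR N * arc_const * tot Vg (lv i) + INR N * arc_const * tot Vm (lv i)
  + 3 * INR N * (rpow 2 p * Rmin (rad i) (ell * ell / rad i))
  + psum (fun j => thick_const * (2 / 2 ^ j) * (cc (2 / 2 ^ j * R0 i / 512) - cc (3 * R0 i))) Jm.
Proof.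
  intros Hi Hincl Hsp HJm.
  set (E := rpow 2 p * Rmin (rad i) (ell * ell / rad i)).
  pose proof (rad_pos i) as Hr.
  assert (HE : 0 <= E).
  { unfold E. apply Rmult_le_pos; [apply rpow_nonneg|]. apply Rmin_glb; [lra|].
    apply Rmult_le_pos; [nra|left; apply Rinv_0_lt_compat; assumption]. }
  pose proof arc_const_nonneg as HA.
  assert (Wg0 : forall l u, 0 <= wexcess gam n Vg l u) by (destruct greedy_hierarchy; apply wexcess_nonneg; assumption).
  assert (Wm0 : forall l u, 0 <= wexcess gam n Vm l u) by (destruct greedy_mid_hierarchy; apply wexcess_nonneg; assumption).
  set (fg := floorv (Vg (lv i))). set (fm := floorv (Vm (lv i))).
  set (ng := nextv n (Vg (lv i))).
  set (e1 := fun t : nat => fg t = 0%nat). set (e2 := fun t => ng (fg t) = n).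
  set (e3 := fun t => (ng (fg t) < n)%nat /\ ng (ng (fg t)) = n).
  assert (Vfg : forall t, Vg (lv i) (fg t)).
  { intros t. apply (floorv_spec (Vg (lv i)) t 0 (greedy_0 _ _ _ _)). lia. }
  (* All possible charges are added with their indicators. They are nonnegative, so it is enough
     that one of them dominates the term. *)
  apply Rle_trans with (lsum (fun t =>
     indic (Vg (lv i) (fg t)) (arc_const * wexcess gam n Vg (lv i) (fg t))
     + indic (Vm (lv i) (fm t)) (arc_const * wexcess gam n Vm (lv i) (fm t))
     + indic (e1 t) E + indic (e2 t) E + indic (e3 t) E
     + psum (fun j => indic (klass i j t) (term i t)) Jm) l2).
  - apply lsum_le. intros t Ht. pose proof (Hincl t Ht) as HtL.
    pose proof (b_nonneg i t Hi HtL) as Hb.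
    assert (T0 : 0 <= term i t) by (apply Rmult_le_pos; [apply rpow_nonneg|lra]).
    pose proof (indic_nonneg (Vg (lv i) (fg t)) (arc_const * wexcess gam n Vg (lv i) (fg t)) ltac:(apply Rmult_le_pos; auto)) as I1.
    pose proof (indic_nonneg (Vm (lv i) (fm t)) (arc_const * wexcess gam n Vm (lv i) (fm t)) ltac:(apply Rmult_le_pos; auto)) as I2.
    pose proof (indic_nonneg (e1 t) E HE) as I3. pose proof (indic_nonneg (e2 t) E HE) as I4.
    pose proof (indic_nonneg (e3 t) E HE) as I5.
    assert (I6 : 0 <= psum (fun j => indic (klass i j t) (term i t)) Jm).
    { apply psum_nonneg. intros j _. apply indic_nonneg; assumption. }
    destruct (term_le i t Hi HtL) as [_ TE]. fold E in TE.
    destruct (Req_dec (b i t) 0) as [E0|E0].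
    { assert (ET : term i t = 0) by (rewrite E0, rpow_0; ring). lra. }
    destruct (item_cases i t Hi HtL ltac:(lra)) as [H|[H|[H|[H|[H|H]]]]].
    + rewrite (indic_true (e1 t)) by exact H. lra.
    + rewrite (indic_true (e2 t)) by exact H. lra.
    + rewrite (indic_true (e3 t)) by exact H. lra.
    + rewrite (indic_true (Vg (lv i) (fg t))) by apply Vfg. unfold fg. lra.
    + destruct H as [H1 H2]. rewrite (indic_true (Vm (lv i) (fm t))) by exact H1. unfold fm. lra.
    + destruct (b_large i t Hi HtL ltac:(lra)) as [HL _]. destruct (b_le2 i t Hi HtL) as [B2 _].
      destruct (dyadic_class (b i t) Jm ltac:(lra)) as [j [Hj Hbj]].
      pose proof (psum_term_le (fun j => indic (klass i j t) (term i t)) j Jm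
        ltac:(intros; apply indic_nonneg; assumption) Hj) as PT. cbv beta in PT.
      rewrite (indic_true (klass i j t)) in PT by (split; [exact H|exact Hbj]). lra.
  - rewrite !lsum_add, !lsum_indic, lsum_psum.
    pose proof (fiber_bound Vg i l2 greedy_hierarchy Hi Hincl Hsp) as F1. fold fg in F1.
    pose proof (fiber_bound Vm i l2 greedy_mid_hierarchy Hi Hincl Hsp) as F2. fold fm in F2.
    assert (Hlt : forall t, In t l2 -> (fg t < n)%nat).
    { intros t Ht. pose proof (floorv_le (Vg (lv i)) t). specialize (L_lt i t Hi (Hincl t Ht)). unfold fg. lia. }
    assert (X1 : lsum (fun _ => E) (sel e1 l2) <= INR N * E).
    { apply (exceptional_bound e1 i); try assumption. unfold e1. fold fg. intros s t _ _ -> ->. reflexivity. }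
    assert (X2 : lsum (fun _ => E) (sel e2 l2) <= INR N * E).
    { apply (exceptional_bound e2 i); try assumption. unfold e2. fold fg. intros s t Hs Ht E1 E2.
      apply (next_inj (Vg (lv i)) (greedy_n _ _ _ _) (greedy_le _ _ _ _)); auto. unfold ng in *; congruence. }
    assert (X3 : lsum (fun _ => E) (sel e3 l2) <= INR N * E).
    { apply (exceptional_bound e3 i); try assumption. unfold e3. fold fg. intros s t Hs Ht [L1 E1] [L2 E2].
      apply (next_inj (Vg (lv i)) (greedy_n _ _ _ _) (greedy_le _ _ _ _)); auto.
      destruct (nextv_spec n (Vg (lv i)) (greedy_n _ _ _ _) (greedy_le _ _ _ _) (fg s) (Hlt s Hs)) as [S1 _].
      destruct (nextv_spec n (Vg (lv i)) (greedy_n _ _ _ _) (greedy_le _ _ _ _) (fg t) (Hlt t Ht)) as [S2 _].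
      apply (next_inj (Vg (lv i)) (greedy_n _ _ _ _) (greedy_le _ _ _ _)); auto. unfold ng in *; congruence. }
    assert (X4 : psum (fun j => lsum (fun t => indic (klass i j t) (term i t)) l2) Jm <=
      psum (fun j => thick_const * (2 / 2 ^ j) * (cc (2 / 2 ^ j * R0 i / 512) - cc (3 * R0 i))) Jm).
    { apply psum_le. intros j _. rewrite lsum_indic. apply klass_sum; assumption. }
    lra.
Qed.

(** Terms in crowded groups are bounded by 2^p [rad i] whatever [b] is, since merging saves a fixed
    part of [rad i] per point. *)
Lemma scale_sum i Jm : (i < I)%nat -> 2 / 2 ^ Jm < bmin ->
  lsum (fun t => term i t) (L i) <=
  16 * rpow 2 p * (cc (rad i / 16) - cc ((2 * near_factor + 2) * rad i)) +
  (INR N * arc_const * tot Vg (lv i) + INR N * arc_const * tot Vm (lv i)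
  + 3 * INR N * (rpow 2 p * Rmin (rad i) (ell * ell / rad i))
  + psum (fun j => thick_const * (2 / 2 ^ j) * (cc (2 / 2 ^ j * R0 i / 512) - cc (3 * R0 i))) Jm).
Proof.
  intros Hi HJm. pose proof (rad_pos i) as Hr. pose proof (rad_ge i).
  assert (HD : 0 <= near_factor) by (unfold near_factor; lra).
  destruct (crowded_split (near i) ltac:(intros; cbv beta; rewrite Bdist_refl; nra) N (L i)) as [G [l2 [HP [Hsp HG]]]].
  { apply INR_lt. simpl. lra. }
  assert (Hin : forall t, In t (concat G ++ l2) -> In t (L i)).
  { intros t Ht. apply (Permutation_in t (Permutation_sym HP) Ht). }
  assert (Hnd : NoDup (concat G ++ l2)) by (apply (Permutation_NoDup HP); apply L_nodup; assumption).
  rewrite (lsum_Permutation _ _ _ HP), lsum_app. apply Rplus_le_compat.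
  - assert (HC : INR (length (concat G)) * rad i / 16 <= cc (rad i / 16) - cc ((2 * near_factor + 2) * rad i)).
    { apply (crowded_gain gam n rho rho_pos gam_step G (rad i) near_factor N); try assumption; try lra.
      - apply NoDup_app_remove_r in Hnd. assumption.
      - intros t Ht. assert (HtL : In t (L i)) by (apply Hin, in_or_app; auto).
        specialize (L_lt i t Hi HtL). lia.
      - intros s t Hs Ht Hst. apply L_sep; try assumption; apply Hin, in_or_app; auto. }
    pose proof (rpow_pos 2 p ltac:(lra)).
    apply Rle_trans with (lsum (fun _ => rpow 2 p * rad i) (concat G)).
    + apply lsum_le. intros t Ht. apply term_le; [assumption|]. apply Hin, in_or_app; auto.
    + rewrite lsum_const.
      replace (INR (length (concat G)) * (rpow 2 p * rad i)) with (16 * rpow 2 p * (INR (length (concat G)) * rad i / 16)) by field.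
      apply Rmult_le_compat_l; lra.
  - apply sparse_scale_sum; try assumption. intros t Ht. apply Hin, in_or_app; auto.
Qed.

(** Each level is counted for five radii, and [wexcess_total] contributes the factor 2. *)
Lemma tot_sum V : hierarchy gam n V sc -> psum (fun i => tot V (lv i)) I <= 10 * ell.
Proof.
  intros [H1 H2 H3 H4 _].
  assert (W0 : forall l, 0 <= tot V l) by (intros; apply psum_nonneg; intros; apply wexcess_nonneg; assumption).
  apply Rle_trans with (psum (fun i => tot V (lv i)) (5 * I)).
  { apply psum_mono; [intros; apply W0|lia]. }
  rewrite (psum_div5 (fun l => tot V (S l))), (psum_succ (fun l => tot V l)).
  pose proof (wexcess_total gam n V H1 H2 H4 (S I)) as HT.
  assert (HC : psum (chord gam n V 0) n <= ell).
  { apply Rle_trans with (psum (fun _ => rho) n).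
    - apply psum_le. intros j Hj. rewrite chord0 by assumption. apply gam_step; assumption.
    - unfold ell. assert (E : psum (fun _ => rho) n = INR n * rho).
      { clear. induction n as [|m IH]; [simpl; ring|]. simpl psum. rewrite IH, S_INR. ring. }
      rewrite E, S_INR. lra. }
  pose proof (W0 0%nat). cbv beta in *. lra.
Qed.

(** In order: crowded groups, curved arcs of the two hierarchies at 10 each, three kinds of end arcs
    with a geometric series of sum 4, and flat arcs. *)
Definition walk_const : R :=
  16 * rpow 2 p * INR J0 + 20 * INR N * arc_const + 12 * INR N * rpow 2 p + 44 * thick_const.

Theorem walk_sum : psum (fun i => lsum (fun t => term i t) (L i)) I <= walk_const * (INR (S n) * rho).
Proof.
  (* [Jm] only has to provide a dyadic class for every positive value of [b]; the bounds below are
     uniform in it. *)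
  destruct (pow_lt_1_zero (/ 2) ltac:(rewrite Rabs_pos_eq; lra) (bmin / 2) ltac:(lra)) as [Jm HJm].
  specialize (HJm Jm (Nat.le_refl _)).
  assert (Hp2 : 0 < 2 ^ Jm) by (apply pow_lt; lra).
  assert (HJ : 2 / 2 ^ Jm < bmin).
  { rewrite pow_inv in HJm. rewrite Rabs_pos_eq in HJm by (left; apply Rinv_0_lt_compat; assumption). unfold Rdiv. lra. }
  fold ell. pose proof ell_pos as Hell. pose proof (rpow_pos 2 p ltac:(lra)) as H2p.
  pose proof arc_const_nonneg as HA. pose proof (pos_INR N) as HN.
  assert (HT : 0 <= thick_const) by (unfold thick_const; apply Rmult_le_pos; lra).
  eapply Rle_trans.
  { apply psum_le. intros i Hi. apply (scale_sum i Jm Hi HJ). }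
  rewrite !psum_add, !psum_scal.
  pose proof (tot_sum Vg greedy_hierarchy) as TG. pose proof (tot_sum Vm greedy_mid_hierarchy) as TM.
  pose proof (psum_min_geometric r0 ell I r0_pos Hell) as TE.
  set (Q := 2 * near_factor + 2) in *.
  assert (HQ : 0 < Q) by (unfold Q, near_factor; lra).
  assert (TC : psum (fun i => cc (rad i / 16) - cc (Q * rad i)) I <= INR J0 * ell).
  (* In this normalization the coarse content is [th (i + J0)], while [J0_large] puts the scale of
     [th i] below rad i / 16; contents decrease with the scale. *)
  { set (th := fun i => cc (Q * (r0 * 2 ^ i) / 2 ^ J0)).
    eapply Rle_trans; [|apply (psum_shift_diff th J0 ell I)].
    - apply psum_le. intros i _. unfold th, rad.
      assert (0 < 2 ^ J0) by (apply pow_lt; lra).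
      replace (Q * (r0 * 2 ^ (i + J0)) / 2 ^ J0) with (Q * (r0 * 2 ^ i)) by (rewrite pow_add; field; lra).
      apply Rplus_le_compat_r. apply capped_anti; [assumption|].
      pose proof (rad_pos i) as Hr. unfold rad in Hr.
      apply Rmult_le_reg_r with (2 ^ J0); [assumption|]. unfold Rdiv. rewrite !Rmult_assoc, Rinv_l by lra. nra.
    - intros i. apply capped_bounds; assumption. }
  assert (TK : psum (fun i => psum (fun j => thick_const * (2 / 2 ^ j) * (cc (2 / 2 ^ j * R0 i / 512) - cc (3 * R0 i))) Jm) I
    <= thick_const * (44 * ell)).
  { rewrite psum_psum.
    apply Rle_trans with (psum (fun j => (thick_const * ell) * (2 / 2 ^ j * INR (j + 10))) Jm).
    - apply psum_le. intros j _.
      assert (Hj : 0 < 2 ^ j) by (apply pow_lt; lra).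
      assert (Hj2 : 0 < 2 / 2 ^ j) by (apply Rdiv_lt_0_compat; lra).
      rewrite psum_scal.
      assert (TJ : psum (fun i => cc (2 / 2 ^ j * R0 i / 512) - cc (3 * R0 i)) I <= INR (j + 10) * ell).
      (* Ten further octaves suffice since 3 / 1024 <= 2 / 512. *)
      { set (th := fun i => cc (3 * (4 * A * (r0 * 2 ^ i)) / 2 ^ (j + 10))).
        eapply Rle_trans; [|apply (psum_shift_diff th (j + 10) ell I)].
        - apply psum_le. intros i _. unfold th, rad.
          assert (H10 : 2 ^ (j + 10) = 2 ^ j * 1024) by (rewrite pow_add; f_equal; simpl; ring).
          replace (2 ^ (i + (j + 10))) with (2 ^ i * (2 ^ j * 1024)) by (rewrite <- H10, <- pow_add; reflexivity).
          rewrite H10.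
          replace (3 * (4 * A * (r0 * (2 ^ i * (2 ^ j * 1024)))) / (2 ^ j * 1024)) with (3 * (4 * A * (r0 * 2 ^ i))) by (field; lra).
          apply Rplus_le_compat_r. apply capped_anti; [assumption|].
          pose proof (Arad_pos i) as Hr. unfold rad in Hr. set (z := r0 * 2 ^ i) in *.
          replace (3 * (4 * A * z) / (2 ^ j * 1024)) with (12 / 1024 * (A * z) * / 2 ^ j) by (field; lra).
          replace (2 / 2 ^ j * (4 * A * z) / 512) with (8 / 512 * (A * z) * / 2 ^ j) by (field; lra).
          apply Rmult_le_compat_r; [left; apply Rinv_0_lt_compat; assumption|lra].
        - intros i. apply capped_bounds; assumption. }
      replace (thick_const * ell * (2 / 2 ^ j * INR (j + 10))) with (thick_const * (2 / 2 ^ j) * (INR (j + 10) * ell)) by ring.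
      apply Rmult_le_compat_l; [nra|assumption].
    - rewrite psum_scal. pose proof (psum_arith_geometric Jm).
      replace (thick_const * (44 * ell)) with (thick_const * ell * 44) by ring.
      apply Rmult_le_compat_l; [nra|assumption]. }
  fold (rad) in *.
  assert (G1 : INR N * arc_const * psum (fun i => tot Vg (lv i)) I <= INR N * arc_const * (10 * ell)).
  { apply Rmult_le_compat_l; [apply Rmult_le_pos; assumption|assumption]. }
  assert (G2 : INR N * arc_const * psum (fun i => tot Vm (lv i)) I <= INR N * arc_const * (10 * ell)).
  { apply Rmult_le_compat_l; [apply Rmult_le_pos; assumption|assumption]. }
  assert (G3 : 3 * INR N * (rpow 2 p * psum (fun i => Rmin (rad i) (ell * ell / rad i)) I) <= 3 * INR N * (rpow 2 p * (4 * ell))).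
  { apply Rmult_le_compat_l; [lra|]. apply Rmult_le_compat_l; [lra|exact TE]. }
  assert (G4 : 16 * rpow 2 p * psum (fun i => cc (rad i / 16) - cc (Q * rad i)) I <= 16 * rpow 2 p * (INR J0 * ell)).
  { apply Rmult_le_compat_l; [lra|assumption]. }
  unfold walk_const. lra.
Qed.
End Discrete.

(** * From a connected set to a walk *)

Section Crossing.
Context {X : Banach}.
Variables (Sigma : X -> Prop) (O : nat -> X -> Prop) (dd : nat -> R).
Hypothesis Sigma_connected : connected Sigma.
Hypothesis O_open : forall i x, O i x -> exists r, r > 0 /\ forall y, Bdist y x < r -> O i y.
Hypothesis O_cover : forall x, Sigma x -> exists i, O i x.
Hypothesis O_diam : forall i x y, O i x -> O i y -> Bdist x y <= dd i.

(* A chain returning to a label can be truncated there, so distances along chains are bounded by sums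
   over distinct labels. *)
Inductive schain (x : X) : list nat -> X -> Prop :=
| schain_one i y : O i x -> O i y -> schain x (i :: nil) y
| schain_cons i l y z : schain x l y -> O i y -> O i z -> ~ In i l -> schain x (i :: l) z.

Lemma schain_truncate x l y i z : schain x l y -> In i l -> O i z -> exists l', schain x l' z.
Proof.
  intros H. induction H as [j y Hx Hy|j l y y' H IH Hy Hy' Hj]; intros Hi Hz.
  - destruct Hi as [<-|[]]. exists (j :: nil). constructor; assumption.
  - destruct Hi as [<-|Hi]; [|auto]. exists (j :: l). econstructor; eassumption.
Qed.

Lemma schain_dist x l y : schain x l y -> Bdist y x <= lsum dd l.
Proof.
  intros H. induction H as [j y Hx Hy|j l y y' H IH Hy Hy' Hj]; rewrite lsum_cons.
  - specialize (O_diam j y x Hy Hx). simpl. lra.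
  - specialize (O_diam j y' y Hy' Hy). pose proof (Bdist_triangle y' y x). lra.
Qed.

Lemma schain_NoDup x l y : schain x l y -> NoDup l.
Proof. induction 1; constructor; simpl; auto. constructor. Qed.

(** Otherwise no chain from [x] ever gets as far as [tau], so [q] is not reached; the sets
    containing a reachable point and the remaining sets then have unions that separate [Sigma]. *)
Lemma crossing x q tau : Sigma x -> Sigma q -> 0 < tau <= Bdist q x ->
  exists l, NoDup l /\ tau <= lsum dd l /\ forall i, In i l -> exists z, O i z /\ Bdist z x < tau.
Proof.
  intros Hx Hq Htau. apply NNPP. intros Hno.
  assert (Hgood : forall l y, schain x l y -> Bdist y x < tau /\ forall i, In i l -> exists z, O i z /\ Bdist z x < tau).
  { intros l y H. induction H as [j y Hxj Hy|j l y y' H [IH1 IH2] Hy Hy' Hj].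
    - assert (HN : forall i, In i (j :: nil) -> exists z, O i z /\ Bdist z x < tau).
      { intros i [<-|[]]. exists x. rewrite Bdist_refl. split; [assumption|lra]. }
      split; [|exact HN]. apply Rnot_le_lt. intros L. apply Hno. exists (j :: nil).
      assert (HS : schain x (j :: nil) y) by (constructor; assumption).
      pose proof (schain_dist _ _ _ HS). pose proof (schain_NoDup _ _ _ HS). repeat split; try assumption. lra.
    - assert (HN : forall i, In i (j :: l) -> exists z, O i z /\ Bdist z x < tau).
      { intros i [<-|Hi]; [|auto]. exists y. auto. }
      split; [|exact HN]. apply Rnot_le_lt. intros L. apply Hno. exists (j :: l).
      assert (HS : schain x (j :: l) y') by (econstructor; eassumption).
      pose proof (schain_dist _ _ _ HS). pose proof (schain_NoDup _ _ _ HS). repeat split; try assumption. lra. }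
  set (Rch := fun y => exists l, schain x l y).
  assert (Hcl : forall i y z, Rch y -> O i y -> O i z -> Rch z).
  { intros i y z [l Hl] Hy Hz. destruct (in_dec Nat.eq_dec i l) as [Hi|Hi].
    - eapply schain_truncate; eassumption.
    - exists (i :: l). econstructor; eassumption. }
  apply Sigma_connected.
  exists (fun y => exists i, O i y /\ exists z, Rch z /\ O i z).
  exists (fun y => exists i, O i y /\ ~ exists z, Rch z /\ O i z).
  split; [|split; [|split; [|split; [|split]]]].
  - intros y [i [Hi Hz]]. destruct (O_open i y Hi) as [r [Hr Hb]]. exists r. split; [assumption|].
    intros y' Hy'. exists i. auto.
  - intros y [i [Hi Hz]]. destruct (O_open i y Hi) as [r [Hr Hb]]. exists r. split; [assumption|].
    intros y' Hy'. exists i. auto.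
  - intros y Hy. destruct (O_cover y Hy) as [i Hi].
    destruct (classic (exists z, Rch z /\ O i z)); [left|right]; exists i; auto.
  - exists x. split; [assumption|]. destruct (O_cover x Hx) as [i Hi]. exists i. split; [assumption|].
    exists x. split; [exists (i :: nil); constructor; assumption|assumption].
  - exists q. split; [assumption|]. destruct (O_cover q Hq) as [i Hi]. exists i. split; [assumption|].
    intros [z [Hz Hiz]]. destruct (Hcl i z q Hz Hiz Hi) as [l Hl]. destruct (Hgood l q Hl) as [H _]. lra.
  - intros y _ [i [Hi [z [Hz Hiz]]]] [j [Hj Hn]]. apply Hn. exists y. split; [|assumption].
    exact (Hcl i z y Hz Hiz Hi).
Qed.
End Crossing.

Lemma psum_sum_f_R0 f m : psum f (S m) = sum_f_R0 f m.
Proof. induction m as [|m IH]; [simpl; ring|]. change (psum f (S (S m))) with (psum f (S m) + f (S m)). rewrite IH. reflexivity. Qed.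

Lemma lsum_NoDup_le_psum f l : (forall i, 0 <= f i) -> NoDup l -> exists m, lsum f l <= psum f m.
Proof.
  intros Hf Hl. exists (S (list_max l)).
  rewrite <- (Rmult_1_l (psum f _)). change 1 with (INR 1).
  apply (fiber_sum (fun i : nat => i)); [assumption| |].
  - intros x Hx. pose proof (proj1 (list_max_le l (list_max l)) (Nat.le_refl _)) as H.
    rewrite Forall_forall in H. specialize (H x Hx). lia.
  - intros i. pose proof (NoDup_sel (fun x => x = i) l Hl) as H.
    assert (Hall : forall x, In x (sel (fun x => x = i) l) -> x = i) by (intros x Hx; apply In_sel in Hx; tauto).
    destruct (sel (fun x => x = i) l) as [|x [|y l']]; simpl; try lia.
    exfalso. inversion H; subst. rewrite (Hall x), (Hall y) in * by (simpl; auto). simpl in *. tauto.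
Qed.

Lemma geometric_sum e m : psum (fun i => e / 2 ^ S i) m = e - e / 2 ^ m.
Proof.
  induction m as [|m IH]; [simpl; field|]. cbn [psum]. rewrite IH. simpl pow.
  assert (0 < 2 ^ m) by (apply pow_lt; lra). field. lra.
Qed.

(* Disjoint balls centred on a connected set each consume a definite share of a fine cover. *)
Lemma packing (X : Banach) (Sigma : X -> Prop) (M rho : R) (l : list X) :
  connected Sigma -> H1_le Sigma M -> 0 < rho ->
  (forall x, In x l -> Sigma x /\ exists q, Sigma q /\ rho / 4 <= Bdist q x) ->
  ForallOrdPairs (fun x y => rho <= Bdist x y) l ->
  INR (length l) * rho <= 4 * M.
Proof.
  intros Hconn HM Hrho Hl Hsep.
  apply le_epsilon. intros e0 He0.
  (* The sets are made open by enlarging the i-th one by e / 2^(i + 1). This adds at most 2 e to the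
     sum, [H1_le] another e, and the factor 4 turns 3 e into [e0]. The bound rho / 16 keeps
     diameters below rho / 2, so no set meets two balls of radius rho / 4. *)
  set (e := Rmin (e0 / 12) (rho / 16)).
  assert (He : 0 < e <= e0 / 12 /\ e <= rho / 16).
  { unfold e. split; [split; [apply Rmin_glb_lt; lra|apply Rmin_l]|apply Rmin_r]. }
  destruct (HM (rho / 16) e ltac:(lra) ltac:(lra)) as [U [d [HU [Hd [Hdiam Hsum]]]]].
  set (ei := fun i => e / 2 ^ S i).
  assert (Hei : forall i, 0 < ei i <= e).
  { intros i. unfold ei. assert (1 <= 2 ^ S i) by (apply pow_R1_Rle; lra).
    split; [apply Rdiv_lt_0_compat; lra|]. apply Rmult_le_reg_r with (2 ^ S i); [lra|].
    unfold Rdiv. rewrite Rmult_assoc, Rinv_l by lra. nra. }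
  set (O := fun i (y : X) => exists x, U i x /\ Bdist y x < ei i).
  set (dd := fun i => d i + 2 * ei i).
  assert (O_open : forall i x, O i x -> exists r, r > 0 /\ forall y, Bdist y x < r -> O i y).
  { intros i x [z [Hz Hxz]]. exists (ei i - Bdist x z). split; [lra|]. intros y Hy. exists z.
    split; [assumption|]. pose proof (Bdist_triangle y x z). lra. }
  assert (O_cover : forall x, Sigma x -> exists i, O i x).
  { intros x Hx. destruct (HU x Hx) as [i Hi]. exists i, x. rewrite Bdist_refl. split; [assumption|apply Hei]. }
  assert (O_diam : forall i x y, O i x -> O i y -> Bdist x y <= dd i).
  { intros i x y [x' [Hx' Dx]] [y' [Hy' Dy]]. specialize (Hdiam i x' y' Hx' Hy'). unfold dd.
    pose proof (Bdist_triangle x x' y). pose proof (Bdist_triangle x' y' y). rewrite (Bdist_sym y y') in Dy. lra. }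
  assert (Hdd : forall i, 0 <= dd i <= rho / 16 + rho / 8).
  { intros i. unfold dd. specialize (Hd i). specialize (Hei i). lra. }
  assert (HJ : exists J, NoDup J /\ INR (length l) * (rho / 4) <= lsum dd J /\
     forall i, In i J -> exists x, In x l /\ exists z, O i z /\ Bdist z x < rho / 4).
  { clear HM Hsum. induction l as [|x l IH].
    - exists nil. repeat split; [constructor|simpl; lra|intros i []].
    - inversion Hsep as [|? ? Hx Hsep']; subst.
      destruct IH as [J [J1 [J2 J3]]]; [intros; apply Hl; simpl; auto|assumption|].
      destruct (Hl x (or_introl eq_refl)) as [Sx [q [Sq Hq]]].
      destruct (crossing Sigma O dd Hconn O_open O_cover O_diam x q (rho / 4) Sx Sq ltac:(lra)) as [J' [K1 [K2 K3]]].
      exists (J' ++ J). split; [|split].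
      + apply NoDup_app; [assumption|assumption|]. intros i Hi Hi'.
        destruct (K3 i Hi) as [z [Oz Dz]]. destruct (J3 i Hi') as [x' [Hx' [z' [Oz' Dz']]]].
        rewrite Forall_forall in Hx. specialize (Hx x' Hx'). specialize (O_diam i z z' Oz Oz'). specialize (Hdd i).
        pose proof (Bdist_triangle x z x') as T1. pose proof (Bdist_triangle z z' x') as T2.
        rewrite (Bdist_sym x z) in T1. lra.
      + rewrite lsum_app. simpl length. rewrite S_INR. lra.
      + intros i Hi. apply in_app_or in Hi. destruct Hi as [Hi|Hi].
        * exists x. split; [simpl; auto|auto].
        * destruct (J3 i Hi) as [x' [Hx' Hz]]. exists x'. split; [simpl; auto|assumption]. }
  destruct HJ as [J [J1 [J2 _]]].
  destruct (lsum_NoDup_le_psum dd J (fun i => proj1 (Hdd i)) J1) as [m Hm].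
  assert (Hm' : psum dd m <= M + 3 * e).
  { apply Rle_trans with (psum dd (S m)); [apply psum_mono; [intros; apply Hdd|lia]|].
    unfold dd. rewrite psum_add, psum_scal, psum_sum_f_R0. unfold ei. rewrite geometric_sum.
    specialize (Hsum m). assert (0 < e / 2 ^ S m) by apply Hei. lra. }
  lra.
Qed.

Lemma finite_of_bounded {T} (P : T -> Prop) (B : nat) :
  (forall l, NoDup l -> (forall x, In x l -> P x) -> (length l <= B)%nat) ->
  exists l, NoDup l /\ forall x, P x <-> In x l.
Proof.
  intros H.
  assert (K : forall k, (exists l, NoDup l /\ forall x, P x <-> In x l) \/
     exists l, NoDup l /\ (forall x, In x l -> P x) /\ length l = k).
  { induction k as [|k [IH|[l [H1 [H2 H3]]]]]; [right; exists nil; repeat split; [constructor|intros x []]|auto|].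
    destruct (classic (exists x, P x /\ ~ In x l)) as [[x [Px Hx]]|N].
    - right. exists (x :: l). split; [constructor; assumption|]. split; [|simpl; lia].
      intros y [<-|Hy]; auto.
    - left. exists l. split; [assumption|]. intros x. split; [|apply H2].
      intros Px. apply NNPP. intros Hx. apply N; eauto. }
  destruct (K (S B)) as [|[l [H1 [H2 H3]]]]; [assumption|]. specialize (H l H1 H2). lia.
Qed.

(** * Walks through all points of a net *)

Section Walks.
Context {T : Type}.
Variable adj : T -> T -> Prop.
Hypothesis adj_sym : forall x y, adj x y -> adj y x.

Fixpoint walk (w : list T) : Prop :=
  match w with
  | x :: ((y :: _) as w') => adj x y /\ walk w'
  | _ => True
  end.

Lemma walk_detour w1 s v w2 : walk (w1 ++ s :: w2) -> adj s v -> walk (w1 ++ s :: v :: s :: w2).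
Proof.
  intros H Hsv. induction w1 as [|x w1 IH].
  - simpl in *. auto.
  - destruct w1 as [|y w1].
    + simpl in *. destruct H as [H1 H2]. repeat split; auto.
    + simpl in *. destruct H as [H1 H2]. split; [assumption|]. apply IH. assumption.
Qed.

Lemma walk_nth w i x0 : walk w -> (S i < length w)%nat -> adj (nth i w x0) (nth (S i) w x0).
Proof.
  revert i; induction w as [|x w IH]; intros i H Hi; [simpl in Hi; lia|].
  destruct w as [|y w]; [simpl in Hi; lia|]. destruct H as [H1 H2].
  destruct i as [|i]; [exact H1|]. apply (IH i H2). simpl in *; lia.
Qed.

(** The visited set grows by a neighbour [v] of a visited [s], and the walk by the detour s, v, s
    inserted at [s]; so each new point costs two steps. *)
Lemma covering_walk (l : list T) x0 : NoDup l -> In x0 l ->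
  (forall P : T -> Prop, (exists x, In x l /\ P x) -> (exists x, In x l /\ ~ P x) ->
     exists x y, In x l /\ In y l /\ P x /\ ~ P y /\ adj x y) ->
  exists w, walk w /\ (forall x, In x w <-> In x l) /\ (S (length w) = 2 * length l)%nat.
Proof.
  intros Hnd H0 Hconn.
  assert (K : forall k, (k < length l)%nat -> exists w V, walk w /\ NoDup V /\ incl V l /\ length V = S k /\
     (forall x, In x w <-> In x V) /\ (S (length w) = 2 * length V)%nat).
  { induction k as [|k IH]; intros Hk.
    - exists (x0 :: nil), (x0 :: nil). split; [simpl; auto|]. split; [repeat constructor; simpl; auto|].
      split; [intros x [<-|[]]; assumption|]. split; [reflexivity|]. split; [reflexivity|reflexivity].
    - destruct IH as [w [V [Hw [HV1 [HV2 [HV3 [HwV HL]]]]]]]; [lia|].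
      destruct (Hconn (fun x => In x V)) as [s [v [Hs [Hv [HsV [HvV Hadj]]]]]].
      + destruct V as [|z V']; [simpl in HV3; lia|]. exists z. split; [apply HV2|]; simpl; auto.
      + apply NNPP. intros N. assert (incl l V).
        { intros x Hx. apply NNPP. intros Hn. apply N; eauto. }
        pose proof (NoDup_incl_length Hnd H). lia.
      + apply HwV in HsV as Hsw. apply in_split in Hsw. destruct Hsw as [w1 [w2 Ew]]. subst w.
        exists (w1 ++ s :: v :: s :: w2), (v :: V). split; [apply walk_detour; assumption|].
        split; [constructor; assumption|]. split; [intros x [<-|Hx]; auto|]. split; [simpl; lia|].
        split.
        * intros x. specialize (HwV x). rewrite in_app_iff in *. simpl in *. tauto.
        * rewrite length_app in *. simpl in *. lia. }
  destruct l as [|z l'] eqn:El; [destruct H0|]. rewrite <- El in *.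
  assert (Hlen : (0 < length l)%nat) by (rewrite El; simpl; lia).
  destruct (K (length l - 1)%nat ltac:(lia)) as [w [V [Hw [HV1 [HV2 [HV3 [HwV HL]]]]]]].
  exists w. split; [assumption|]. split; [|lia].
  intros x. rewrite HwV. split; [apply HV2|]. apply (NoDup_length_incl HV1); [lia|assumption].
Qed.
End Walks.

Lemma nth_last_default {T} (w : list T) x0 : w <> nil -> nth (length w - 1) w (last w x0) = last w x0.
Proof.
  intros H. destruct (exists_last H) as [w' [x ->]]. rewrite last_last, length_app. simpl.
  rewrite app_nth2 by lia. replace (length w' + 1 - 1 - length w')%nat with 0%nat by lia. reflexivity.
Qed.

Section NetWalk.
Context {X : Banach}.
Variables (Sigma : X -> Prop) (M rho : R) (P : X -> Prop) (p1 q1 : X).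
Hypothesis Sigma_connected : connected Sigma.
Hypothesis H1_Sigma : H1_le Sigma M.
Hypothesis rho_pos : 0 < rho.
Hypothesis Sp1 : Sigma p1.
Hypothesis Sq1 : Sigma q1.
Hypothesis rho_small : rho <= Bdist p1 q1.
Hypothesis P_net : is_net Sigma rho P.

Lemma net_finite : exists l, NoDup l /\ (forall x, P x <-> In x l) /\ INR (length l) * rho <= 4 * M.
Proof.
  destruct P_net as [N1 [N2 N3]].
  assert (Hpack : forall l, NoDup l -> (forall x, In x l -> P x) -> INR (length l) * rho <= 4 * M).
  { intros l Hl HP. apply (packing X Sigma M rho l Sigma_connected H1_Sigma rho_pos).
    - intros x Hx. split; [auto|].
      destruct (Rle_lt_dec (rho / 4) (Bdist p1 x)); [eauto|]. exists q1. split; [assumption|].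
      pose proof (Bdist_triangle p1 x q1). rewrite (Bdist_sym x q1) in *. lra.
    - apply (ForallOrdPairs_impl_in (fun x y => x <> y)); [|apply NoDup_ForallOrdPairs; assumption].
      intros x y Hx Hy Hne. apply Rge_le, N2; auto. }
  destruct (INR_unbounded (4 * M / rho)) as [B HB].
  destruct (finite_of_bounded P B) as [l [H1 H2]].
  - intros l Hl HP. specialize (Hpack l Hl HP). apply INR_le.
    apply Rmult_le_reg_r with rho; [assumption|].
    assert (4 * M / rho * rho = 4 * M) by (field; lra). nra.
  - exists l. split; [assumption|]. split; [assumption|]. apply Hpack; [assumption|]. intros x; apply H2.
Qed.

(** If the two parts of the net were more than 2 rho apart, the unions of the open rho-balls about
    them would separate [Sigma]. *)
Lemma net_connected (Q : X -> Prop) : (exists x, P x /\ Q x) -> (exists x, P x /\ ~ Q x) ->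
  exists x y, P x /\ P y /\ Q x /\ ~ Q y /\ Bdist x y <= 2 * rho.
Proof.
  destruct P_net as [N1 [N2 N3]].
  intros [x [Px Qx]] [y [Py Qy]]. apply NNPP. intros Hno. apply Sigma_connected.
  assert (Hop : forall R : X -> Prop, is_open (fun z => exists w, P w /\ R w /\ Bdist z w < rho)).
  { intros R z [w [H1 [H2 H3]]]. exists (rho - Bdist z w). split; [lra|]. intros z' Hz'.
    exists w. repeat split; try assumption. pose proof (Bdist_triangle z' z w). lra. }
  exists (fun z => exists w, P w /\ Q w /\ Bdist z w < rho), (fun z => exists w, P w /\ ~ Q w /\ Bdist z w < rho).
  split; [apply Hop|]. split; [apply Hop|]. split; [|split; [|split]].
  - intros z Hz. destruct (N3 z Hz) as [w [Pw Dw]]. destruct (classic (Q w)); [left|right]; exists w; auto.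
  - exists x. split; [auto|]. exists x. rewrite Bdist_refl. auto.
  - exists y. split; [auto|]. exists y. rewrite Bdist_refl. auto.
  - intros z _ [w [H1 [H2 H3]]] [w' [H1' [H2' H3']]]. apply Hno. exists w, w'.
    repeat split; try assumption. pose proof (Bdist_triangle w z w') as T. rewrite (Bdist_sym w z) in T. lra.
Qed.

Lemma net_walk : exists (gam : nat -> X) (n : nat),
  (forall i, (i < n)%nat -> Bdist (gam (S i)) (gam i) <= 2 * rho) /\
  (forall i, P (gam i)) /\
  (forall x, P x -> exists i, (i < n)%nat /\ gam i = x) /\
  INR (S n) * rho <= 8 * M.
Proof.
  destruct net_finite as [l [H1 [H2 H3]]].
  destruct P_net as [_ [_ N3]]. destruct (N3 p1 Sp1) as [x0 [Px0 _]].
  destruct (covering_walk (fun x y => Bdist x y <= 2 * rho) ltac:(intros x y H; cbv beta in *; rewrite Bdist_sym; exact H) l x0 H1)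
    as [w [W1 [W2 W3]]].
  - apply H2; assumption.
  - intros Q [x [Hx Qx]] [y [Hy Qy]].
    destruct (net_connected Q) as [x' [y' [A1 [A2 [A3 [A4 A5]]]]]].
    + exists x. rewrite H2. auto.
    + exists y. rewrite H2. auto.
    + exists x', y'. rewrite <- !H2. auto.
  - assert (Hne : w <> nil).
    { intros ->. apply (W2 x0). apply H2; assumption. }
    assert (Hlast : In (last w x0) w).
    { destruct (exists_last Hne) as [w' [z ->]]. rewrite last_last. apply in_or_app; simpl; auto. }
    (* The default value repeats the last vertex at index n = [length w], so every net point occurs
       strictly before [n], as [L_lt] demands, and n + 1 is twice the number of net points. *)
    exists (fun i => nth i w (last w x0)), (length w). split; [|split; [|split]].
    + intros i Hi. destruct (Nat.eq_dec (S i) (length w)) as [E|E].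
      * rewrite (nth_overflow w (n := S i)) by lia.
        replace i with (length w - 1)%nat by lia. rewrite nth_last_default by assumption. rewrite Bdist_refl. lra.
      * rewrite Bdist_sym. apply (walk_nth _ w i (last w x0) W1). lia.
    + intros i. apply H2, W2. destruct (Nat.lt_ge_cases i (length w)).
      * apply nth_In; assumption.
      * rewrite nth_overflow by assumption. assumption.
    + intros x Px. apply H2, W2 in Px. apply (In_nth w x (last w x0)) in Px. exact Px.
    + rewrite W3, mult_INR. simpl INR. lra.
Qed.
End NetWalk.

(** * Beta numbers and the theorem *)

Section Beta.
Context {X : Banach}.

Lemma nonzero_vector : exists v : X, v <> Bzero.
Proof.
  destruct (Bdim2 X) as [u [v Huv]]. exists u. intros E.
  destruct (Huv 1 0) as [H _]; [|lra]. rewrite E. vlin.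
Qed.

Lemma dist_line_glb (y a v : X) :
  is_glb (fun t => exists s, t = Bdist y (Badd a (Bscal s v))) (dist_line y a v).
Proof.
  apply Rinf_spec.
  - exists (Bdist y (Badd a (Bscal 0 v))), 0. reflexivity.
  - exists 0. intros t [s ->]. apply Bdist_nonneg.
Qed.

Lemma dist_line_nonneg (y a v : X) : 0 <= dist_line y a v.
Proof. apply (dist_line_glb y a v). intros t [s ->]. apply Bdist_nonneg. Qed.

Lemma dist_line_le (y a v : X) s : dist_line y a v <= Bdist y (Badd a (Bscal s v)).
Proof. apply (dist_line_glb y a v). eauto. Qed.

Lemma diam_closed_ball (x : X) (r : R) : 0 < r -> diam (closed_ball x r) = 2 * r.
Proof.
  intros Hr.
  assert (Hub : forall t, (exists y z, closed_ball x r y /\ closed_ball x r z /\ t = Bdist y z) -> t <= 2 * r).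
  { intros t [y [z [Hy [Hz ->]]]]. unfold closed_ball in *.
    pose proof (Bdist_triangle y x z) as T. rewrite (Bdist_sym x z) in T. lra. }
  destruct nonzero_vector as [v Hv].
  assert (Hn : 0 < Bnorm v).
  { pose proof (Bdist_pos v Bzero Hv) as H. unfold Bdist in H. replace (Bsub v Bzero) with v in H by vlin. exact H. }
  assert (Hin : exists y z, closed_ball x r y /\ closed_ball x r z /\ 2 * r = Bdist y z).
  { set (u := Bscal (r / Bnorm v) v).
    assert (Hu : Bnorm u = r).
    { unfold u. rewrite Bnorm_scal_nonneg by (left; apply Rdiv_lt_0_compat; assumption). field. lra. }
    exists (Badd x u), (Badd x (Bopp u)). unfold closed_ball, Bdist.
    replace (Bsub (Badd x u) x) with u by vlin.
    replace (Bsub (Badd x (Bopp u)) x) with (Bopp u) by vlin.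
    replace (Bsub (Badd x u) (Badd x (Bopp u))) with (Bscal 2 u) by vlin.
    rewrite Bnorm_opp, Bnorm_scal_nonneg, Hu by lra. lra. }
  destruct (Rsup_spec (fun t => exists y z, closed_ball x r y /\ closed_ball x r z /\ t = Bdist y z)) as [S1 S2].
  - eauto.
  - exists (2 * r). exact Hub.
  - unfold diam. apply Rle_antisym; [apply S2; exact Hub|apply S1; exact Hin].
Qed.

(** The diameter being 2 r, the supremum over the ball is at least 2 r times beta for every line. It
    need not be attained, hence 3/2 in place of 2; the slack above 1 is spent on moving to net
    points. *)
Lemma beta_ball (E : X -> Prop) (x : X) (r : R) : E x -> 0 < r ->
  0 <= beta E (closed_ball x r) /\
  (0 < beta E (closed_ball x r) -> forall a v : X, v <> Bzero ->
     exists z, E z /\ Bdist z x <= r /\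
       forall s, 3 / 2 * beta E (closed_ball x r) * r <= Bdist z (Badd a (Bscal s v))).
Proof.
  intros Ex Hr.
  set (D := fun (a v : X) t => exists z, E z /\ closed_ball x r z /\ t = dist_line z a v).
  assert (Hball : closed_ball x r x) by (unfold closed_ball; rewrite Bdist_refl; lra).
  assert (HD : forall a v, is_lub (D a v) (Rsup (D a v))).
  { intros a v. apply Rsup_spec.
    - exists (dist_line x a v), x. auto.
    - exists (r + Bdist x (Badd a (Bscal 0 v))). intros t [z [Ez [Hz ->]]]. unfold closed_ball in Hz.
      pose proof (dist_line_le z a v 0). pose proof (Bdist_triangle z x (Badd a (Bscal 0 v))). lra. }
  assert (HD0 : forall a v, 0 <= Rsup (D a v)).
  { intros a v. destruct (HD a v) as [H _]. apply Rle_trans with (dist_line x a v); [apply dist_line_nonneg|].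
    apply H. exists x. auto. }
  assert (G : is_glb (fun b => exists a v : X, v <> Bzero /\ b = Rsup (D a v) / diam (closed_ball x r)) (beta E (closed_ball x r))).
  { unfold beta. destruct (excluded_middle_informative _) as [_|N]; [|exfalso; apply N; eauto].
    apply Rinf_spec.
    - destruct nonzero_vector as [v Hv]. exists (Rsup (D x v) / diam (closed_ball x r)), x, v. auto.
    - exists 0. intros b [a [v [Hv ->]]]. rewrite diam_closed_ball by assumption.
      apply Rmult_le_pos; [apply HD0|left; apply Rinv_0_lt_compat; lra]. }
  destruct G as [G1 G2]. rewrite diam_closed_ball in G1, G2 by assumption.
  set (be := beta E (closed_ball x r)) in *. split.
  - apply G2. intros b [a [v [Hv ->]]].
    apply Rmult_le_pos; [apply HD0|left; apply Rinv_0_lt_compat; lra].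
  - intros Hbe a v Hv. apply NNPP. intros Hno.
    assert (Hsup : Rsup (D a v) <= 3 / 2 * be * r).
    { apply (HD a v). intros t [z [Ez [Hz ->]]]. apply Rnot_lt_le. intros HL. apply Hno. exists z.
      split; [assumption|]. split; [exact Hz|]. intros s. pose proof (dist_line_le z a v s). lra. }
    specialize (G1 (Rsup (D a v) / (2 * r)) (ex_intro _ a (ex_intro _ v (conj Hv eq_refl)))).
    assert (be * (2 * r) <= Rsup (D a v)).
    { apply Rmult_le_reg_r with (/ (2 * r)); [apply Rinv_0_lt_compat; lra|].
      rewrite Rmult_assoc, Rinv_r by lra. unfold Rdiv in G1. lra. }
    assert (0 < be * r) by (apply Rmult_lt_0_compat; assumption). lra.
Qed.
End Beta.

(** * Reduction of a finite family of balls to a walk *)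

Lemma list_positive_bound {T} (f : T -> R) (l : list T) :
  exists m, 0 < m /\ forall x, In x l -> 0 < f x -> m <= f x.
Proof.
  induction l as [|x l [m [Hm H]]]; [exists 1; split; [lra|intros x []]|].
  destruct (Rlt_le_dec 0 (f x)) as [Hx|Hx].
  - exists (Rmin m (f x)). split; [apply Rmin_glb_lt; assumption|].
    intros y [<-|Hy] Hfy; [apply Rmin_r|]. eapply Rle_trans; [apply Rmin_l|auto].
  - exists m. split; [assumption|]. intros y [<-|Hy] Hfy; [lra|auto].
Qed.

Lemma list_Z_bound {T} (f : T -> Z) (l : list T) : exists m, forall x, In x l -> (f x <= m)%Z.
Proof.
  induction l as [|x l [m H]]; [exists 0%Z; intros x []|].
  exists (Z.max m (f x)). intros y [<-|Hy]; [lia|]. specialize (H y Hy). lia.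
Qed.

Lemma lsum_partition {T} (f : T -> nat) (g : T -> R) (l : list T) m :
  (forall x, In x l -> (f x < m)%nat) -> lsum g l = psum (fun i => lsum g (sel (fun x => f x = i) l)) m.
Proof.
  revert l; induction m as [|m IH]; intros l H.
  - destruct l as [|x l]; [reflexivity|]. specialize (H x (or_introl eq_refl)). lia.
  - rewrite (lsum_sel_split g (fun x => f x = m) l). simpl psum. rewrite Rplus_comm. f_equal.
    rewrite IH.
    + apply psum_ext. intros i Hi. f_equal. rewrite sel_sel. apply sel_ext. intros x _.
      split; [tauto|]. intros E. split; [assumption|lia].
    + intros x Hx. apply In_sel in Hx. destruct Hx as [Hx Hne]. specialize (H x Hx). lia.
Qed.

Lemma lsum_map {S T} (h : S -> T) (g : T -> R) (l : list S) : lsum g (map h l) = lsum (fun x => g (h x)) l.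
Proof. induction l as [|x l IH]; [reflexivity|]. simpl map. rewrite !lsum_cons, IH. reflexivity. Qed.

Lemma NoDup_map_inj_in {S T} (h : S -> T) (l : list S) :
  NoDup l -> (forall x y, In x l -> In y l -> h x = h y -> x = y) -> NoDup (map h l).
Proof.
  induction 1 as [|x l Hx Hl IH]; intros Hinj; simpl; constructor.
  - intros Hin. apply in_map_iff in Hin. destruct Hin as [y [E Hy]].
    rewrite (Hinj x y) in Hx by (simpl; auto). contradiction.
  - apply IH. intros; apply Hinj; simpl; auto.
Qed.

Lemma walk_const_nonneg c p N J0 : 0 <= walk_const c p N J0.
Proof.
  pose proof (pos_INR N). pose proof (pos_INR J0). pose proof (rpow_nonneg 2 p).
  assert (0 <= arc_const c p) by apply rpow_nonneg.
  assert (0 <= rpow 2 p * INR J0) by (apply Rmult_le_pos; assumption).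
  assert (0 <= INR N * arc_const c p) by (apply Rmult_le_pos; assumption).
  assert (0 <= INR N * rpow 2 p) by (apply Rmult_le_pos; assumption).
  unfold walk_const, thick_const. lra.
Qed.

Lemma H1_le_nonneg {X : Banach} (E : X -> Prop) M : H1_le E M -> 0 <= M.
Proof.
  intros H. apply le_epsilon. intros eps He.
  destruct (H 1 eps ltac:(lra) ltac:(lra)) as [U [d [_ [Hd [_ Hs]]]]].
  specialize (Hs 0%nat). simpl in Hs. specialize (Hd 0%nat). lra.
Qed.

Lemma net_mono {X : Banach} (Xk : Z -> X -> Prop) : (forall k x, Xk k x -> Xk (k + 1)%Z x) ->
  forall j k x, Xk k x -> Xk (k + Z.of_nat j)%Z x.
Proof.
  intros H. induction j as [|j IH]; intros k x Hx; [rewrite Z.add_0_r; assumption|].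
  replace (k + Z.of_nat (S j))%Z with (k + Z.of_nat j + 1)%Z by lia. auto.
Qed.

(** A ball has diameter 2 A times its net scale and the walk, with steps [2 * rho], has the budget
    16 M, whence 32 A. The 48 covers the extent of the walk and the net errors at [x] and [y]. *)
Lemma multiresolution_sum (X : Banach) (c p A : R) (N J0 : nat) :
  2 <= p -> 0 < c -> power_convex X c p -> 1 < A ->
  32 * near_factor A + 64 <= INR N -> 16 * (2 * near_factor A + 2) <= 2 ^ J0 ->
  forall (Sigma : X -> Prop), connected Sigma ->
  forall (Xk : Z -> X -> Prop), multires_nets Sigma Xk ->
  forall (M : R), H1_le Sigma M ->
  forall (F : list (Z * X)), NoDup F -> (forall kx, In kx F -> Xk (fst kx) (snd kx)) ->
  forall x y, Sigma x -> Sigma y ->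
    Bdist x y + beta_sum Sigma p A F <= (48 + 32 * A * walk_const c p N J0) * M.
Proof.
  intros Hp Hc Hconv HA HN HJ Sigma Hconn Xk [Hnest Hnet] M HM F HF HFX x y Sx Sy.
  pose proof (H1_le_nonneg Sigma M HM) as HM0.
  pose proof (walk_const_nonneg c p N J0) as Hwc.
  assert (HCM : 0 <= A * walk_const c p N J0 * M) by (apply Rmult_le_pos; [apply Rmult_le_pos; lra|assumption]).
  assert (P2 : forall k, 0 < powerRZ 2 k) by (intros; apply powerRZ_lt; lra).
  assert (HR : forall k, 0 < A * powerRZ 2 k) by (intros; apply Rmult_lt_0_compat; [lra|apply P2]).
  set (be := fun kx : Z * X => beta Sigma (mr_ball A kx)).
  assert (HS : forall kx, In kx F -> Sigma (snd kx)).
  { intros kx Hkx. destruct (Hnet (fst kx)) as [H _]. apply H, HFX; assumption. }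
  assert (Hbe : forall kx, In kx F -> 0 <= be kx /\
    (0 < be kx -> forall a v : X, v <> Bzero -> exists z, Sigma z /\ Bdist z (snd kx) <= A * powerRZ 2 (- fst kx) /\
       forall s, 3 / 2 * be kx * (A * powerRZ 2 (- fst kx)) <= Bdist z (Badd a (Bscal s v)))).
  { intros kx Hkx. apply (beta_ball Sigma (snd kx) (A * powerRZ 2 (- fst kx))); auto. }
  assert (Hsum : beta_sum Sigma p A F = lsum (fun kx => 2 * A * (rpow (be kx) p * powerRZ 2 (- fst kx))) F).
  { unfold beta_sum, lsum, be. clear HF HFX HS Hbe. induction F as [|kx F IH]; [reflexivity|]. cbn [fold_right]. rewrite IH.
    unfold mr_ball at 2. rewrite diam_closed_ball by apply HR. ring. }
  rewrite lsum_scal in Hsum.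
  destruct (classic (exists p1 q1, Sigma p1 /\ Sigma q1 /\ p1 <> q1)) as [[p1 [q1 [Sp [Sq Hpq]]]]|Hsingle].
  (* For a single point a line through it misses nothing, so no beta is positive. *)
  2:{ assert (Heq : forall u v, Sigma u -> Sigma v -> u = v).
      { intros u v Hu Hv. apply NNPP. intros Hne. apply Hsingle. eauto. }
      rewrite (Heq x y Sx Sy), Bdist_refl, Hsum.
      assert (E : lsum (fun kx => rpow (be kx) p * powerRZ 2 (- fst kx)) F <= lsum (fun _ => 0) F).
      { apply lsum_le. intros kx Hkx. destruct (Hbe kx Hkx) as [B0 B1].
        destruct (Req_dec (be kx) 0) as [->|Hne]; [rewrite rpow_0; lra|]. exfalso.
        destruct (nonzero_vector (X := X)) as [v Hv].
        destruct (B1 ltac:(lra) (snd kx) v Hv) as [z [Sz [_ Lz]]]. specialize (Lz 0).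
        rewrite (Heq z (snd kx) Sz (HS kx Hkx)) in Lz.
        replace (Badd (snd kx) (Bscal 0 v)) with (snd kx) in Lz by vlin. rewrite Bdist_refl in Lz.
        specialize (HR (- fst kx)%Z). nra. }
      rewrite lsum_const in E. nra. }
  destruct (list_Z_bound fst F) as [kmax Hkmax].
  (* Counting down from a bound on the generations makes radii double with the index. *)
  set (idx := fun kx : Z * X => Z.to_nat (kmax - fst kx)).
  destruct (list_Z_bound (fun kx => Z.of_nat (idx kx)) F) as [I0 HI0].
  set (I := S (Z.to_nat I0)).
  assert (HI : forall kx, In kx F -> (idx kx < I)%nat).
  { intros kx Hkx. specialize (HI0 kx Hkx). unfold I. lia. }
  set (r0 := powerRZ 2 (- kmax)). assert (Hr0 : 0 < r0) by apply P2.
  assert (Hrad : forall kx, In kx F -> powerRZ 2 (- fst kx) = rad r0 (idx kx)).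
  { intros kx Hkx. specialize (Hkmax kx Hkx). unfold rad, r0. rewrite pow_powerRZ.
    rewrite <- powerRZ_add by lra. f_equal. unfold idx. lia. }
  destruct (list_positive_bound be F) as [bmin [Hbmin HbF]].
  pose proof (Bdist_pos p1 q1 Hpq) as Hd1.
  (* The three bounds serve [net_walk], the hypothesis [r0_rho] and the hypothesis [b_large]; the
     last two are applied to the step size [2 * rho]. *)
  set (eps := Rmin (Bdist p1 q1) (Rmin (r0 / 32) (bmin * r0 / 200000))).
  assert (Heps : 0 < eps).
  { unfold eps. apply Rmin_glb_lt; [assumption|]. apply Rmin_glb_lt; [lra|]. nra. }
  destruct (pow_lt_1_zero (/ 2) ltac:(rewrite Rabs_pos_eq; lra) (eps / r0) ltac:(apply Rdiv_lt_0_compat; assumption)) as [m Hm].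
  specialize (Hm m (Nat.le_refl _)). rewrite pow_inv in Hm.
  assert (H2m : 0 < 2 ^ m) by (apply pow_lt; lra).
  rewrite Rabs_pos_eq in Hm by (left; apply Rinv_0_lt_compat; assumption).
  (* The net underlying the walk is taken from the given family, so by nesting it contains the
     centres of all balls in [F]. *)
  set (K := (kmax + Z.of_nat m)%Z).
  set (rho := powerRZ 2 (- K)). assert (Hrho : 0 < rho) by apply P2.
  assert (Erho : rho * 2 ^ m = r0).
  { unfold rho, r0, K. rewrite pow_powerRZ, <- powerRZ_add by lra. f_equal. lia. }
  assert (Hrho_eps : rho <= eps).
  { replace rho with (r0 * / 2 ^ m) by (rewrite <- Erho; field; lra).
    apply Rmult_le_reg_r with (/ r0); [apply Rinv_0_lt_compat; assumption|].
    replace (r0 * / 2 ^ m * / r0) with (/ 2 ^ m) by (field; lra). unfold Rdiv in Hm. lra. }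
  pose proof (Rmin_l (Bdist p1 q1) (Rmin (r0 / 32) (bmin * r0 / 200000))) as E1.
  pose proof (Rmin_r (Bdist p1 q1) (Rmin (r0 / 32) (bmin * r0 / 200000))) as E2.
  pose proof (Rmin_l (r0 / 32) (bmin * r0 / 200000)) as E3.
  pose proof (Rmin_r (r0 / 32) (bmin * r0 / 200000)) as E4.
  fold eps in E1, E2.
  destruct (net_walk Sigma M rho (Xk K) p1 q1 Hconn HM Hrho Sp Sq ltac:(lra) (Hnet K))
    as [gam [n [G1 [G2 [G3 G4]]]]].
  destruct (Hnet K) as [NK1 [NK2 NK3]]. fold rho in NK2, NK3.
  set (tidx := fun z : X => least (fun i => (i < n)%nat /\ gam i = z) 0).
  assert (Htidx : forall kx, In kx F -> (tidx (snd kx) < n)%nat /\ gam (tidx (snd kx)) = snd kx).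
  { intros kx Hkx. apply least_spec, G3.
    pose proof (net_mono Xk Hnest (Z.to_nat (K - fst kx)) (fst kx) (snd kx) (HFX kx Hkx)) as H.
    specialize (Hkmax kx Hkx). replace (fst kx + Z.of_nat (Z.to_nat (K - fst kx)))%Z with K in H by (unfold K; lia).
    exact H. }
  set (L := fun i => map (fun kx => tidx (snd kx)) (sel (fun kx => idx kx = i) F)).
  set (b := fun i t => be ((kmax - Z.of_nat i)%Z, gam t)).
  assert (HL : forall i t, In t (L i) -> exists kx, In kx F /\ idx kx = i /\ tidx (snd kx) = t /\ b i t = be kx /\
     gam t = snd kx /\ (t < n)%nat).
  { intros i t Ht. apply in_map_iff in Ht. destruct Ht as [kx [<- Hkx]]. apply In_sel in Hkx. destruct Hkx as [Hkx Ei].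
    destruct (Htidx kx Hkx) as [T1 T2]. exists kx. repeat split; try assumption.
    unfold b. rewrite T2. f_equal. rewrite <- Ei. unfold idx. specialize (Hkmax kx Hkx).
    rewrite Z2Nat.id by lia. destruct kx as [k z]; simpl. f_equal. lia. }
  assert (Hinj : forall kx kx', In kx F -> In kx' F -> idx kx = idx kx' -> snd kx = snd kx' -> kx = kx').
  { intros [k z] [k' z'] H1 H2 Ei Es. simpl in Es. subst z'. f_equal.
    pose proof (Hkmax _ H1). pose proof (Hkmax _ H2). unfold idx in Ei. simpl in *. lia. }
  assert (Hell : INR (S n) * (2 * rho) <= 16 * M) by lra.
  pose proof (walk_sum gam n (2 * rho) c p A r0 I L b bmin N J0 Hp Hc Hconv HA ltac:(lra) ltac:(lra) G1 HN HJ) as W.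
  assert (Htotal : psum (fun i => lsum (fun t => rpow (b i t) p * rad r0 i) (L i)) I <= walk_const c p N J0 * (16 * M)).
  { eapply Rle_trans; [apply W|apply Rmult_le_compat_l; assumption].
    - intros i _. apply NoDup_map_inj_in; [apply NoDup_sel; assumption|].
      intros kx kx' H1 H2 E. apply In_sel in H1, H2. destruct H1 as [H1 I1], H2 as [H2 I2].
      apply Hinj; try assumption; [congruence|].
      destruct (Htidx kx H1) as [_ T1]. destruct (Htidx kx' H2) as [_ T2]. congruence.
    - intros i t _ Ht. destruct (HL i t Ht) as [kx Hkx]. tauto.
    - intros i s t _ Hs Ht Hst.
      destruct (HL i s Hs) as [kx [F1 [I1 [T1 [_ [S1 _]]]]]]. destruct (HL i t Ht) as [kx' [F2 [I2 [T2 [_ [S2 _]]]]]].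
      rewrite S1, S2, <- I1, <- Hrad by assumption.
      assert (Ek : fst kx = fst kx').
      { pose proof (Hkmax _ F1). pose proof (Hkmax _ F2). unfold idx in *. lia. }
      destruct (Hnet (fst kx)) as [_ [Hsep _]]. apply Rge_le, Hsep.
      + apply HFX; assumption.
      + rewrite Ek. apply HFX; assumption.
      + intros E. apply Hst. rewrite <- T1, <- T2, E. reflexivity.
    - intros i t _ Ht. destruct (HL i t Ht) as [kx [F1 [_ [_ [-> _]]]]]. apply Hbe; assumption.
    - intros i t _ Ht a w Hw. destruct (HL i t Ht) as [kx [F1 [I1 [T1 [-> [S1 Ln]]]]]].
      rewrite S1, <- I1, <- Hrad by assumption.
      destruct (Hbe kx F1) as [B0 B1]. pose proof (HR (- fst kx)%Z) as HRk.
      destruct (Req_dec (be kx) 0) as [E0|E0].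
      + exists t. rewrite S1, E0, Bdist_refl. split; [lia|]. split; [lra|]. intros s.
        rewrite !Rmult_0_l. apply Bdist_nonneg.
      + destruct (B1 ltac:(lra) a w Hw) as [z [Sz [Dz Lz]]].
        destruct (NK3 z Sz) as [z' [Xz' Dz']]. destruct (G3 z' Xz') as [j [Hj <-]].
        exists j. split; [lia|].
        assert (Hb : bmin <= be kx) by (apply HbF; [assumption|lra]).
        assert (Hr : r0 <= powerRZ 2 (- fst kx)).
        { rewrite Hrad by assumption. unfold rad. assert (1 <= 2 ^ idx kx) by (apply pow_R1_Rle; lra). nra. }
        (* Moving to a net point costs at most half of beta times the radius, which reduces the 3/2
           of [beta_ball] to the 1 in [b_line]. *)
        assert (Hsmall : rho <= be kx * (A * powerRZ 2 (- fst kx)) / 2 /\ rho <= A * powerRZ 2 (- fst kx)).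
        { set (q := powerRZ 2 (- fst kx)) in *.
          assert (bmin * r0 <= be kx * (A * q)) by (apply Rmult_le_compat; nra).
          split; [lra|nra]. }
        rewrite (Bdist_sym z) in Dz'. split.
        * pose proof (Bdist_triangle (gam j) z (snd kx)). lra.
        * intros s. specialize (Lz s). pose proof (Bdist_triangle z (gam j) (Badd a (Bscal s w))) as T.
          rewrite (Bdist_sym z (gam j)) in T. lra.
    - intros i t _ Ht Hb. destruct (HL i t Ht) as [kx [F1 [_ [_ [E _]]]]]. rewrite E in *.
      pose proof (HbF kx F1 Hb) as HbF'. split; [assumption|].
      assert (bmin * r0 <= be kx * r0) by (apply Rmult_le_compat_r; lra). lra.
    - assumption. }
  assert (Hpart : lsum (fun kx => rpow (be kx) p * powerRZ 2 (- fst kx)) F =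
    psum (fun i => lsum (fun t => rpow (b i t) p * rad r0 i) (L i)) I).
  { rewrite (lsum_partition idx _ F I HI). apply psum_ext. intros i _. unfold L. rewrite lsum_map.
    apply Rle_antisym; apply lsum_le; intros kx Hkx; apply In_sel in Hkx; destruct Hkx as [Hkx Ei];
    (destruct (HL i (tidx (snd kx))) as [kx' [F1 [I1 [T1 [Eb [S1 _]]]]]];
      [unfold L; apply in_map_iff; exists kx; split; [reflexivity|apply In_sel; auto]|]);
    (assert (kx' = kx) by (apply Hinj; try assumption; [congruence|];
       destruct (Htidx kx Hkx) as [_ T2]; congruence)); subst kx';
    rewrite Eb, Hrad, Ei by assumption; lra. }
  assert (Hdist : Bdist x y <= 48 * M).
  { destruct (NK3 x Sx) as [x' [Xx Dx]]. destruct (NK3 y Sy) as [y' [Xy Dy]].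
    destruct (G3 x' Xx) as [i [Hi <-]]. destruct (G3 y' Xy) as [j [Hj <-]].
    pose proof (walk_dist gam n (2 * rho) ltac:(lra) G1 i j ltac:(lia) ltac:(lia)) as Wd.
    pose proof (Bdist_triangle x (gam i) y) as T1. pose proof (Bdist_triangle (gam i) (gam j) y) as T2.
    rewrite (Bdist_sym (gam j) y) in T2.
    assert (2 * rho <= INR (S n) * (2 * rho)).
    { rewrite S_INR. pose proof (pos_INR n). nra. }
    lra. }
  rewrite Hsum, Hpart.
  assert (2 * A * psum (fun i => lsum (fun t => rpow (b i t) p * rad r0 i) (L i)) I <= 2 * A * (walk_const c p N J0 * (16 * M))).
  { apply Rmult_le_compat_l; lra. }
  lra.
Qed.

Theorem mainTheorem5 :
  forall (p : R), 2 <= p ->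
  forall (A : R), 1 < A ->
  forall (delta0 : R -> R),
  exists C : R,
    forall (X : Banach),
      is_modulus_of_convexity X delta0 ->
      uniformly_convex_mod delta0 ->
      convexity_power_type delta0 p ->
      forall (Sigma : X -> Prop), connected Sigma ->
      forall (Xk : Z -> X -> Prop), multires_nets Sigma Xk ->
      forall (M : R), H1_le Sigma M ->
      (* S_{Sigma,p}(H) = diam Sigma + sum_{Q in H} beta^p diam Q <= C * M,
         the (possibly infinite) sum being the sup of its finite partial sums *)
      forall (F : list (Z * X)), NoDup F -> (forall kx, In kx F -> Xk (fst kx) (snd kx)) ->
      forall x y, Sigma x -> Sigma y ->
        Bdist x y + beta_sum Sigma p A F <= C * M.
Proof.
  intros p Hp A HA delta0.
  (* The constant has to be fixed before the space; without power type no space satisfies the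
     hypotheses and any constant will do. *)
  destruct (classic (convexity_power_type delta0 p)) as [[c0 [Hc0 Hpow]]|Hno].
  2:{ exists 0. intros X _ _ H. contradiction. }
  set (c := Rmin (1 / 4) (c0 / 2) / rpow 2 p).
  assert (Hc : 0 < c).
  { unfold c. apply Rdiv_lt_0_compat; [apply Rmin_glb_lt; lra|apply rpow_pos; lra]. }
  destruct (INR_unbounded (32 * near_factor A + 64)) as [N HN].
  destruct (Pow_x_infinity 2 ltac:(rewrite Rabs_pos_eq; lra) (16 * (2 * near_factor A + 2))) as [J0 HJ].
  specialize (HJ J0 (Nat.le_refl _)). rewrite Rabs_pos_eq in HJ by (apply pow_le; lra).
  exists (48 + 32 * A * walk_const c p N J0).
  intros X Hmod _ _ Sigma Hconn Xk Hnets M HM F HF HFX x y Sx Sy.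
  apply (multiresolution_sum X c p A N J0 Hp Hc) with (Xk := Xk); try assumption; try lra.
  apply (power_convex_of_modulus X delta0 c0 p Hp Hc0 Hmod Hpow).
Qed.
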